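(* Let $V$ be a finite vertex set, $\Pi$ a partition of $V$, $\mathbf{d}$ a sequence of $|V|$ positive integers (prescribed degrees of the vertices of $V$), and let $\mathcal{S}=(\Pi;\mathcal{B})$ be a connected loopless skeleton graph with at most one cycle (weights not specified). Then one can find in polynomial time all weight functions $w$ on $\mathcal{B}$ for which there exist realizations of $\mathbf{d}$ that are consistent with the skeleton graph $(\Pi;\mathcal{B},w)$, along with at least one such consistent realization for each of these weight functions.
   Context: Graphs are finite and simple. A realization of $\mathbf{d}$ is a simple graph on $V$ in which every vertex has its prescribed degree. A (loopless) skeleton graph $(\Pi;\mathcal{B},w)$ is a simple graph whose vertices are the classes of the partition $\Pi$ of $V$, whose edge set is $\mathcal{B}$ (edges are called bones), together with a weight function $w$ assigning a nonnegative integer to each bone; $w(UW)=0$ by convention if $UW$ is not a bone (including $U=W$). A realization $G$ of $\mathbf{d}$ is consistent with $(\Pi;\mathcal{B},w)$ if for all distinct $U,W\in\Pi$ the number of edges of $G$ between $U$ and $W$ equals $w(UW)$, and no edge of $G$ lies inside a class. *)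

(* Defs.v *)
From HB Require Import structures.
From mathcomp Require Import all_boot all_order all_algebra.
Set Implicit Arguments. Unset Strict Implicit. Unset Printing Implicit Defensive.

(** A simple graph is given by its vertex set [A] and its set [E] of edges, an
    edge being a two-element subset of [A]. *)

Section Graphs.
Variable T : finType.
Implicit Types (A U W : {set T}) (E : {set {set T}}) (s : seq T).

Definition simple_graph A E : Prop :=
  forall e, e \in E -> #|e| = 2 /\ e \subset A.

Definition adj E : rel T := fun x y => [set x; y] \in E.

Definition degree E (v : T) : nat := #|[set e in E | v \in e]|.

Definition edges_between E U W : {set {set T}} :=
  [set e in E | [exists u in U, exists v in W, e == [set u; v]]].

Definition connected_graph A E : Prop :=
  {in A &, forall x y, connect (adj E) x y}.

Definition is_cycle E s : Prop := 3 <= size s /\ ucycle (adj E) s.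

Definition cycle_edges s : {set {set T}} := [set [set x; next s x] | x in s].

(* A cycle is a subgraph: sequences that differ by a rotation or a reversal
   describe the same cycle, so cycles are compared by their edge sets. *)
Definition at_most_one_cycle E : Prop :=
  forall s1 s2, is_cycle E s1 -> is_cycle E s2 ->
    cycle_edges s1 = cycle_edges s2.

End Graphs.

(** A skeleton graph has the classes of a partition [Pi] of [V] as vertices, so
    a bone is an unordered pair [[set U; W]] of classes. *)

Section Skeletons.
Variable V : finType.
Implicit Types (Pi : {set {set V}}) (B : {set {set {set V}}}).
Implicit Types (w : {ffun {set {set V}} -> nat}) (E : {set {set V}}).

(* [w] is extended by zero outside the bones; this covers the convention
   w(UU) = 0, as [[set U; U]] is not a two-element set. *)
Definition weight_function B w : Prop := forall b, b \notin B -> w b = 0.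

Definition realization (d : V -> nat) E : Prop :=
  simple_graph [set: V] E /\ forall v, degree E v = d v.

Definition consistent Pi w E : Prop :=
  {in Pi &, forall U W, U != W -> #|edges_between E U W| = w [set U; W]} /\
  forall e U, e \in E -> U \in Pi -> ~~ (e \subset U).

Definition consistent_realization Pi B (d : V -> nat) w E : Prop :=
  [/\ weight_function B w, realization d E & consistent Pi w E].

End Skeletons.

(** Model of computation: the WHILE language over binary trees (N. D. Jones,
    Computability and Complexity).  Evaluating an expression costs the total
    size of the values of all its subexpressions, not one unit per operation:
    no value or output can then be larger than what has been paid for, and
    running times are polynomially related to those of Turing machines. *)

Inductive data : Type := Leaf | Node of data & data.

Fixpoint dsize (t : data) : nat :=
  if t is Node l r then (dsize l + dsize r).+1 else 1.

Fixpoint data_eqb (a b : data) : bool :=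
  match a, b with
  | Leaf, Leaf => true
  | Node a1 a2, Node b1 b2 => data_eqb a1 b1 && data_eqb a2 b2
  | _, _ => false
  end.

Definition enc_bool (b : bool) : data := if b then Node Leaf Leaf else Leaf.

Inductive expr : Type :=
  | Var of nat
  | Nil
  | Cons of expr & expr
  | Hd of expr
  | Tl of expr
  | Eq of expr & expr.

Inductive cmd : Type :=
  | Skip
  | Assign of nat & expr
  | Seq of cmd & cmd
  | If of expr & cmd & cmd
  | While of expr & cmd.

Definition store := nat -> data.

Definition update (s : store) (x : nat) (t : data) : store :=
  fun y => if y == x then t else s y.

Fixpoint eval (s : store) (e : expr) : data :=
  match e with
  | Var x => s x
  | Nil => Leaf
  | Cons e1 e2 => Node (eval s e1) (eval s e2)
  | Hd e1 => if eval s e1 is Node l _ then l else Leaf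
  | Tl e1 => if eval s e1 is Node _ r then r else Leaf
  | Eq e1 e2 => enc_bool (data_eqb (eval s e1) (eval s e2))
  end.

Fixpoint eval_cost (s : store) (e : expr) : nat :=
  dsize (eval s e) +
  match e with
  | Var _ | Nil => 0
  | Cons e1 e2 | Eq e1 e2 => eval_cost s e1 + eval_cost s e2
  | Hd e1 | Tl e1 => eval_cost s e1
  end.

(* [exec c s s' t]: started in [s], [c] halts in [s'] after time [t].  The test
   of a conditional or a loop holds when its value is not [Leaf]. *)
Inductive exec : cmd -> store -> store -> nat -> Prop :=
  | ExecSkip s : exec Skip s s 1
  | ExecAssign s x e :
      exec (Assign x e) s (update s x (eval s e)) (eval_cost s e)
  | ExecSeq c1 c2 s1 s2 s3 t1 t2 :
      exec c1 s1 s2 t1 -> exec c2 s2 s3 t2 -> exec (Seq c1 c2) s1 s3 (t1 + t2)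
  | ExecIfTrue e c1 c2 s s' t :
      eval s e <> Leaf -> exec c1 s s' t ->
      exec (If e c1 c2) s s' (eval_cost s e + t)
  | ExecIfFalse e c1 c2 s s' t :
      eval s e = Leaf -> exec c2 s s' t ->
      exec (If e c1 c2) s s' (eval_cost s e + t)
  | ExecWhileTrue e c s1 s2 s3 t1 t2 :
      eval s1 e <> Leaf -> exec c s1 s2 t1 -> exec (While e c) s2 s3 t2 ->
      exec (While e c) s1 s3 (eval_cost s1 e + t1 + t2)
  | ExecWhileFalse e c s :
      eval s e = Leaf -> exec (While e c) s s (eval_cost s e).

Definition init_store (x : data) : store := update (fun=> Leaf) 0 x.

(* Variable 0 holds the input at the start and the output at the end. *)
Definition computes (p : cmd) (x y : data) (t : nat) : Prop :=
  exists2 s, exec p (init_store x) s t & s 0 = y.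

Definition enc_seq (T : Type) (f : T -> data) (s : seq T) : data :=
  foldr (fun x t => Node (f x) t) Leaf s.

Fixpoint pos_bits (p : BinNums.positive) : seq bool :=
  match p with
  | BinNums.xH => [:: true]
  | BinNums.xO p' => false :: pos_bits p'
  | BinNums.xI p' => true :: pos_bits p'
  end.

(* Binary notation, least significant bit first; zero has no bits. *)
Definition nat_bits (n : nat) : seq bool :=
  if bin_of_nat n is BinNums.Npos p then pos_bits p else [::].

Definition enc_nat (n : nat) : data := enc_seq enc_bool (nat_bits n).

(* The matrix with rows and columns indexed by the list [r]. *)
Definition table (I T : Type) (f : I -> I -> T) (r : seq I) : seq (seq T) :=
  [seq [seq f i j | j <- r] | i <- r].

Definition enc_matrix (T : Type) (f : T -> data) (m : seq (seq T)) : data :=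
  enc_seq (enc_seq f) m.

(** [vs] and [cs] list the vertices and the classes; these orders fix the
    meaning of positions in the input and in the output. *)

Section Encodings.
Variables (V : finType) (vs : seq V) (cs : seq {set V}).

(* Degree sequence, incidence matrix of the classes, adjacency matrix of the
   skeleton graph. *)
Definition enc_instance (d : V -> nat) (B : {set {set {set V}}}) : data :=
  Node (enc_seq enc_nat [seq d v | v <- vs])
    (Node (enc_matrix enc_bool [seq [seq v \in U | v <- vs] | U : {set V} <- cs])
          (enc_matrix enc_bool (table (adj B) cs))).

Definition enc_weight (w : {ffun {set {set V}} -> nat}) : data :=
  enc_matrix enc_nat (table (fun U W => w [set U; W]) cs).

Definition enc_graph (E : {set {set V}}) : data :=
  enc_matrix enc_bool (table (adj E) vs).

Definition enc_output
    (L : seq ({ffun {set {set V}} -> nat} * {set {set V}})) : data :=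
  enc_seq (fun wE => Node (enc_weight wE.1) (enc_graph wE.2)) L.

End Encodings.

(* Main.v *)
(** Guess one bone [b0] and its weight.  For the right guess, the skeleton without
    [b0] is a forest, so the degrees determine all other weights; hence it suffices to
    find, for every guess, one realization that has the guessed weight on [b0].
    Realizations are found edge by edge, by deciding each time whether the choices made
    so far can be completed.

    The decision is a linear programming relaxation: maximising a linear form over the
    box [0,1]^edges is trivial, so the Frank-Wolfe method minimises the squared distance
    of the vector of degrees and of the weight of [b0] to its target, with error
    1/poly after poly many steps.  An approximate fractional solution can be rounded.
    Let F be its set of fractional edges and X the set of vertices covered by F.
    An edge that is alone in F at a vertex is nearly integral, and is rounded.  Otherwise
    |F| >= |X|.  The forest is 2-colourable, so signs on the vertices give a linear
    relation between the |X| degree rows and the row of [b0]; hence either F supports a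
    kernel vector, along which one moves until an edge becomes integral, or |F| = |X| and
    one can move to an exact solution.  In an exact solution that is stuck, F is 2-regular
    and has two edges in [b0]; as vertices of a class have the same possible neighbours,
    there is a possible edge f outside F inside X, and moving along a kernel vector
    supported by F + f decreases the number of fractional edges. *)

Require Import Defs.
From Corelib Require PosDef.
From HB Require Import structures.
From mathcomp Require Import all_boot all_order all_algebra.
From mathcomp Require Import zify lra ring.
Set Implicit Arguments. Unset Strict Implicit. Unset Printing Implicit Defensive.
Import Order.TTheory GRing.Theory Num.Theory.

(** * Polynomial-time programs *)

(** Fractional solutions alone do not decide feasibility. In a triangle of bones with two vertices
    in each class and all degrees one, two disjoint triangles of edges at one half meet every degree
    and give each bone the integral weight one, and they support no kernel vector. If exactly these
    six pairs were still possible, there would be no realization. The rounding escapes only through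
    a pair joining the two triangles, so such pairs must not have been excluded by earlier choices.
    This dictates the order of the choices: all pairs at one vertex are decided before those at the
    next. Between later vertices every pair allowed by the skeleton is then still open, and only the
    vertex in progress is irregular; the exchange of twins copes with one such vertex by choosing
    which twin copies the other. *)

Class encodable (A : Type) := enc : A -> data.

#[global] Instance encodable_bool : encodable bool := enc_bool.
(* Numbers are kept in unary inside the program. *)
#[global] Instance encodable_nat : encodable nat := fun n => iter n (Node Leaf) Leaf.
#[global] Instance encodable_prod A B (_ : encodable A) (_ : encodable B) :
  encodable (A * B) := fun p => Node (enc p.1) (enc p.2).
#[global] Instance encodable_seq A (_ : encodable A) : encodable (seq A) :=
  enc_seq enc.

Lemma dsize_gt0 t : 0 < dsize t. Proof. by case: t. Qed.

Section PolynomialBounds.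
Context {A : Type} {EA : encodable A}.
Implicit Types g h : A -> nat.

(* One power is enough, as the base is at least two. *)
Definition pbounded g := exists k, forall x, g x <= (dsize (enc x)).+1 ^ k.

Lemma pbounded_le g h : pbounded h -> (forall x, g x <= h x) -> pbounded g.
Proof. by case=> k Hk Hgh; exists k => x; apply: leq_trans (Hgh x) (Hk x). Qed.

Lemma pbounded_cst c : pbounded (fun=> c).
Proof.
exists c => x; apply: leq_trans (ltnW (ltn_expl c (isT : 1 < 2))) _.
by case: c => // c; rewrite leq_exp2r // ltnS dsize_gt0.
Qed.

Lemma pbounded_dsize : pbounded (fun x => dsize (enc x)).
Proof. by exists 1 => x; rewrite expn1. Qed.

Lemma pbounded_mul g h :
  pbounded g -> pbounded h -> pbounded (fun x => g x * h x).
Proof. by move=> [k Hk] [l Hl]; exists (k + l) => x; rewrite expnD leq_mul. Qed.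

(** A sum is reduced to a product, as powers of one base multiply by adding exponents. *)
Lemma pbounded_add g h :
  pbounded g -> pbounded h -> pbounded (fun x => g x + h x).
Proof.
move=> Hg Hh; apply: (@pbounded_le _ (fun x => (g x).+1 * (h x).+1)); last first.
  by move=> x; rewrite mulSn mulnS; lia.
have S f : pbounded f -> pbounded (fun x => (f x).+1).
  move=> [k Hk]; exists k.+1 => x; rewrite expnS.
  have Hp : 0 < (dsize (enc x)).+1 ^ k by rewrite expn_gt0.
  apply: (@leq_trans (2 * (dsize (enc x)).+1 ^ k)); last by rewrite leq_mul2r ltnS dsize_gt0 orbT.
  by have := Hk x; lia.
by apply: pbounded_mul; apply: S.
Qed.

Lemma pbounded_exp g k : pbounded g -> pbounded (fun x => g x ^ k).
Proof.
move=> Hg; elim: k => [|k IH]; first exact: (pbounded_cst 1).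
by apply: (@pbounded_le _ (fun x => g x * g x ^ k)) => [|x]; [exact: pbounded_mul | rewrite expnS].
Qed.

Lemma pbounded_S g : pbounded g -> pbounded (fun x => (g x).+1).
Proof.
by move=> Hg; apply: (pbounded_le (pbounded_add Hg (pbounded_cst 1))) => x; rewrite addn1.
Qed.
End PolynomialBounds.

Section PolynomialTime.
Context {A B : Type} {EA : encodable A} {EB : encodable B}.

(* The command may use the registers from [n] on; the lower ones are kept,
   which lets programs be composed without renaming. *)
Definition ptime (f : A -> B) :=
  exists2 c : nat -> cmd, exists2 T : A -> nat, pbounded T &
    forall x n s, s n = enc x -> exists s' t,
      [/\ exec (c n) s s' t, s' n = enc (f x),
          (forall m, m < n -> s' m = s m) & t <= T x]
  & pbounded (fun x => dsize (enc (f x))).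

Lemma ptime_ext (f g : A -> B) : ptime f -> f =1 g -> ptime g.
Proof.
move=> [c [T HT Hc] Hs] E; exists c; last by apply: (pbounded_le Hs) => x; rewrite E.
by exists T => // x n s; rewrite -E; apply: Hc.
Qed.

Lemma pbounded_ptime (f : A -> B) : ptime f -> pbounded (fun x => dsize (enc (f x))).
Proof. by case. Qed.

Lemma pbounded_comp (g : B -> nat) (f : A -> B) :
  pbounded g -> pbounded (fun x => dsize (enc (f x))) -> pbounded (fun x => g (f x)).
Proof.
move=> [k Hk] Hf; apply: (@pbounded_le _ _ _ (fun x => (dsize (enc (f x))).+1 ^ k)) => //.
by apply: pbounded_exp; apply: pbounded_S.
Qed.
End PolynomialTime.

Fixpoint expr_of_data (t : data) : expr :=
  if t is Node l r then Defs.Cons (expr_of_data l) (expr_of_data r) else Defs.Nil.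

Lemma eval_expr_of_data s t : eval s (expr_of_data t) = t.
Proof. by elim: t => //= l -> r ->. Qed.

Lemma eval_cost_expr_of_data s s' t :
  eval_cost s (expr_of_data t) = eval_cost s' (expr_of_data t).
Proof. by elim: t => //= l -> r ->; rewrite !eval_expr_of_data. Qed.

Lemma update_eq s x t : update s x t x = t.
Proof. by rewrite /update eqxx. Qed.

Lemma update_neq s x t y : y != x -> update s x t y = s y.
Proof. by rewrite /update => /negbTE->. Qed.

Lemma update_lt s x t y : y < x -> update s x t y = s y.
Proof. by move=> H; rewrite update_neq // neq_ltn H. Qed.

Section Combinators.
Context {A : Type} {EA : encodable A}.

Lemma ptime_expr {B} {EB : encodable B} (f : A -> B) (e : nat -> expr) (T : A -> nat) :
  pbounded T ->
  (forall x n s, s n = enc x -> eval s (e n) = enc (f x) /\ eval_cost s (e n) <= T x) ->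
  ptime f.
Proof.
move=> HT He; exists (fun n => Assign n (e n)).
  exists T => // x n s /He [E1 E2].
  exists (update s n (eval s (e n))), (eval_cost s (e n)); split => //.
  - by constructor.
  - by rewrite update_eq.
  - by move=> m Hm; rewrite update_lt.
apply: (pbounded_le HT) => x; have [<-] := He x 0 (fun=> enc x) erefl.
by apply: leq_trans; case: (e 0) => *; apply: leq_addr.
Qed.

Lemma ptime_id : ptime (fun x : A => x).
Proof.
apply: (@ptime_expr _ _ _ Var (fun x => dsize (enc x))); first exact: pbounded_dsize.
by move=> x n s /= ->; rewrite addn0.
Qed.

Lemma ptime_cst {B} {EB : encodable B} (b : B) : ptime (fun _ : A => b).
Proof.
apply: (@ptime_expr _ _ _ (fun=> expr_of_data (enc b))
  (fun x => eval_cost (fun=> Leaf) (expr_of_data (enc b)))); first exact: pbounded_cst.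
by move=> x n s _; rewrite eval_expr_of_data -(eval_cost_expr_of_data s).
Qed.

Lemma ptime_comp {B C} {EB : encodable B} {EC : encodable C} (g : B -> C) (f : A -> B) :
  ptime g -> ptime f -> ptime (fun x => g (f x)).
Proof.
move=> [cg [Tg HTg Hcg] Hsg] [cf [Tf HTf Hcf] Hsf].
exists (fun n => Seq (cf n) (cg n)); last exact: (pbounded_comp Hsg).
exists (fun x => Tf x + Tg (f x)).
  by apply: pbounded_add => //; apply: pbounded_comp.
move=> x n s /Hcf [s1 [t1 [X1 E1 P1 L1]]].
have [s2 [t2 [X2 E2 P2 L2]]] := Hcg _ _ _ E1.
exists s2, (t1 + t2); split => //; first exact: ExecSeq X1 X2.
  by move=> m Hm; rewrite P2 ?P1.
exact: leq_add.
Qed.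

Lemma ptime_pair {B C} {EB : encodable B} {EC : encodable C} (f : A -> B) (g : A -> C) :
  ptime f -> ptime g -> ptime (fun x => (f x, g x)).
Proof.
move=> [cf [Tf HTf Hcf] Hsf] [cg [Tg HTg Hcg] Hsg].
have Hs : pbounded (fun x => dsize (enc (f x, g x))).
  by apply: (pbounded_le (pbounded_S (pbounded_add Hsf Hsg))).
(* Register [n] keeps the input for the second call, and [n.+1] keeps the first result. *)
exists (fun n => Seq (Seq (Assign n.+1 (Var n)) (cf n.+1))
  (Seq (Seq (Assign n.+2 (Var n)) (cg n.+2)) (Assign n (Defs.Cons (Var n.+1) (Var n.+2))))) => //.
exists (fun x => dsize (enc x) + Tf x + (dsize (enc x) + Tg x +
  (dsize (enc (f x, g x)) + (dsize (enc (f x)) + dsize (enc (g x)))))).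
  do ?[apply: pbounded_add => //]; exact: pbounded_dsize.
move=> x n s E.
have [|s1 [t1 [X1 E1 P1 L1]]] := Hcf x n.+1 (update s n.+1 (enc x)).
  by rewrite update_eq.
have [|s2 [t2 [X2 E2 P2 L2]]] := Hcg x n.+2 (update s1 n.+2 (enc x)).
  by rewrite update_eq.
have E1' : s1 n = enc x by rewrite P1 // update_lt.
have E2' : s2 n.+1 = enc (f x) by rewrite P2 // update_lt.
exists (update s2 n (enc (f x, g x))); eexists; split.
- apply: ExecSeq; first apply: ExecSeq; [|exact: X1|].
    by have := ExecAssign s n.+1 (Var n); rewrite /= E; apply.
  apply: ExecSeq; first apply: ExecSeq; [|exact: X2|].
    by have := ExecAssign s1 n.+2 (Var n); rewrite /= E1'; apply.
  by have := ExecAssign s2 n (Defs.Cons (Var n.+1) (Var n.+2)); rewrite /= E2 E2'; apply.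
- by rewrite update_eq.
- by move=> m Hm; rewrite update_lt // P2 ?update_lt ?P1 ?update_lt //; lia.
- rewrite !addn0.
  by do ?[apply: leq_add => //].
Qed.

Lemma ptime_fst {B C} {EB : encodable B} {EC : encodable C} (f : A -> B * C) :
  ptime f -> ptime (fun x => (f x).1).
Proof.
apply: (ptime_comp (g := fst)).
have Hb : pbounded (fun p : B * C => dsize (enc p) + dsize (enc p)).
  by apply: pbounded_add; apply: pbounded_dsize.
exists (fun n => Assign n (Hd (Var n))); last by apply: (pbounded_le Hb) => -[b c] /=; lia.
exists (fun p : B * C => dsize (enc p) + dsize (enc p)) => // -[b c] n s E.
eexists _, _; split; first exact: ExecAssign.
- by rewrite update_eq /= E.
- by move=> m Hm; rewrite update_lt.
- by rewrite /= E /=; lia.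
Qed.

Lemma ptime_snd {B C} {EB : encodable B} {EC : encodable C} (f : A -> B * C) :
  ptime f -> ptime (fun x => (f x).2).
Proof.
apply: (ptime_comp (g := snd)).
have Hb : pbounded (fun p : B * C => dsize (enc p) + dsize (enc p)).
  by apply: pbounded_add; apply: pbounded_dsize.
exists (fun n => Assign n (Tl (Var n))); last by apply: (pbounded_le Hb) => -[b c] /=; lia.
exists (fun p : B * C => dsize (enc p) + dsize (enc p)) => // -[b c] n s E.
eexists _, _; split; first exact: ExecAssign.
- by rewrite update_eq /= E.
- by move=> m Hm; rewrite update_lt.
- by rewrite /= E /=; lia.
Qed.

Lemma ptime_if {B} {EB : encodable B} (b : A -> bool) (f g : A -> B) :
  ptime b -> ptime f -> ptime g -> ptime (fun x => if b x then f x else g x).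
Proof.
move=> [cb [Tb HTb Hcb] Hsb] [cf [Tf HTf Hcf] Hsf] [cg [Tg HTg Hcg] Hsg].
exists (fun n => Seq (Seq (Assign n.+1 (Var n)) (cb n.+1))
                     (If (Var n.+1) (cf n) (cg n))); last first.
  by apply: (pbounded_le (pbounded_add Hsf Hsg)) => x; case: (b x); lia.
exists (fun x => dsize (enc x) + Tb x + (dsize (enc (b x)) + (Tf x + Tg x))).
  do ?[apply: pbounded_add => //]; exact: pbounded_dsize.
move=> x n s E.
have [|s1 [t1 [X1 E1 P1 L1]]] := Hcb x n.+1 (update s n.+1 (enc x)).
  by rewrite update_eq.
have E1' : s1 n = enc x by rewrite P1 // update_lt.
have Ha : exec (Assign n.+1 (Var n)) s (update s n.+1 (enc x)) (dsize (enc x)).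
  by have := ExecAssign s n.+1 (Var n); rewrite /= addn0 E.
have P m : m < n -> s1 m = s m by move=> Hm; rewrite P1 ?update_lt //; lia.
case Eb: (b x) E1 => E1.
- have [s2 [t2 [X2 E2 P2 L2]]] := Hcf _ _ _ E1'.
  exists s2; eexists; split.
  + apply: ExecSeq; first exact: ExecSeq Ha X1.
    by apply: ExecIfTrue X2 => /=; rewrite E1.
  + by [].
  + by move=> m Hm; rewrite P2 ?P.
  + by rewrite /= E1 !addn0; do ?[apply: leq_add => //]; lia.
- have [s2 [t2 [X2 E2 P2 L2]]] := Hcg _ _ _ E1'.
  exists s2; eexists; split.
  + apply: ExecSeq; first exact: ExecSeq Ha X1.
    by apply: ExecIfFalse X2 => /=; rewrite E1.
  + by [].
  + by move=> m Hm; rewrite P2 ?P.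
  + by rewrite /= E1 !addn0; do ?[apply: leq_add => //]; lia.
Qed.
End Combinators.

Lemma dsize_cons {A} {EA : encodable A} a (l : seq A) :
  dsize (enc (a :: l)) = (dsize (enc a) + dsize (enc l)).+1.
Proof. by []. Qed.

Lemma dsize_pair {A B} {EA : encodable A} {EB : encodable B} (p : A * B) :
  dsize (enc p) = (dsize (enc p.1) + dsize (enc p.2)).+1.
Proof. by []. Qed.

Lemma size_dsize_seq {A} {EA : encodable A} (l : seq A) : size l < dsize (enc l).
Proof. by elim: l => // a l IH; rewrite dsize_cons; have := dsize_gt0 (enc a); rewrite /=; lia. Qed.

Lemma dsize_suffix {A} {EA : encodable A} (l1 l2 : seq A) :
  dsize (enc l2) <= dsize (enc (l1 ++ l2)).
Proof. by elim: l1 => // b l1 IH; rewrite cat_cons dsize_cons; lia. Qed.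

Section Foldl.
Context {X S A : Type} {EX : encodable X} {ES : encodable S} {EA : encodable A}.

(* Every intermediate state must be small, not only the final one. *)
Lemma ptime_foldl (f : X -> S -> A -> S) (s0 : X -> S) (l : X -> seq A) (b : X -> nat) :
  ptime (fun p : X * S * A => f p.1.1 p.1.2 p.2) -> ptime s0 -> ptime l ->
  pbounded b ->
  (forall x l1 l2, l x = l1 ++ l2 -> dsize (enc (foldl (f x) (s0 x) l1)) <= b x) ->
  ptime (fun x => foldl (f x) (s0 x) (l x)).
Proof.
move=> [cf [Tf HTf Hcf] Hsf] [ci [Ti HTi Hci] Hsi] [cl [Tq HTl Hcl] Hsl] Hb Hbound.
(* Register [n] holds [x], [n.+1] the rest of the list, [n.+2] the state, and [n.+3] the argument
   and the result of the loop body. *)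
exists (fun n => Seq (Seq (Seq (Assign n.+1 (Var n)) (cl n.+1))
                          (Seq (Assign n.+2 (Var n)) (ci n.+2)))
  (Seq (While (Var n.+1)
     (Seq (Seq (Assign n.+3 (Defs.Cons (Defs.Cons (Var n) (Var n.+2)) (Hd (Var n.+1)))) (cf n.+3))
          (Seq (Assign n.+2 (Var n.+3)) (Assign n.+1 (Tl (Var n.+1))))))
   (Assign n (Var n.+2)))); last first.
  by apply: (pbounded_le Hb) => x; apply: (Hbound x _ [::]); rewrite cats0.
case: HTf => kf Hkf.
pose sl x := dsize (encodable_seq EA (l x)).
(* [m] bounds, up to a constant, the argument of the loop body, and [U] the cost of one round. A
   list has fewer items than its size, so there are at most [sl x] rounds. *)
pose m x := (dsize (EX x) + b x).+1 + sl x.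
pose U x := sl x + (m x + (dsize (EX x) + b x).+1 + dsize (EX x) + b x + sl x + sl x
    + (m x).+2 ^ kf + (b x + (sl x + sl x))).
exists (fun x => (dsize (enc x) + Tq x + (dsize (enc x) + Ti x)) +
   (sl x * U x + sl x + b x)).
  have Hx : pbounded (fun x : X => dsize (enc x)) by apply: pbounded_dsize.
  have Hm : pbounded m by do ?[apply: pbounded_add => // | apply: pbounded_S].
  have HU : pbounded U.
    by do ?[apply: pbounded_add => // | apply: pbounded_S | apply: pbounded_exp].
  by do ?[apply: pbounded_add => // | apply: pbounded_mul => //].
move=> x n s E.
have [|s1 [t1 [X1 E1 P1 L1]]] := Hcl x n.+1 (update s n.+1 (enc x)).
  by rewrite update_eq.
have [|s2 [t2 [X2 E2 P2 L2]]] := Hci x n.+2 (update s1 n.+2 (enc x)).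
  by rewrite update_eq.
have E1n : s1 n = enc x by rewrite P1 // update_lt.
have E2n : s2 n = enc x by rewrite P2 // update_lt // ltnW.
have E2l : s2 n.+1 = enc (l x) by rewrite P2 // update_lt.
have Ha1 : exec (Assign n.+1 (Var n)) s (update s n.+1 (enc x)) (dsize (enc x)).
  by have := ExecAssign s n.+1 (Var n); rewrite /= addn0 E.
have Ha2 : exec (Assign n.+2 (Var n)) s1 (update s1 n.+2 (enc x)) (dsize (enc x)).
  by have := ExecAssign s1 n.+2 (Var n); rewrite /= addn0 E1n.
have P2' k : k < n -> s2 k = s k.
  by move=> Hk; rewrite P2 ?update_lt ?P1 ?update_lt //; lia.
set body := (Seq (Seq (Assign n.+3 _) _) _).
have loop : forall l2 l1 u, l x = l1 ++ l2 -> u n = enc x -> u n.+1 = enc l2 ->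
    u n.+2 = enc (foldl (f x) (s0 x) l1) ->
    exists u' t, [/\ exec (While (Var n.+1) body) u u' t,
      u' n.+2 = enc (foldl (f x) (s0 x) (l x)),
      (forall k, k < n -> u' k = u k) & t <= size l2 * U x + sl x].
  elim=> [|a l2 IH] l1 u El Ux Ul Us.
    exists u; eexists; split.
    - by apply: ExecWhileFalse; rewrite /= Ul.
    - by rewrite El cats0.
    - by [].
    - by rewrite /= Ul /=; exact: dsize_gt0.
  set st := foldl (f x) (s0 x) l1 in Us.
  pose u1 := update u n.+3 (Node (Node (EX x) (ES st)) (EA a)).
  have [|u2 [t3 [X3 E3 P3 L3]]] := Hcf (x, st, a) n.+3 u1 ; first by rewrite /u1 update_eq.
  pose u3 := update u2 n.+2 (u2 n.+3).
  pose u4 := update u3 n.+1 (encodable_seq EA l2).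
  have F2l : u2 n.+1 = enc (a :: l2) by rewrite P3 ?/u1 ?update_lt //; lia.
  have F3l : u3 n.+1 = enc (a :: l2) by rewrite /u3 update_lt.
  have [||||u' [t [X5 E5 P5 L5]]] := IH (rcons l1 a) u4.
  - by rewrite cat_rcons.
  - have H1 : n < n.+1 by []. have H2 : n < n.+2 by lia. have H3 : n < n.+3 by lia.
    by rewrite /u4 /u3 !update_lt // P3 // /u1 update_lt.
  - by rewrite /u4 update_eq.
  - rewrite /u4 update_neq; last by apply/eqP; lia.
    by rewrite /u3 update_eq E3 foldl_rcons.
  have Hst := Hbound x l1 _ El; rewrite -/st in Hst.
  have Hst' := Hbound x (rcons l1 a) l2; rewrite foldl_rcons cat_rcons -/st in Hst'.
  have {}Hst' := Hst' El.
  have Hal : (dsize (enc a) + dsize (enc l2)).+1 <= sl x.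
    by rewrite -dsize_cons /sl El dsize_suffix.
  exists u'; eexists; split.
  - apply: ExecWhileTrue X5; first by rewrite /= Ul.
    apply: ExecSeq.
      apply: ExecSeq X3.
      have := ExecAssign u n.+3 (Defs.Cons (Defs.Cons (Var n) (Var n.+2)) (Hd (Var n.+1))).
      by rewrite /= Ux Us Ul; apply.
    apply: ExecSeq; first exact: ExecAssign.
    rewrite [eval _ _]/=.
    by have := ExecAssign u3 n.+1 (Tl (Var n.+1)); rewrite /= F3l; apply.
  - by [].
  - move=> k Hk; have H1 : k < n.+1 by lia. have H2 : k < n.+2 by lia.
    have H3 : k < n.+3 by lia.
    by rewrite P5 // /u4 /u3 !update_lt // P3 // /u1 update_lt.
  - have H3 : t3 <= (m x).+2 ^ kf.
      apply: leq_trans L3 (leq_trans (Hkf _) _).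
      have mono a1 a2 : a1 <= a2 -> a1 ^ kf <= a2 ^ kf.
        by case: (kf) => // k' Hk'; rewrite leq_exp2r.
      by apply: mono; rewrite !dsize_pair /= /m; move: Hst Hal; rewrite /enc; lia.
    have Da : dsize (enc (a :: l2)) <= sl x by rewrite dsize_cons.
    rewrite mulSn; move: L5; set q := size l2 * U x => L5.
    rewrite /= Ul E3.
    move: L5 H3 Hst Hst' Hal Da; rewrite /U /= /m /enc; move: (_ ^ kf) => pw.
    lia.
have [|u' [t [X6 E6 P6 L6]]] := loop (l x) [::] s2 erefl E2n E2l.
  by [].
exists (update u' n (u' n.+2)); eexists; split.
- apply: ExecSeq; first by apply: ExecSeq; [exact: ExecSeq Ha1 X1 | exact: ExecSeq Ha2 X2].
  by apply: ExecSeq; [exact: X6 | exact: ExecAssign].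
- by rewrite update_eq.
- by move=> k Hk; rewrite update_lt // P6 ?P2'.
- rewrite /= E6 addn0; apply: leq_add.
    by apply: leq_add; apply: leq_add.
  apply: leq_add; last by apply: (Hbound x _ [::]); rewrite cats0.
  apply: leq_trans L6 _; rewrite leq_add2r leq_mul2r ltnW ?orbT //.
  exact: size_dsize_seq.
Qed.
End Foldl.

#[global] Instance encodable_unit : encodable unit := fun=> Leaf.

#[global] Instance encodable_data : encodable data := id.

Definition left_part {B} {EB : encodable B} (b : B) : data := if enc b is Node l _ then l else Leaf.
Definition right_part {B} {EB : encodable B} (b : B) : data := if enc b is Node _ r then r else Leaf.
Definition same_enc {B C} {EB : encodable B} {EC : encodable C} (p : B * C) : bool :=
  data_eqb (enc p.1) (enc p.2).

Section Conversions.
Context {A : Type} {EA : encodable A}.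

(** A program sees only encodings. Reading a pair as a list cell, or a number as a list of units,
    therefore costs nothing. *)
Lemma ptime_same {B C} {EB : encodable B} {EC : encodable C} (f : A -> B) (g : A -> C) :
  (forall x, enc (f x) = enc (g x)) -> ptime f -> ptime g.
Proof.
move=> E [c [T HT Hc] Hs]; exists c; last by apply: (pbounded_le Hs) => x; rewrite E.
by exists T => // x n s; rewrite -E; apply: Hc.
Qed.

Lemma ptime_head {B C} {EB : encodable B} {EC : encodable C} (f : A -> B) (g : A -> C) :
  (forall x, enc (g x) = if enc (f x) is Node l _ then l else Leaf) -> ptime f -> ptime g.
Proof.
move=> E Hf; apply: (@ptime_same _ _ _ _ (fun x => left_part (f x))) => [x|]; first by rewrite E.
apply: (ptime_comp (g := left_part)) Hf.
apply: (@ptime_expr _ _ _ _ _ (fun n => Hd (Var n)) (fun b => dsize (enc b) + dsize (enc b))).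
  by apply: pbounded_add; apply: pbounded_dsize.
move=> b n s /= ->; split=> //; rewrite addn0 leq_add2r.
by case: (enc b) => //= l r; lia.
Qed.

Lemma ptime_tail {B C} {EB : encodable B} {EC : encodable C} (f : A -> B) (g : A -> C) :
  (forall x, enc (g x) = if enc (f x) is Node _ r then r else Leaf) -> ptime f -> ptime g.
Proof.
move=> E Hf; apply: (@ptime_same _ _ _ _ (fun x => right_part (f x))) => [x|]; first by rewrite E.
apply: (ptime_comp (g := right_part)) Hf.
apply: (@ptime_expr _ _ _ _ _ (fun n => Tl (Var n)) (fun b => dsize (enc b) + dsize (enc b))).
  by apply: pbounded_add; apply: pbounded_dsize.
move=> b n s /= ->; split=> //; rewrite addn0 leq_add2r.
by case: (enc b) => //= l r; lia.
Qed.

Lemma ptime_eqb {B C} {EB : encodable B} {EC : encodable C} (f : A -> B) (g : A -> C)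
    (b : A -> bool) :
  (forall x, b x = data_eqb (enc (f x)) (enc (g x))) -> ptime f -> ptime g -> ptime b.
Proof.
move=> E Hf Hg; have Hp := ptime_pair Hf Hg.
apply: (@ptime_ext _ _ _ _ (fun x => same_enc (f x, g x))); last by move=> x; rewrite E.
apply: (ptime_comp (g := same_enc)) Hp.
apply: (@ptime_expr _ _ _ _ _ (fun n => Eq (Hd (Var n)) (Tl (Var n)))
   (fun p => 3 + (dsize (enc p) + dsize (enc p) + (dsize (enc p) + dsize (enc p))))).
  by do ?[apply: pbounded_add]; first [exact: pbounded_cst | exact: pbounded_dsize].
move=> [x y] n s /= ->; split=> //=; rewrite !addn0.
by rewrite /same_enc /=; case: data_eqb => /=; lia.
Qed.

Lemma ptime_negb (b : A -> bool) : ptime b -> ptime (fun x => ~~ b x).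
Proof. by move=> H; exact: (ptime_if H (ptime_cst false) (ptime_cst true)). Qed.

Lemma ptime_andb (b1 b2 : A -> bool) : ptime b1 -> ptime b2 -> ptime (fun x => b1 x && b2 x).
Proof. by move=> H1 H2; exact: (ptime_if H1 H2 (ptime_cst false)). Qed.

Lemma ptime_orb (b1 b2 : A -> bool) : ptime b1 -> ptime b2 -> ptime (fun x => b1 x || b2 x).
Proof. by move=> H1 H2; exact: (ptime_if H1 (ptime_cst true) H2). Qed.

Lemma ptime_addb (b1 b2 : A -> bool) : ptime b1 -> ptime b2 -> ptime (fun x => b1 x (+) b2 x).
Proof.
by move=> H1 H2; apply: (ptime_ext (ptime_if H1 (ptime_negb H2) H2)) => x; case: (b1 x).
Qed.

Lemma ptime_cons {B} {EB : encodable B} (f : A -> B) (l : A -> seq B) :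
  ptime f -> ptime l -> ptime (fun x => f x :: l x).
Proof. by move=> Hf Hl; apply: ptime_same (ptime_pair Hf Hl). Qed.

Lemma ptime_succ (f : A -> nat) : ptime f -> ptime (fun x => (f x).+1).
Proof. by move=> Hf; apply: ptime_same (ptime_pair (ptime_cst tt) Hf). Qed.

Lemma ptime_pred (f : A -> nat) : ptime f -> ptime (fun x => (f x).-1).
Proof. by apply: ptime_tail => x; case: (f x). Qed.

Lemma ptime_behead {B} {EB : encodable B} (l : A -> seq B) :
  ptime l -> ptime (fun x => behead (l x)).
Proof. by apply: ptime_tail => x; case: (l x). Qed.

Lemma ptime_head_seq {B} {EB : encodable B} (b0 : B) (l : A -> seq B) :
  enc b0 = Leaf -> ptime l -> ptime (fun x => head b0 (l x)).
Proof. by move=> E; apply: ptime_head => x; case: (l x). Qed.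

Lemma enc_nseq (n : nat) : enc (nseq n tt) = enc n.
Proof. by elim: n => //= n IH; rewrite /enc /= /encodable_nat /= -/(iter _ _ _) -[iter _ _ _]IH. Qed.

Lemma ptime_nseq (f : A -> nat) : ptime f -> ptime (fun x => nseq (f x) tt).
Proof. by apply: ptime_same => x; rewrite enc_nseq. Qed.
End Conversions.

Lemma dsize_nat (n : nat) : dsize (enc n) = n.*2.+1.
Proof. by elim: n => //= n; rewrite /enc /= => ->. Qed.

Lemma pbounded_value {A} {EA : encodable A} (f : A -> nat) : ptime f -> pbounded f.
Proof.
by move=> /pbounded_ptime/pbounded_le; apply => x; rewrite dsize_nat; lia.
Qed.

Lemma pbounded_size {A B} {EA : encodable A} {EB : encodable B} (l : A -> seq B) :
  ptime l -> pbounded (fun x => size (l x)).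
Proof. by move=> /pbounded_ptime/pbounded_le; apply => x; exact/ltnW/size_dsize_seq. Qed.

Lemma data_eqb_nat (m n : nat) : (m == n) = data_eqb (enc m) (enc n).
Proof. by elim: m n => [|m IH] n; case: n => // n; rewrite eqSS IH. Qed.

Section Iteration.
Context {A : Type} {EA : encodable A}.

(** The unary counter is read as a list of units, which turns the iteration into a fold. *)
Lemma ptime_iter {S} {ES : encodable S} (f : A -> S -> S) (s0 : A -> S) (k : A -> nat) (b : A -> nat) :
  ptime (fun p : A * S => f p.1 p.2) -> ptime s0 -> ptime k -> pbounded b ->
  (forall x i, i <= k x -> dsize (enc (iter i (f x) (s0 x))) <= b x) ->
  ptime (fun x => iter (k x) (f x) (s0 x)).
Proof.
move=> Hf Hs Hk Hb Hi.
have E i x : foldl (fun s (_ : unit) => f x s) (s0 x) (nseq i tt) = iter i (f x) (s0 x).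
  by rewrite -[nseq i tt]revK foldl_rev rev_nseq; elim: i => //= i ->.
apply: (@ptime_ext _ _ _ _ (fun x => foldl (fun s (_ : unit) => f x s) (s0 x) (nseq (k x) tt)));
  last by move=> x; exact: E.
apply: (ptime_foldl (f := fun x s (_ : unit) => f x s) (b := b)) => //.
- apply: (ptime_comp (g := fun p : A * S => f p.1 p.2) (f := fun p : A * S * unit => p.1)) => //.
  exact: ptime_fst ptime_id.
- exact: ptime_nseq.
- move=> x l1 l2 El; have -> : l1 = nseq (size l1) tt by elim: {El} l1 => //= -[] l1 <-.
  by rewrite E Hi // -(size_nseq (k x) tt) El size_cat leq_addr.
Qed.

Lemma ptime_addn (f g : A -> nat) : ptime f -> ptime g -> ptime (fun x => f x + g x).
Proof.
move=> Hf Hg; apply: (@ptime_ext _ _ _ _ (fun x => iter (f x) S (g x))); last by move=> x; rewrite iter_succn addnC.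
apply: (@ptime_iter _ _ (fun _ => S) _ _ (fun x => (f x + g x + (f x + g x)).+1)) => //.
- by apply: ptime_succ; apply: ptime_snd; apply: ptime_id.
- by apply: pbounded_S; do ?[apply: pbounded_add]; apply: pbounded_value.
- by move=> x i Hi; rewrite iter_succn dsize_nat; lia.
Qed.

End Iteration.

Ltac ptime_step := match goal with
  | |- ptime (fun x => x) => exact: ptime_id
  | |- ptime fst => exact: (ptime_fst ptime_id)
  | |- ptime snd => exact: (ptime_snd ptime_id)
  | H : ptime ?f |- ptime ?f => exact: H
  | |- ptime (fun x => fst (@?f x)) => apply: (ptime_fst (f := f))
  | |- ptime (fun x => snd (@?f x)) => apply: (ptime_snd (f := f))
  | |- ptime (fun x => (@?f x, @?g x)) => apply: (ptime_pair (f := f) (g := g))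
  | |- ptime (fun x => if _ then _ else _) => apply: ptime_if
  | |- ptime (fun x => ~~ (@?f x)) => apply: (ptime_negb (b := f))
  | |- ptime (fun x => (@?f x) && (@?g x)) => apply: (ptime_andb (b1 := f) (b2 := g))
  | |- ptime (fun x => (@?f x) || (@?g x)) => apply: (ptime_orb (b1 := f) (b2 := g))
  | |- ptime (fun x => (@?f x) (+) (@?g x)) => apply: (ptime_addb (b1 := f) (b2 := g))
  | |- ptime (fun x => addn (@?f x) (@?g x)) => apply: (ptime_addn (f := f) (g := g))
  | |- ptime (fun x => S (@?f x)) => apply: (ptime_succ (f := f))
  | |- ptime (fun x => cons (@?f x) (@?g x)) => apply: (ptime_cons (f := f) (l := g))
  | |- ptime (fun x => behead (@?f x)) => apply: (ptime_behead (l := f))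
  | H : ptime ?f |- ptime (fun x => ?f (@?g x)) => apply: (ptime_comp (g := f) (f := g) H)
  | |- ptime (fun _ => ?c) => exact: (ptime_cst c)
  end.
Ltac pt := repeat ptime_step.

Section Lists.
Context {A B : Type} {EA : encodable A} {EB : encodable B}.
Implicit Types l : A -> seq B.

Lemma dsize_catrev (s t : seq B) :
  (dsize (enc (catrev s t))).+1 = dsize (enc s) + dsize (enc t).
Proof. by elim: s t => // y s IH t; rewrite [catrev _ _]/= IH !dsize_cons; lia. Qed.

Lemma dsize_rev (s : seq B) : dsize (enc (rev s)) = dsize (enc s).
Proof. by have := dsize_catrev s [::]; rewrite -/(rev s) addn1 => -[]. Qed.

Lemma dsize_cat (s t : seq B) : (dsize (enc (s ++ t))).+1 = dsize (enc s) + dsize (enc t).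
Proof. by elim: s => // y s IH; rewrite cat_cons !dsize_cons; lia. Qed.

Lemma dsize_prefix (s t : seq B) : dsize (enc s) <= dsize (enc (s ++ t)).
Proof. by rewrite -ltnS dsize_cat -addn1 leq_add2l; exact: dsize_gt0. Qed.

Lemma dsize_seq_le (s : seq B) M :
  (forall s1 y s2, s = s1 ++ y :: s2 -> dsize (enc y) <= M) ->
  dsize (enc s) <= size s * M.+1 + 1.
Proof.
elim: s => // y s IH H; rewrite dsize_cons /= mulSn.
have H1 := H [::] y s erefl.
have {}IH : dsize (enc s) <= size s * M.+1 + 1.
  by apply: IH => s1 z s2 E; apply: (H (y :: s1) z s2); rewrite E.
lia.
Qed.

Lemma ptime_size l : ptime l -> ptime (fun x => size (l x)).
Proof.
move=> Hl; have E (s : seq B) n : foldl (fun n _ => n.+1) n s = n + size s.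
  by elim: s n => [|y s IH] n /=; rewrite ?addn0 // IH addSnnS.
apply: (@ptime_ext _ _ _ _ (fun x => foldl (fun n _ => n.+1) 0 (l x))); last by move=> x; exact: E.
apply: (ptime_foldl (f := fun _ n _ => n.+1) (b := fun x => (size (l x) + size (l x)).+1)) => //; try by pt.
- by apply: pbounded_S; apply: pbounded_add; apply: pbounded_size.
- by move=> x l1 l2 ->; rewrite E size_cat dsize_nat; lia.
Qed.

Lemma ptime_catrev l (t : A -> seq B) : ptime l -> ptime t -> ptime (fun x => catrev (l x) (t x)).
Proof.
move=> Hl Ht; have E (s u : seq B) : foldl (fun t y => y :: t) u s = catrev s u.
  by elim: s u => //= y s IH u; rewrite IH.
apply: (@ptime_ext _ _ _ _ (fun x => foldl (fun t y => y :: t) (t x) (l x))); last by move=> x; exact: E.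
apply: (ptime_foldl (f := fun _ t y => y :: t)
  (b := fun x => dsize (enc (l x)) + dsize (enc (t x)))) => //; try by pt.
- by apply: pbounded_add; apply: pbounded_ptime.
- move=> x l1 l2 ->; rewrite E.
  by have := dsize_catrev l1 (t x); have := dsize_prefix l1 l2; lia.
Qed.

Lemma ptime_rev l : ptime l -> ptime (fun x => rev (l x)).
Proof. by move=> H; apply: ptime_catrev => //; pt. Qed.

Lemma ptime_all (p : A -> B -> bool) l :
  ptime (fun q : A * B => p q.1 q.2) -> ptime l -> ptime (fun x => all (p x) (l x)).
Proof.
move=> Hp Hl; have E x (s : seq B) b : foldl (fun b y => b && p x y) b s = b && all (p x) s.
  by elim: s b => [|y s IH] b /=; rewrite ?andbT // IH andbA.
apply: (@ptime_ext _ _ _ _ (fun x => foldl (fun b y => b && p x y) true (l x))); last by move=> x; exact: E.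
apply: (ptime_foldl (f := fun x b y => b && p x y) (b := fun=> 3)) => //; try by pt.
- pt; apply: (ptime_comp (g := fun q : A * B => p q.1 q.2) (f := fun q : A * bool * B => (q.1.1, q.2))) => //.
  by pt.
- exact: pbounded_cst.
- by move=> x l1 l2 _; case: foldl.
Qed.

Lemma ptime_has (p : A -> B -> bool) l :
  ptime (fun q : A * B => p q.1 q.2) -> ptime l -> ptime (fun x => has (p x) (l x)).
Proof.
move=> Hp Hl; apply: (@ptime_ext _ _ _ _ (fun x => ~~ all (fun y => ~~ p x y) (l x))).
  apply: ptime_negb; apply: (@ptime_all (fun x y => ~~ p x y)) => //.
  by apply: (ptime_negb (b := fun q : A * B => p q.1 q.2)).
by move=> x; rewrite all_predC negbK.
Qed.

Lemma ptime_nth (y0 : B) l (i : A -> nat) :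
  enc y0 = Leaf -> ptime l -> ptime i -> ptime (fun x => nth y0 (l x) (i x)).
Proof.
move=> E0 Hl Hi; have E (s : seq B) k : iter k behead s = drop k s.
  by elim: k => [|k IH]; rewrite ?drop0 // iterS IH -drop1 drop_drop add1n.
apply: (@ptime_ext _ _ _ _ (fun x => head y0 (iter (i x) behead (l x)))); last first.
  by move=> x; rewrite E -nth0 nth_drop addn0.
apply: ptime_head_seq => //.
apply: (@ptime_iter _ _ _ _ (fun _ => behead) _ _ (fun x => dsize (enc (l x)))) => //; try by pt.
  exact: pbounded_ptime.
by move=> x k _; rewrite E -{2}(cat_take_drop k (l x)) dsize_suffix.
Qed.

(** An item is no larger than its list, so a bound in the pair becomes a bound in [x] alone, uniform
    over the items. *)
Lemma pbounded_items (g : A * B -> nat) l : pbounded g -> ptime l ->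
  exists2 b, pbounded b & forall x (l1 : seq B) y (l2 : seq B), l x = l1 ++ y :: l2 -> g (x, y) <= b x.
Proof.
move=> [k Hk] Hl; exists (fun x => (dsize (enc x) + dsize (enc (l x))).+2 ^ k).
  apply: pbounded_exp; do 2 apply: pbounded_S; apply: pbounded_add; last exact: pbounded_ptime.
  exact: pbounded_dsize.
move=> x l1 y l2 E; apply: leq_trans (Hk _) _.
case: k {Hk} => // k; rewrite leq_exp2r // dsize_pair /= E.
have := @dsize_suffix _ EB l1 (y :: l2); rewrite dsize_cons; lia.
Qed.
End Lists.

Lemma ptime_map {A B C} {EA : encodable A} {EB : encodable B} {EC : encodable C}
    (f : A -> B -> C) (l : A -> seq B) :
  ptime (fun p : A * B => f p.1 p.2) -> ptime l -> ptime (fun x => [seq f x y | y <- l x]).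
Proof.
move=> Hf Hl.
have E x s t : foldl (fun acc y => f x y :: acc) t s = catrev [seq f x y | y <- s] t.
  by elim: s t => //= y s IH t; rewrite IH.
have [b Hb Hbx] := pbounded_items (pbounded_ptime Hf) Hl.
apply: (@ptime_ext _ _ _ _ (fun x => rev (foldl (fun acc y => f x y :: acc) [::] (l x)))); last first.
  by move=> x; rewrite E -/(rev _) revK.
apply: ptime_rev.
apply: (ptime_foldl (f := fun x acc y => f x y :: acc) (b := fun x => size (l x) * (b x).+1 + 1)) => //; try by pt.
- apply: ptime_cons; last by pt.
  apply: (ptime_comp (g := fun q : A * B => f q.1 q.2) (f := fun q : A * seq C * B => (q.1.1, q.2))) => //.
  by pt.
- apply: pbounded_add; last exact: pbounded_cst.
  by apply: pbounded_mul; [apply: pbounded_size | apply: pbounded_S].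
- move=> x l1 l2 El; rewrite E -/(rev _) dsize_rev.
  apply: leq_trans (@dsize_seq_le _ _ _ (b x) _) _; last first.
    by rewrite size_map El size_cat leq_add2r leq_mul2r leq_addr orbT.
  move=> s1 z s2 Es.
  have [m1 [y [m2 [El1 <-]]]] : exists m1 y m2, l1 = m1 ++ y :: m2 /\ f x y = z.
    elim: l1 s1 Es {El} => [|y l1 IH] [|z1 s1] //= [] .
      by move=> <- _; exists [::], y, l1.
    by move=> _ /IH [m1 [y' [m2 [-> <-]]]]; exists (y :: m1), y', m2.
  by apply: (Hbx x m1 y (m2 ++ l2)); rewrite El El1 -catA.
Qed.

Lemma ptime_filter {A B} {EA : encodable A} {EB : encodable B}
    (p : A -> B -> bool) (l : A -> seq B) :
  ptime (fun q : A * B => p q.1 q.2) -> ptime l -> ptime (fun x => [seq y <- l x | p x y]).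
Proof.
move=> Hp Hl.
have E x s t : foldl (fun acc y => if p x y then y :: acc else acc) t s = catrev [seq y <- s | p x y] t.
  by elim: s t => //= y s IH t; rewrite IH; case: (p x y).
apply: (@ptime_ext _ _ _ _ (fun x => rev (foldl (fun acc y => if p x y then y :: acc else acc) [::] (l x)))); last first.
  by move=> x; rewrite E -/(rev _) revK.
apply: ptime_rev.
apply: (ptime_foldl (f := fun x acc y => if p x y then y :: acc else acc) (b := fun x => dsize (enc (l x)))) => //; try by pt.
- apply: ptime_if; try by pt.
  apply: (ptime_comp (g := fun q : A * B => p q.1 q.2) (f := fun q : A * seq B * B => (q.1.1, q.2))) => //.
  by pt.
- exact: pbounded_ptime.
- move=> x l1 l2 ->; rewrite E -/(rev _) dsize_rev; apply: leq_trans (dsize_prefix _ _).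
  elim: l1 => // y l1 IH; rewrite [filter _ _]/= [X in _ <= X]dsize_cons.
  by case: (p x y); rewrite ?dsize_cons; lia.
Qed.

Lemma ptime_flatten {A B} {EA : encodable A} {EB : encodable B} (l : A -> seq (seq B)) :
  ptime l -> ptime (fun x => flatten (l x)).
Proof.
move=> Hl.
have E (s : seq (seq B)) t : foldl (fun acc y => catrev y acc) t s = catrev (flatten s) t.
  by elim: s t => //= y s IH t; rewrite IH catrev_catl.
apply: (@ptime_ext _ _ _ _ (fun x => rev (foldl (fun acc y => catrev y acc) [::] (l x)))); last first.
  by move=> x; rewrite E -/(rev _) revK.
apply: ptime_rev.
apply: (ptime_foldl (f := fun _ acc y => catrev y acc) (b := fun x => dsize (enc (l x)))) => //; try by pt.
- by apply: ptime_catrev; pt.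
- exact: pbounded_ptime.
- move=> x l1 l2 ->; rewrite E -/(rev _) dsize_rev; apply: leq_trans (dsize_prefix _ _).
  elim: l1 => // y l1 IH; rewrite [flatten _]/= dsize_cons.
  by have := @dsize_cat _ EB y (flatten l1); lia.
Qed.

Section Numbers.
Context {A : Type} {EA : encodable A}.
Implicit Types f g : A -> nat.

Lemma ptime_iota f : ptime f -> ptime (fun x => iota 0 (f x)).
Proof.
move=> Hf.
(* The length of the accumulator serves as the counter. *)
have E n : foldl (fun acc (_ : unit) => size acc :: acc) [::] (nseq n tt) = rev (iota 0 n).
  elim: n => // n IH; rewrite -addn1 nseqD foldl_cat IH /= size_rev size_iota addn1.
  by rewrite -addn1 iotaD rev_cat.
apply: (@ptime_ext _ _ _ _ (fun x => rev (foldl (fun acc (_ : unit) => size acc :: acc) [::] (nseq (f x) tt)))); last first.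
  by move=> x; rewrite E revK.
apply: ptime_rev.
apply: (ptime_foldl (f := fun _ acc _ => size acc :: acc)
   (b := fun x => f x * (f x + f x).+2 + 1)) => //; try by pt.
- by apply: ptime_cons; [apply: ptime_size; pt | pt].
- exact: ptime_nseq.
- apply: pbounded_add; last exact: pbounded_cst.
  have Hv := pbounded_value Hf.
  by apply: pbounded_mul => //; do 2 apply: pbounded_S; apply: pbounded_add.
- move=> x l1 l2 El; have -> : l1 = nseq (size l1) tt by elim: {El} l1 => //= -[] l1 <-.
  have le : size l1 <= f x by rewrite -(size_nseq (f x) tt) El size_cat leq_addr.
  rewrite E dsize_rev; apply: leq_trans (@dsize_seq_le _ _ _ (f x + f x).+1 _) _; last first.
    by rewrite size_iota; nia.
  move=> s1 y s2 Es; have : y \in iota 0 (size l1) by rewrite Es mem_cat inE eqxx orbT.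
  by rewrite mem_iota dsize_nat; lia.
Qed.

Lemma ptime_sumn (l : A -> seq nat) : ptime l -> ptime (fun x => sumn (l x)).
Proof.
move=> Hl; have E (s : seq nat) n : foldl addn n s = n + sumn s.
  by elim: s n => [|y s IH] n /=; rewrite ?addn0 // IH addnA.
apply: (@ptime_ext _ _ _ _ (fun x => foldl addn 0 (l x))); last by move=> x; exact: E.
apply: (ptime_foldl (f := fun _ => addn) (b := fun x => dsize (enc (l x)))) => //; try by pt.
- exact: pbounded_ptime.
- move=> x l1 l2 ->; rewrite E; apply: leq_trans (dsize_prefix _ _).
  rewrite dsize_nat add0n.
  by elim: l1 => // y l1; rewrite dsize_cons dsize_nat [sumn (_ :: _)]/=; lia.
Qed.

Lemma ptime_muln f g : ptime f -> ptime g -> ptime (fun x => f x * g x).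
Proof.
move=> Hf Hg; apply: (@ptime_ext _ _ _ _ (fun x => iter (f x) (addn (g x)) 0)).
  apply: (@ptime_iter _ _ _ _ (fun x => addn (g x)) (fun _ => 0) _ (fun x => (f x * g x + f x * g x).+1)) => //; try by pt.
  - by apply: pbounded_S; apply: pbounded_add; apply: pbounded_mul; apply: pbounded_value.
  - by move=> x i Hi; rewrite iter_addn_0 dsize_nat; nia.
by move=> x; rewrite iter_addn_0 mulnC.
Qed.

Lemma ptime_subn f g : ptime f -> ptime g -> ptime (fun x => f x - g x).
Proof.
move=> Hf Hg; apply: (@ptime_ext _ _ _ _ (fun x => iter (g x) predn (f x))).
  apply: (@ptime_iter _ _ _ _ (fun _ => predn) f _ (fun x => (f x + f x).+1)) => //; try by pt.
  - by apply: ptime_pred; pt.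
  - by apply: pbounded_S; apply: pbounded_add; apply: pbounded_value.
  - by move=> x i Hi; rewrite iter_predn dsize_nat; lia.
by move=> x; rewrite iter_predn.
Qed.

Lemma ptime_eqn f g : ptime f -> ptime g -> ptime (fun x => f x == g x).
Proof. by apply: ptime_eqb => x; apply: data_eqb_nat. Qed.

Lemma ptime_leq f g : ptime f -> ptime g -> ptime (fun x => f x <= g x).
Proof. by move=> Hf Hg; apply: ptime_eqn; [apply: ptime_subn | pt]. Qed.

Lemma ptime_minn f g : ptime f -> ptime g -> ptime (fun x => minn (f x) (g x)).
Proof. by move=> Hf Hg; apply: (ptime_if (b := fun x => f x < g x)) => //; apply: ptime_leq; pt. Qed.

Lemma ptime_expn f k : ptime f -> ptime (fun x => f x ^ k).
Proof.
move=> Hf; elim: k => [|k IH]; first exact: (ptime_cst 1).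
by apply: (ptime_ext (ptime_muln Hf IH)) => x; rewrite expnS.
Qed.

Lemma ptime_nat_of_bool (b : A -> bool) : ptime b -> ptime (fun x => b x : nat).
Proof. by move=> Hb; apply: (ptime_ext (ptime_if Hb (ptime_cst 1) (ptime_cst 0))) => x; case: (b x). Qed.
End Numbers.

(** * Rounding fractional realizations *)

Section KernelVector.
Local Open Scope ring_scope.

(** The relation [rho] keeps the rank of the rows in [R] below [#|R|], hence below the number of
    columns. *)
Lemma kernel_vector (I J : finType) (A : I -> J -> rat) (R : {set I}) (C : {set J})
    (rho : I -> rat) :
  (exists2 i, i \in R & rho i != 0) ->
  (forall j, j \in C -> \sum_(i in R) rho i * A i j = 0) -> (#|R| <= #|C|)%N ->
  exists z : J -> rat, [/\ exists2 j, j \in C & z j != 0, forall j, j \notin C -> z j = 0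
    & forall i, i \in R -> \sum_(j in C) A i j * z j = 0].
Proof.
move=> [i0 i0R rho0] Hrho leRC.
(* Transposed, since [kermx] is the left kernel. *)
pose N := \matrix_(j < #|C|, i < #|R|) A (enum_val i) (enum_val j).
pose r := \row_(i < #|R|) rho (enum_val i).
have rN : r *m N^T = 0.
  apply/rowP => j; rewrite !mxE -[RHS](Hrho (enum_val j)) ?enum_valP //.
  by rewrite [RHS]big_enum_val; apply: eq_bigr => i _; rewrite !mxE.
have r0 : r != 0.
  apply/eqP => /rowP /(_ (enum_rank_in i0R i0)); rewrite !mxE enum_rankK_in //.
  by apply/eqP.
have rk : (\rank N < #|R|)%N.
  rewrite -mxrank_tr ltn_neqAle rank_leq_row andbT; apply: contraNneq r0 => /eqP rf.
  by have /row_freeP [K KE] := rf; rewrite -[r]mulmx1 -KE mulmxA rN mul0mx.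
have : kermx N != 0.
  by rewrite -mxrank_eq0 mxrank_ker subn_eq0 -ltnNge (leq_trans rk).
case/rowV0Pn=> v /sub_kermxP vN v0.
have /existsP [k vk] : [exists k, v 0 k != 0].
  by apply: contraNT v0 => /existsPn H; apply/eqP/rowP => k; rewrite mxE; have /negPn/eqP := H k.
pose z j := \sum_(k < #|C|) v 0 k * (enum_val k == j)%:R.
have zE l : z (enum_val l) = v 0 l.
  rewrite /z (bigD1 l) //= eqxx mulr1 big1 ?addr0 // => m ml.
  by rewrite (inj_eq enum_val_inj) (negbTE ml) mulr0.
exists z; split.
- by exists (enum_val k); rewrite ?enum_valP ?zE.
- move=> j jC; rewrite /z big1 // => l _; case: eqP => [E|]; last by rewrite mulr0.
  by rewrite -E enum_valP in jC.
- move=> i iR; have /rowP/(_ (enum_rank_in iR i)) := vN; rewrite !mxE => H.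
  rewrite -[RHS]H [LHS]big_enum_val; apply: eq_bigr => l _.
  by rewrite zE !mxE enum_rankK_in // mulrC.
Qed.
End KernelVector.

Lemma sum_option (R : nmodType) (I : finType) (g : option I -> R) :
  (\sum_o g o = g None + \sum_i g (Some i))%R.
Proof.
rewrite (bigD1 None) //= (reindex_omap Some id) /=; last by case.
by congr (_ + _)%R; apply: eq_bigl => i; rewrite eqxx.
Qed.

Section Rounding.
Local Open Scope ring_scope.
Variable T : finType.
Implicit Types (x z : {set T} -> rat) (e f : {set T}) (o : option T) (F : {set {set T}}).
Variables (host free M : {set {set T}}) (b rho : option T -> int).

Definition in_box x := forall e, 0 <= x e <= 1.
Definition fractional x := [set e | 0 < x e < 1].
(** [Some v] stands for the degree row of [v], and [None] for the row counting the edges in the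
    guessed bone, which form [M]. *)
Definition row_coef o e : rat := if o is Some v then (v \in e)%:R else (e \in M)%:R.
Definition row_sum x o := \sum_e row_coef o e * x e.
Definition row_err x o := row_sum x o - (b o)%:~R.

Hypothesis host2 : forall e, e \in host -> #|e| = 2%N.
Hypothesis free_host : free \subset host.
(* The left kernel vector [rho] makes the rows of a nonempty set of edges dependent,
   so at most as many of them are independent as there are vertices covered. *)
Hypothesis rho_row : forall e, e \in host -> \sum_o (rho o)%:~R * row_coef o e = 0.
Hypothesis rho_vertex : forall v, `|rho (Some v)| = 1.
Hypothesis rho_mask : `|rho None| <= 2.

Lemma row_sumD x z l o :
  row_sum (fun e => x e + l * z e) o = row_sum x o + l * row_sum z o.
Proof.
by rewrite /row_sum mulr_sumr -big_split; apply: eq_bigr => e _ /=; ring.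
Qed.

Lemma boxNfrac x e : in_box x -> e \notin fractional x -> x e = 0 \/ x e = 1.
Proof. by move=> /(_ e); rewrite inE => ? ?; lra. Qed.

Lemma boxNfrac_int x e : in_box x -> e \notin fractional x -> x e \is a Num.int.
Proof. by move=> Hx He; case: (boxNfrac Hx He) => ->; rewrite ?rpred0 ?rpred1. Qed.

Lemma row_coef_int o e : row_coef o e \is a Num.int.
Proof. by case: o => [v|]; exact: natr_int. Qed.

Lemma row_coef_eq0 o e : row_coef o e = 0 \/ row_coef o e = 1.
Proof. by case: o => [v|] /=; case: (_ \in _); [right|left|right|left]. Qed.

Lemma small_int (a : rat) : a \is a Num.int -> `|a| < 1 -> a = 0.
Proof.
move=> /intrP [m ->]; rewrite -intr_norm -[1]/(1%:~R) ltr_int => H.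
by have -> : m = 0 by lia.
Qed.

Definition frac_at x o := [set e in fractional x | row_coef o e != 0].

Lemma row_sum_split x o : in_box x ->
  row_sum x o - \sum_(e in frac_at x o) x e \is a Num.int.
Proof.
move=> Hx; rewrite /row_sum (bigID [in frac_at x o]) /=.
rewrite [X in X + _ - _](eq_bigr x); last first.
  by move=> e; rewrite inE => /andP [_ H]; case: (row_coef_eq0 o e) H => -> //; rewrite mul1r.
rewrite addrAC subrr add0r rpred_sum // => e; rewrite inE negb_and => /orP[H|].
  by rewrite rpredM ?row_coef_int ?boxNfrac_int.
by rewrite negbK => /eqP->; rewrite mul0r rpred0.
Qed.

(** The other edges of the row contribute an integer, so a single fractional edge would have to be
    integral. *)
Lemma lone_fraction x o (m : int) : in_box x -> row_sum x o = m%:~R -> #|frac_at x o| <> 1%N.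
Proof.
move=> Hx Ho /eqP/cards1P [e E].
have := row_sum_split o Hx; rewrite Ho E big_set1.
have : e \in frac_at x o by rewrite E inE.
rewrite inE inE => /andP[/andP[x0 x1] _] H.
have xi : x e \is a Num.int.
  by rewrite -[x e](subKr m%:~R) rpredB // intr_int.
have : x e = 0 by apply: small_int => //; rewrite ger0_norm // ltW.
lra.
Qed.

(** The ratio test of the simplex method: the longest step that stays in the box takes some moving
    edge to its bound. An edge already at a bound must move inward, or the step could be zero. *)
Lemma shift_to_boundary x z : in_box x -> (exists e, z e != 0) ->
  (forall e, z e != 0 -> [\/ e \in fractional x, x e = 0 /\ 0 < z e | x e = 1 /\ z e < 0]) ->
  exists l : rat, [/\ 0 < l, in_box (fun e => x e + l * z e) &
    exists2 e, z e != 0 & e \notin fractional (fun e => x e + l * z e)].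
Proof.
move=> Hx [e0 z0] Hz.
pose bnd e := if 0 < z e then (1 - x e) / z e else x e / (- z e).
have [e1 ze1 min1] := @arg_minP _ _ _ e0 (fun e => z e != 0) bnd z0.
have bpos e : z e != 0 -> 0 < bnd e.
  move=> ze; rewrite /bnd; have := Hz e ze; rewrite inE => Hc.
  case: (ltrP 0 (z e)) => H; first by apply: divr_gt0 => //; case: Hc => [|[]|[]]; lra.
  have {}H : z e < 0 by rewrite lt_neqAle ze.
  by apply: divr_gt0; rewrite ?oppr_gt0 //; case: Hc => [|[]|[]]; lra.
exists (bnd e1); split; first exact: bpos.
- move=> e; have /andP[xe0 xe1] := Hx e.
  have [->|ze] := eqVneq (z e) 0; first by rewrite mulr0 addr0 xe0.
  have := min1 e ze; have := bpos _ ze1; move: (bnd e1) => l lpos; rewrite /bnd.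
  case: (ltrP 0 (z e)) => H.
    rewrite ler_pdivlMr // => H1; apply/andP; split; last by lra.
    by apply: addr_ge0 => //; apply: mulr_ge0; lra.
  have {}H : 0 < - z e by rewrite oppr_gt0 lt_neqAle ze.
  rewrite ler_pdivlMr // mulrN => H1; apply/andP; split; first by lra.
  have : 0 <= l * - z e by apply: mulr_ge0; lra.
  by rewrite mulrN; lra.
- exists e1 => //; rewrite inE /bnd; case: (ltrP 0 (z e1)) => H.
    by rewrite divfK //; lra.
  by rewrite invrN mulrN mulNr divfK //; lra.
Qed.

Lemma fractional_shift x z l :
  fractional (fun e => x e + l * z e) \subset fractional x :|: [set e | z e != 0].
Proof.
apply/subsetP => e; rewrite !inE; case: eqP => [->|_]; last by rewrite orbT.
by rewrite mulr0 addr0 orbF.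
Qed.

Section Cover.
Variable F : {set {set T}}.
Hypothesis F_free : F \subset free.
Let deg_ (v : T) := #|[set e in F | v \in e]|.

Lemma sum_incidences : (\sum_(v in cover F) deg_ v = 2 * #|F|)%N.
Proof.
transitivity (\sum_(v in cover F) \sum_(e in F) (v \in e : nat))%N.
  apply: eq_bigr => v _; rewrite /deg_ -sum1_card big_mkcond [RHS]big_mkcond /=.
  by apply: eq_bigr => e _; rewrite inE; case: (e \in F); case: (v \in e).
rewrite exchange_big mulnC -sum_nat_const; apply: eq_bigr => e eF.
rewrite -(host2 (subsetP free_host _ (subsetP F_free _ eF))) -sum1_card.
rewrite [RHS]big_mkcond [LHS]big_mkcond /=. apply: eq_bigr => v _.
case: (boolP (v \in e)) => ve; last by case: ifP.
suff -> : v \in cover F by [].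
by apply/bigcupP; exists e.
Qed.

Hypothesis no_lone : forall v, deg_ v <> 1%N.

Lemma cover_deg v : v \in cover F -> (2 <= deg_ v)%N.
Proof.
case/bigcupP => e eF ve; have := @no_lone v.
have : (0 < deg_ v)%N by apply/card_gt0P; exists e; rewrite inE eF.
by rewrite /deg_; case: #|_| => [|[|]].
Qed.

(** Every covered vertex contributes at least two to the handshake sum. *)
Lemma cover_le : (#|cover F| <= #|F|)%N.
Proof.
rewrite -(leq_pmul2l (isT : 0 < 2)%N) -sum_incidences mulnC -sum_nat_const.
by apply: leq_sum => v /cover_deg.
Qed.

Lemma cover_eq : (#|F| <= #|cover F|)%N -> forall v, v \in cover F -> deg_ v = 2%N.
Proof.
move=> le v vF.
have [S [HS E]] : exists S, (2 * #|cover F|.-1 <= S)%N /\ (deg_ v + S = 2 * #|F|)%N.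
  exists (\sum_(u in cover F | u != v) deg_ u)%N; split.
    have -> : (#|cover F|.-1 = \sum_(u in cover F | u != v) 1)%N.
      by rewrite -[#|cover F|]sum1_card [in LHS](bigD1 v).
    by rewrite big_distrr /=; apply: leq_sum => u /andP[/cover_deg].
  by rewrite -sum_incidences [RHS](bigD1 v).
have H2 := cover_deg vF; have H0 : (0 < #|cover F|)%N by apply/card_gt0P; exists v.
move: le HS E H2 H0; move: (deg_ v) #|cover F| #|F| => p q r; lia.
Qed.
End Cover.

Definition touched F := None |: [set Some v | v in cover F].

Lemma card_touched F : #|touched F| = #|cover F|.+1.
Proof.
rewrite cardsU1 card_imset; last by move=> ? ? [].
by case: imsetP => // -[].
Qed.

Lemma untouched_row F o e : e \subset cover F -> o \notin touched F -> row_coef o e = 0.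
Proof.
case: o => [v|] eF; rewrite !inE //= => H; case: (boolP (v \in e)) => // ve.
by case/imsetP: H; exists v => //; apply: (subsetP eF).
Qed.

Lemma rho_touched F e : e \in host -> e \subset cover F ->
  \sum_(o in touched F) (rho o)%:~R * row_coef o e = 0.
Proof.
move=> eh eF; rewrite -[RHS](rho_row eh) [RHS](bigID [in touched F]) /=.
by rewrite [X in _ = _ + X]big1 ?addr0 // => o /(untouched_row eF)->; rewrite mulr0.
Qed.

Lemma sub_cover F e : e \in F -> e \subset cover F.
Proof. exact: bigcup_sup. Qed.

Lemma row_sum_supp (C : {set {set T}}) z o : (forall e, e \notin C -> z e = 0) ->
  row_sum z o = \sum_(e in C) row_coef o e * z e.
Proof.
move=> Hz; rewrite /row_sum (bigID [in C]) /= [X in _ + X]big1 ?addr0 // => e /Hz->.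
by rewrite mulr0.
Qed.

Lemma untouched_sum F (C : {set {set T}}) z o :
  (forall e, e \in C -> e \subset cover F) -> (forall e, e \notin C -> z e = 0) ->
  o \notin touched F -> row_sum z o = 0.
Proof.
move=> HC Hz Ho; rewrite (row_sum_supp _ Hz) big1 // => e /HC eF.
by rewrite (untouched_row eF Ho) mul0r.
Qed.

(* A vector in the kernel lets a fractional edge be rounded at no cost. *)
Definition kernel_on F z :=
  [/\ exists2 e, e \in F & z e != 0, forall e, e \notin F -> z e = 0
    & forall o, row_sum z o = 0].

Lemma kernel_shift x z : in_box x -> kernel_on (fractional x) z ->
  exists y, [/\ in_box y, fractional y \proper fractional x,
    forall e, e \notin fractional x -> y e = x e & row_sum y =1 row_sum x].
Proof.
move=> Hx [[e0 e0F z0] Hz Hr].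
have Hin e : z e != 0 -> e \in fractional x by apply: contraNT => /Hz->.
have [||l [l0 Hb [e1 z1 e1N]]] := @shift_to_boundary x z Hx.
- by exists e0.
- by move=> e /Hin ?; apply: Or31.
exists (fun e => x e + l * z e); split => //.
- apply/properP; split; last by exists e1 => //; apply: Hin.
  apply: subset_trans (fractional_shift x z l) _; rewrite subUset subxx /=.
  by apply/subsetP => e; rewrite inE; apply: Hin.
- by move=> e /Hz->; rewrite mulr0 addr0.
- by move=> o; rewrite row_sumD Hr mulr0 addr0.
Qed.

(** The mask row vanishes on an [F] that avoids [M]. It can then be dropped from [R], and as many
    edges as covered vertices suffice; otherwise one more edge is needed. *)
Lemma kernel_on_exists F (R : {set option T}) :
  F \subset free -> Some @: cover F \subset R -> R \subset touched F ->
  (R = touched F \/ None \notin R /\ [disjoint F & M]) -> F != set0 ->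
  (#|R| <= #|F|)%N -> exists z, kernel_on F z.
Proof.
move=> Ff cR Rt HR /set0Pn [e0 e0F] le.
have e0h := subsetP free_host _ (subsetP Ff _ e0F).
have [v ve0] : exists v, v \in e0 by apply/card_gt0P; rewrite host2.
have vR : Some v \in R.
  by apply: (subsetP cR); apply: imset_f; apply: (subsetP (sub_cover e0F)).
have out o e : e \in F -> o \notin R -> row_coef o e = 0.
  case: HR => [->|[NR dis]] eF oR; first exact: untouched_row (sub_cover eF) oR.
  case: o oR => [u|] uR /=; last by rewrite (disjointFr dis eF).
  case: (boolP (u \in e)) => // ue; case/negP: uR; apply: (subsetP cR).
  by apply: imset_f; apply: (subsetP (sub_cover eF)).
have [||z [z0 Hz Hr]] := @kernel_vector _ _ row_coef R F (fun o => (rho o)%:~R) _ _ le.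
- by exists (Some v) => //; rewrite intr_eq0 -normr_eq0 rho_vertex.
- move=> e eF; rewrite -[RHS](rho_row (subsetP free_host _ (subsetP Ff _ eF))).
  rewrite [RHS](bigID [in R]) /= [X in _ = _ + X]big1 ?addr0 // => o oR.
  by rewrite (out _ _ eF oR) mulr0.
exists z; split => // o; rewrite (row_sum_supp _ Hz).
case: (boolP (o \in R)) => [/Hr //|oR].
by rewrite big1 // => e eF; rewrite (out _ _ eF oR) mul0r.
Qed.

Definition on_target x := forall o, row_sum x o = (b o)%:~R.

Lemma frac_at_vertex x v : frac_at x (Some v) = [set e in fractional x | v \in e].
Proof. by apply/setP => e; rewrite !inE /= pnatr_eq0 eqb0 negbK. Qed.

Lemma frac_at_mask x : frac_at x None = fractional x :&: M.
Proof. by apply/setP => e; rewrite !inE /= pnatr_eq0 eqb0 negbK. Qed.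

(** The sum is an integer strictly between zero and two. *)
Lemma pair_sum_frac x o : in_box x -> on_target x -> #|frac_at x o| = 2%N ->
  \sum_(e in frac_at x o) x e = 1.
Proof.
move=> Hx Ho /eqP/cards2P [e1 [e2 [e12 E]]].
have := row_sum_split o Hx; rewrite Ho rpredBl ?intr_int // => Hint.
have H e : e \in frac_at x o -> 0 < x e < 1 by rewrite !inE => /andP[].
have H1 : 0 < x e1 < 1 by apply: H; rewrite E !inE eqxx.
have H2 : 0 < x e2 < 1 by apply: H; rewrite E !inE eqxx orbT.
move: Hint; rewrite E big_setU1 ?inE //= big_set1 => Hint.
apply/eqP; rewrite -subr_eq0; apply/eqP/small_int; first by rewrite rpredB ?rpred1.
by rewrite ltr_norml; apply/andP; split; lra.
Qed.

(** The only place where the rounding depends on the classes; [twin_chord] provides it. *)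
Hypothesis chord : forall F, F \subset free ->
  (forall v, v \in cover F -> #|[set e in F | v \in e]| = 2%N) -> (2 <= #|F :&: M|)%N ->
  (exists z, kernel_on F z) \/ exists f, [/\ f \in free, f \notin F & f \subset cover F].

Lemma inward_sign x z f : in_box x -> f \notin fractional x -> z f != 0 ->
  exists2 s : rat, s != 0 & x f = 0 /\ 0 < s * z f \/ x f = 1 /\ s * z f < 0.
Proof.
move=> Hx fF zf; have sq : 0 < z f * z f by rewrite -expr2 exprn_even_gt0 //= zf.
case: (boxNfrac Hx fF) => E; [exists (z f) | exists (- z f)]; rewrite ?oppr_eq0 //.
  by left.
by right; rewrite mulNr oppr_lt0.
Qed.

(* Pushing an integral edge [f] off its bound along a kernel vector supported by
   [F + f] can bring [f] to its other bound only together with the two edges of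
   [F] at an end of [f], because these two always sum to one. *)
Lemma chord_shift x z f v : in_box x -> on_target x -> fractional x \subset free ->
  (forall u, u \in cover (fractional x) -> #|[set e in fractional x | u \in e]| = 2%N) ->
  f \in free -> f \notin fractional x -> v \in f -> v \in cover (fractional x) ->
  (forall e, e \notin f |: fractional x -> z e = 0) -> (forall o, row_sum z o = 0) ->
  z f != 0 ->
  exists y, [/\ in_box y, on_target y, fractional y \subset free, (#|fractional y| < #|fractional x|)%N &
    forall e, e \notin free -> y e = x e].
Proof.
set F := fractional x => Hx Ex Ff reg ff fF vf vF Hz Hr zf.
have [s s0 Hs] := inward_sign Hx fF zf.
have [||l [l0 Hb [e1 z1 e1N]]] := @shift_to_boundary x (fun e => s * z e) Hx.
- by exists f; rewrite mulf_neq0.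
- move=> e; rewrite mulf_eq0 negb_or => /andP [_ ze].
  have := contraNN (fun H => introT eqP (Hz e H)) ze.
  rewrite negbK !inE => /orP[/eqP->|eF]; last by apply: Or31.
  by case: Hs; [apply: Or32|apply: Or33].
set y := fun e => _ in Hb e1N.
have Ey : on_target y.
  move=> o; rewrite /y row_sumD -[in RHS](Ex o); suff -> : row_sum (fun e => s * z e) o = 0.
    by rewrite mulr0 addr0.
  transitivity (row_sum (fun e => 0 + s * z e) o).
    by apply: eq_bigr => e _; rewrite add0r.
  rewrite row_sumD Hr mulr0 addr0 /row_sum big1 // => e _; exact: mulr0.
have yE e : e \notin f |: F -> y e = x e.
  by move=> H; rewrite /y Hz // !mulr0 addr0.
have Fy : fractional y \subset f |: F.
  apply/subsetP => e; apply: contraTT => H; rewrite inE yE //.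
  by move: H; rewrite !inE negb_or => /andP[].
have free_y : f |: F \subset free by rewrite subUset sub1set ff.
exists y; split => //; first exact: subset_trans Fy free_y; last first.
  by move=> e H; apply: yE; apply: contraNN H; apply: (subsetP free_y).
have e1F : e1 \in f |: F.
  by apply: contraNT z1 => /Hz ->; rewrite mulr0.
(* Suppose that [f] reaches its other bound while all of [F] stays fractional. The two fractional
   edges at [v] sum to one before and after, and the row of [v] is unchanged, so [f] cannot have
   moved. *)
have [E|e1f] := eqVneq e1 f.
  have Fy' : fractional y \subset F.
    apply/subsetP => e ey; have := subsetP Fy e ey.
    by rewrite in_setU1 => /orP[/eqP ef|//]; case/negP: e1N; rewrite E -ef.
  rewrite ltn_neqAle subset_leq_card // andbT; apply/eqP => cE.
  have FE : fractional y = F by apply/eqP; rewrite eqEcard Fy' cE /= leqnn.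
  have sF : \sum_(e in frac_at x (Some v)) x e = 1.
    by apply: pair_sum_frac => //; rewrite frac_at_vertex reg.
  have sFy : \sum_(e in frac_at y (Some v)) y e = 1.
    by apply: pair_sum_frac => //; rewrite frac_at_vertex FE reg.
  have fat : frac_at y (Some v) = frac_at x (Some v) by rewrite !frac_at_vertex FE.
  have split w : in_box w -> (forall e, e \notin f |: F -> w e = x e) -> fractional w = F ->
      row_sum w (Some v) = \sum_(e in frac_at w (Some v)) w e + (w f +
      \sum_(e | (e \notin frac_at x (Some v)) && (e != f)) row_coef (Some v) e * x e).
    move=> Hw wE wF; rewrite /row_sum (bigID [in frac_at w (Some v)]) /=; congr (_ + _).
      apply: eq_bigr => e; rewrite frac_at_vertex inE => /andP[_ ->]; exact: mul1r.
    have fw : frac_at w (Some v) = frac_at x (Some v) by rewrite !frac_at_vertex wF.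
    rewrite fw (bigD1 f) /=; last by rewrite frac_at_vertex inE (negbTE fF).
    rewrite vf mul1r; congr (_ + _); apply: eq_bigr => e /andP[eat ef].
    case: (boolP (v \in e)) => ve; rewrite ?mul0r // !mul1r wE // in_setU1 (negbTE ef) /=.
    by move: eat; rewrite frac_at_vertex inE ve andbT.
  have Sx := split x Hx (fun _ _ => erefl) erefl.
  have Sy := split y Hb yE FE.
  have : row_sum x (Some v) = row_sum y (Some v) by rewrite Ex Ey.
  rewrite Sx Sy sF sFy => /addrI/addIr Exy.
  have : l * (s * z f) != 0 by rewrite !mulf_neq0 // gt_eqF.
  by rewrite -[l * _](addKr (x f)) -/(y f) -Exy addNr eqxx.
(* If [f] merely replaced [e1] among the fractional edges, an end of [e1] outside [f] would keep a
   single fractional edge, against exactness. *)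
move: e1F; rewrite in_setU1 (negbTE e1f) /= => e1F.
rewrite ltnNge; apply/negP => le.
have sub1 : fractional y \subset (f |: F) :\ e1.
  by rewrite subsetD1 Fy e1N.
have cF1 : #|(f |: F) :\ e1| = #|F|.
  have := cardsD1 e1 (f |: F); rewrite in_setU1 e1F orbT cardsU1 fF.
  by rewrite !add1n => -[].
have FE : fractional y = (f |: F) :\ e1.
  by apply/eqP; rewrite eqEcard sub1 cF1.
have c2 e : e \in free -> #|e| = 2%N by move=> /(subsetP free_host)/host2.
have [u ue uf] : exists2 u, u \in e1 & u \notin f.
  apply/subsetPn; apply: contraNN e1f => sub.
  by rewrite eqEcard sub /= !c2 ?leqnn // (subsetP Ff).
have uF : u \in cover F by apply/bigcupP; exists e1.
apply: (@lone_fraction y (Some u) (b (Some u))) => //.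
have -> : frac_at y (Some u) = [set e in F | u \in e] :\ e1.
  apply/setP => e; rewrite frac_at_vertex FE !inE.
  have [->|_] := eqVneq e f; last by rewrite /= -!andbA.
  by rewrite (negbTE uf) !andbF.
have := cardsD1 e1 [set e in F | u \in e]; rewrite reg // inE e1F ue add1n => -[] //.
Qed.

Lemma exact_round n x : (#|fractional x| <= n)%N -> in_box x -> on_target x ->
  fractional x \subset free ->
  exists y, [/\ in_box y, on_target y, fractional y = set0 & forall e, e \notin free -> y e = x e].
Proof.
elim: n x => [|n IH] x le Hx Ex Ff.
  by exists x; split => //; apply/eqP; rewrite -cards_eq0 -leqn0.
have [F0|F0] := eqVneq (fractional x) set0; first by exists x.
have step y : (#|fractional y| < #|fractional x|)%N -> in_box y -> on_target y ->
    fractional y \subset free -> (forall e, e \notin free -> y e = x e) ->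
    exists y, [/\ in_box y, on_target y, fractional y = set0 & forall e, e \notin free -> y e = x e].
  move=> lt Hy Ey Fy yE; have [|w [Hw Ew Fw wE]] := IH y _ Hy Ey Fy.
    by rewrite -ltnS (leq_trans lt).
  by exists w; split => // e He; rewrite wE // yE.
have ker : (exists z, kernel_on (fractional x) z) ->
    exists y, [/\ in_box y, on_target y, fractional y = set0 & forall e, e \notin free -> y e = x e].
  case=> z /(kernel_shift Hx) [y [Hy Fy yE ry]]; apply: (step y) => //.
  - exact: proper_card.
  - by move=> o; rewrite ry.
  - exact: subset_trans (proper_sub Fy) Ff.
  - by move=> e eF; apply: yE; apply: contraNN eF; apply: (subsetP Ff).
have nl v : #|[set e in fractional x | v \in e]| <> 1%N.
  by rewrite -frac_at_vertex; apply: lone_fraction (Ex _).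
have cle := cover_le Ff nl.
have cS : Some @: cover (fractional x) \subset touched (fractional x) by apply: subsetUr.
(* One edge more than there are vertices pays for the vertex rows and the mask row. *)
have [lt|ge] := ltnP #|cover (fractional x)| #|fractional x|.
  apply: ker; apply: (@kernel_on_exists _ (touched (fractional x))) => //; first by left.
  by rewrite card_touched.
have reg := cover_eq Ff nl ge.
have [m0|m0] := eqVneq #|fractional x :&: M| 0%N.
  apply: ker; apply: (@kernel_on_exists _ (Some @: cover (fractional x))) => //.
    right; split; last by rewrite -setI_eq0 -cards_eq0 m0.
    by apply/imsetP => -[].
  by rewrite card_imset //; move=> ? ? [].
have m1 : #|fractional x :&: M| <> 1%N.
  by rewrite -frac_at_mask; apply: lone_fraction (Ex _).
have [//||[f [ff fF fc]]] := chord Ff reg; [|exact: ker|].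
  by case: #|_| m0 m1 => [|[|]].
have [v vf] : exists v, v \in f by apply/card_gt0P; rewrite host2 // (subsetP free_host).
have vF := subsetP fc v vf.
have ffh := subsetP free_host _ ff.
have sub e : e \in f |: fractional x -> e \subset cover (fractional x).
  by rewrite in_setU1 => /orP[/eqP->//|]; apply: sub_cover.
have subh e : e \in f |: fractional x -> e \in host.
  by rewrite in_setU1 => /orP[/eqP->//|/(subsetP Ff)/(subsetP free_host)].
(* The chord [f] supplies the one column that was missing, and adds no row because its ends are
   already covered. *)
have [|||z [z0 Hz Hr]] := @kernel_vector _ _ row_coef (touched (fractional x)) (f |: fractional x)
    (fun o => (rho o)%:~R).
- exists (Some v); first by rewrite inE imset_f ?orbT.
  by rewrite intr_eq0 -normr_eq0 rho_vertex.
- by move=> e eC; apply: rho_touched; [apply: subh|apply: sub].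
- by rewrite card_touched cardsU1 fF add1n ltnS.
have Hr0 o : row_sum z o = 0.
  case: (boolP (o \in touched (fractional x))) => oR; first by rewrite (row_sum_supp _ Hz) Hr.
  exact: untouched_sum sub Hz oR.
have [zf|zf] := eqVneq (z f) 0.
  apply: ker; exists z; split => //.
    case: z0 => e; rewrite in_setU1 => /orP[/eqP->|eF ze]; first by rewrite zf eqxx.
    by exists e.
  move=> e eF; have [->|ef] := eqVneq e f; first exact: zf.
  by apply: Hz; rewrite in_setU1 (negbTE ef).
have [y [Hy Ey Fy lt yE]] := chord_shift Hx Ex Ff reg ff fF vf vF Hz Hr0 zf.
exact: (step y).
Qed.

(* The weight of the vertex errors pays for the error that each later rounding
   of an edge may add to the mask row. *)
Definition slack x :=
  `|row_err x None| + #|fractional x|.+1%:R * \sum_v `|row_err x (Some v)|.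

Lemma vertex_errs_ge0 x : 0 <= \sum_v `|row_err x (Some v)|.
Proof. by apply: sumr_ge0. Qed.

Lemma vertex_errs_le x : \sum_v `|row_err x (Some v)| <= slack x - `|row_err x None|.
Proof.
rewrite /slack addrC addKr -[X in X <= _]mul1r ler_wpM2r ?vertex_errs_ge0 //.
by rewrite ler1n.
Qed.

Lemma row_err_le x o : `|row_err x o| <= slack x.
Proof.
have H0 := vertex_errs_ge0 x; have H1 := vertex_errs_le x.
case: o => [v|]; last by lra.
have H2 := normr_ge0 (row_err x None).
apply: le_trans (_ : \sum_v `|row_err x (Some v)| <= _); last by lra.
by rewrite (bigD1 v) //= lerDl sumr_ge0.
Qed.

Lemma slack_shrink x y (l : rat) : 0 <= l <= 1 -> (forall o, row_err y o = l * row_err x o) ->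
  (#|fractional y| <= #|fractional x|)%N -> slack y <= slack x.
Proof.
move=> /andP[l0 l1] Hl le.
have H o : `|row_err y o| <= `|row_err x o|.
  by rewrite Hl normrM (ger0_norm l0) ler_piMl.
apply: lerD => //; apply: ler_pM => //; rewrite ?ler0n ?sumr_ge0 ?ler_nat ?ltnS //.
by apply: ler_sum.
Qed.

Lemma row_err_int x o : in_box x -> frac_at x o = set0 -> row_err x o \is a Num.int.
Proof.
move=> Hx E; have := row_sum_split o Hx; rewrite E big_set0 subr0 => H.
by rewrite /row_err rpredB ?intr_int.
Qed.

(* Rounding the only fractional edge at [v] removes the error at [v] and adds it
   to the other end at worst. *)
Lemma round_lone x v : in_box x -> fractional x \subset free -> slack x < 1 / 2 ->
  #|frac_at x (Some v)| = 1%N ->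
  exists y, [/\ in_box y, fractional y \proper fractional x, slack y <= slack x
    & forall e, e \notin free -> y e = x e].
Proof.
move=> Hx Ff Hs /eqP/cards1P [e Ee].
have : e \in frac_at x (Some v) by rewrite Ee inE.
rewrite frac_at_vertex inE => /andP[eF ve].
have := row_sum_split (Some v) Hx; rewrite Ee big_set1 => Hint.
have Herr := row_err_le x (Some v).
set err := row_err x (Some v) in Herr.
(* Subtracting the error at [v] from [x e] makes the row of [v] exact, and the other edges of this
   row are integral. As the error is below one half, the new value is 0 or 1. *)
have Hr : x e - err \is a Num.int.
  have -> : x e - err = (b (Some v))%:~R - (row_sum x (Some v) - x e) by rewrite /err /row_err; ring.
  by rewrite rpredB ?intr_int.
have xe : 0 < x e < 1 by rewrite inE in eF.
have Hr01 : x e - err = 0 \/ x e - err = 1.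
  have [H|H] := lerP (x e) (1 / 2).
    by left; apply: small_int => //; move: Herr; rewrite ler_norml ltr_norml; lra.
  right; apply/eqP; rewrite -subr_eq0; apply/eqP/small_int; first by rewrite rpredB ?rpred1.
  by move: Herr; rewrite ler_norml ltr_norml; lra.
pose z (e' : {set T}) : rat := (e' == e)%:R.
pose y e' := x e' + (- err) * z e'.
have zo o : row_sum z o = row_coef o e.
  rewrite /row_sum (bigD1 e) //= /z eqxx mulr1 big1 ?addr0 // => f /negbTE->.
  by rewrite mulr0.
have yerr o : row_err y o = row_err x o - err * row_coef o e.
  by rewrite /row_err /y row_sumD zo; ring.
have yE e' : e' != e -> y e' = x e' by move=> /negbTE H; rewrite /y /z H mulr0 addr0.
have ye : y e = x e - err by rewrite /y /z eqxx mulr1.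
have Fsub : fractional y \proper fractional x.
  apply/properP; split; last by exists e; rewrite // inE ye; case: Hr01 => ->; rewrite ltxx ?andbF.
  apply/subsetP => f; have [->//|fe] := eqVneq f e; by rewrite !inE yE.
exists y; split => //.
- move=> f; have [->|/yE->//] := eqVneq f e.
  by rewrite ye; case: Hr01 => ->; rewrite lexx ler01.
- have lt := proper_card Fsub.
  have c2 : #|e :\ v| = 1%N.
    have := cardsD1 v e; rewrite ve host2 ?add1n; last exact: subsetP free_host _ (subsetP Ff _ eF).
    by case.
  have HV : \sum_w `|row_err y (Some w)| <= \sum_w `|row_err x (Some w)|.
    rewrite (bigD1 v) //= yerr -/err /row_coef ve mulr1 subrr normr0 add0r.
    apply: (@le_trans _ _ (\sum_(w | w != v) (`|row_err x (Some w)| + `|err| * (w \in e)%:R))).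
      apply: ler_sum => w _; rewrite yerr; apply: le_trans (ler_normB _ _) _.
      by rewrite normrM /= normr_nat.
    rewrite big_split [X in _ <= X](bigD1 v) //= addrC lerD2r -/err -mulr_sumr.
    rewrite -[X in _ <= X]mulr1 ler_wpM2l //.
    rewrite -natr_sum (_ : (\sum_(w | w != v) (w \in e) = 1)%N) // -c2 -sum1_card.
    rewrite big_mkcond [RHS]big_mkcond /=; apply: eq_bigr => w _; rewrite !inE.
    by case: (w != v); case: (w \in e).
  have HN : `|row_err y None| <= `|row_err x None| + `|err|.
    rewrite yerr; apply: le_trans (ler_normB _ _) _; rewrite lerD2l normrM.
    by case: (row_coef_eq0 None e) => ->; rewrite ?normr0 ?normr1 ?mulr0 ?mulr1.
  have Herr' : `|err| <= \sum_w `|row_err x (Some w)|.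
    by rewrite (bigD1 v) //= lerDl sumr_ge0.
  have H3 : #|fractional y|.+1%:R * (\sum_w `|row_err y (Some w)|) <=
            #|fractional x|%:R * \sum_w `|row_err x (Some w)|.
    by apply: ler_pM => //; rewrite ?ler0n ?sumr_ge0 ?ler_nat.
  have S0 := vertex_errs_ge0 x.
  rewrite /slack -natr1 mulrDl mul1r; lra.
- by move=> f fN; apply: yE; apply: contraNneq fN => ->; apply: (subsetP Ff).
Qed.

(** Small errors satisfy the relation [rho] exactly, so the error vector can be added as a further
    column without raising the rank. A kernel vector then either leaves all rows unchanged, or gives
    a direction that cancels all errors at once. *)
Lemma approx_exact n x : (#|fractional x| <= n)%N -> in_box x -> fractional x \subset free ->
  (forall e, e \notin host -> x e = 0) -> slack x < 1 / 2 ->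
  exists y, [/\ in_box y, on_target y, fractional y \subset free & forall e, e \notin free -> y e = x e].
Proof.
elim: n x => [|n IH] x le Hx Ff Hh Hs; have Herr := row_err_le x.
  exists x; split => // o.
  have F0 : fractional x = set0 by apply/eqP; rewrite -cards_eq0 -leqn0.
  apply/eqP; rewrite -subr_eq0; apply/eqP/small_int; last by apply: le_lt_trans (Herr o) _; lra.
  by apply: row_err_int => //; apply/setP => e; rewrite inE F0 !inE.
have step y : in_box y -> fractional y \proper fractional x -> slack y <= slack x ->
    (forall e, e \notin free -> y e = x e) ->
    exists y, [/\ in_box y, on_target y, fractional y \subset free & forall e, e \notin free -> y e = x e].
  move=> Hy Fy sy yE; have [||||w [Hw Ew Fw wE]] := IH y _ Hy.
  - by rewrite -ltnS (leq_trans (proper_card Fy)).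
  - exact: subset_trans (proper_sub Fy) Ff.
  - by move=> e He; rewrite yE ?Hh //; apply: contraNN He; apply: (subsetP free_host).
  - exact: le_lt_trans sy Hs.
  by exists w; split => // e He; rewrite wE // yE.
have [nl|] := boolP [forall v, #|[set e in fractional x | v \in e]| != 1%N]; last first.
  case/forallPn => v; rewrite negbK -frac_at_vertex => /eqP/(round_lone Hx Ff Hs) [y [Hy Fy sy yE]].
  exact: (step y).
have {}nl v : #|[set e in fractional x | v \in e]| <> 1%N by move/forallP: nl => /(_ v)/eqP.
have cle := cover_le Ff nl.
set F := fractional x in nl cle step *.
(* [None] is the column of the errors. *)
pose C : {set option {set T}} := None |: [set Some e | e in F].
have cC : #|C| = #|F|.+1.
  rewrite cardsU1 card_imset; last by move=> ? ? [].
  by case: imsetP => // -[].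
pose A o (c : option {set T}) := if c is Some e then row_coef o e else row_err x o.
have out o : o \notin touched F -> row_err x o = 0.
  move=> oF; apply: small_int; last by apply: le_lt_trans (Herr o) _; lra.
  apply: row_err_int => //; apply/setP => e; rewrite !inE.
  apply/negP => /andP[eF]; rewrite (untouched_row (F := F)) ?eqxx //.
  by apply: sub_cover; rewrite inE.
have total0 : \sum_o (rho o)%:~R * row_sum x o = 0.
  rewrite /row_sum; under eq_bigr => o _ do rewrite mulr_sumr.
  rewrite exchange_big big1 // => e _.
  have [eh|/Hh->] := boolP (e \in host); last by rewrite big1 // => o _; rewrite !mulr0.
  under eq_bigr => o _ do rewrite mulrA.
  by rewrite -mulr_suml rho_row ?mul0r.
(* An integer of absolute value below one. With [m] the mask error, the sum is at most
   [2 |m| + (slack - |m|)], hence at most twice the slack; this is where the bounds 2 on [rho None]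
   and 1/2 on the slack come from. *)
have total : \sum_o (rho o)%:~R * row_err x o = 0.
  apply: small_int.
    rewrite /row_err; under eq_bigr => o _ do rewrite mulrBr.
    rewrite sumrB total0 sub0r rpredN; apply: rpred_sum => o _.
    by rewrite rpredM ?intr_int.
  apply: le_lt_trans (ler_norm_sum _ _ _) _.
  under eq_bigr => o _ do rewrite normrM -intr_norm.
  rewrite sum_option; under eq_bigr => v _ do rewrite rho_vertex mul1r.
  have := vertex_errs_le x; have := rho_mask; rewrite -(ler_int rat) => H1 H2.
  have : `|rho None|%:~R * `|row_err x None| <= 2 * `|row_err x None| by apply: ler_wpM2r.
  have := row_err_le x None; lra.
have [F0|[e0 e0F]] := set_0Vmem F.
  exists x; split => // o; apply/eqP; rewrite -subr_eq0; apply/eqP/small_int.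
    by apply: row_err_int => //; apply/setP => e; rewrite inE -/F F0 !inE.
  by apply: le_lt_trans (Herr o) _; lra.
have [v ve0] : exists v, v \in e0.
  by apply/card_gt0P; rewrite host2 // (subsetP free_host) // (subsetP Ff).
have vF : v \in cover F by apply/bigcupP; exists e0.
have [|||z [z0 Hz Hr]] := @kernel_vector _ _ A (touched F) C (fun o => (rho o)%:~R).
- exists (Some v); first by rewrite !inE imset_f ?orbT.
  by rewrite intr_eq0 -normr_eq0 rho_vertex.
- case=> [e|] /=.
    rewrite !inE /= => /imsetP[f fF [->]]; apply: rho_touched; last exact: sub_cover.
    by rewrite (subsetP free_host) // (subsetP Ff).
  move=> _; rewrite -[RHS]total [RHS](bigID [in touched F]) /=.
  by rewrite [X in _ = _ + X]big1 ?addr0 // => o /out->; rewrite mulr0.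
- by rewrite card_touched cC ltnS.
have zF e : e \notin F -> z (Some e) = 0.
  move=> eF; apply: Hz; rewrite !inE /=; apply: contraNN eF => /imsetP[f fF [->]] //.
have Hr' o : row_sum (fun e => z (Some e)) o = - (row_err x o * z None).
  have [oR|oR] := boolP (o \in touched F); last first.
    rewrite out // mul0r oppr0; apply: (untouched_sum (F := F) (C := F)) => //.
    exact: sub_cover.
  apply/eqP; rewrite -addr_eq0 -[X in _ == X](Hr o oR) /C big_setU1 /=; last by case: imsetP => // -[].
  rewrite big_imset /=; last by move=> ? ? _ _ [].
  by rewrite (row_sum_supp (C := F)) // addrC.
have [zN|zN] := eqVneq (z None) 0.
  have [|y [Hy Fy yE ry]] := @kernel_shift x (fun e => z (Some e)) Hx.
    split => //; last by move=> o; rewrite Hr' zN mulr0 oppr0.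
    case: z0 => -[e|]; last by rewrite zN eqxx.
    by rewrite !inE /= => /imsetP[f fF [->]]; exists f.
  apply: (step y) => //.
  - apply: (@slack_shrink _ _ 1); rewrite ?ler01 ?lexx //.
      by move=> o; rewrite mul1r /row_err ry.
    exact: subset_leq_card (proper_sub Fy).
  - by move=> e eF; apply: yE; apply: contraNN eF; apply: (subsetP Ff).
(* A full step along [w] gives an exact solution. A step of length [l] below 1 scales all errors by
   [1 - l], so stopping at the boundary of the box does not raise the slack. *)
pose w e := z (Some e) / z None.
have wr o : row_sum w o = - row_err x o.
  have -> : row_sum w o = row_sum (fun e => z (Some e)) o / z None.
    by rewrite /row_sum mulr_suml; apply: eq_bigr => e _; rewrite /w mulrA.
  by rewrite Hr' mulNr mulfK.
have wF e : e \notin F -> w e = 0 by move=> /zF H; rewrite /w H mul0r.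
have yerr l o : row_err (fun e => x e + l * w e) o = (1 - l) * row_err x o.
  by rewrite {1}/row_err row_sumD wr /row_err; ring.
have yF l : fractional (fun e => x e + l * w e) \subset F.
  apply: subset_trans (fractional_shift x w l) _; rewrite subUset subxx /=.
  by apply/subsetP => e; rewrite inE; apply: contraNT => /wF->.
have yfree l e : e \notin free -> x e + l * w e = x e.
  by move=> eF; rewrite wF ?mulr0 ?addr0 //; apply: contraNN eF; apply: (subsetP Ff).
have full : in_box (fun e => x e + 1 * w e) ->
    exists y, [/\ in_box y, on_target y, fractional y \subset free & forall e, e \notin free -> y e = x e].
  move=> H1; exists (fun e => x e + 1 * w e); split => //; last by move=> e; exact: yfree.
    move=> o; apply/eqP; rewrite -subr_eq0; apply/eqP.
    by rewrite -/(row_err _ o) yerr subrr mul0r.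
  exact: subset_trans (yF 1) Ff.
have [/existsP we|/existsPn w0] := boolP [exists e, w e != 0]; last first.
  by apply: full => e; have /negPn/eqP-> := w0 e; rewrite mulr0 addr0.
have [|l [l0 Hb [e1 w1 e1N]]] := @shift_to_boundary x w Hx we.
  by move=> e we'; apply: Or31; apply: contraNT we' => /wF->.
have [l1|l1] := lerP 1 l.
  apply: full => e; have /andP[H0 H1] := Hx e; have /andP[H2 H3] := Hb e.
  rewrite mul1r; have [ws|ws] := lerP 0 (w e).
    have : 1 * w e <= l * w e by apply: ler_wpM2r.
    by rewrite mul1r; lra.
  have : l * w e <= 1 * w e by rewrite ler_nM2r.
  by rewrite mul1r; lra.
apply: (step (fun e => x e + l * w e)) => //.
- apply/properP; split; first exact: yF.
  by exists e1 => //; apply: contraNT w1 => /wF->.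
- apply: (@slack_shrink _ _ (1 - l)); [by lra | by move=> o; rewrite yerr |].
  exact: subset_leq_card (yF l).
- by move=> e; apply: yfree.
Qed.
End Rounding.

Lemma card2_other (T : finType) (e : {set T}) u :
  #|e| = 2 -> u \in e -> exists2 w, w != u & e = [set u; w].
Proof.
move=> /eqP/cards2P [a [b [ab ->]]]; rewrite !inE => /orP[/eqP->|/eqP->].
  by exists b; rewrite // eq_sym.
by exists a; rewrite // setUC.
Qed.

Lemma set2_eq (T : finType) (a b c d : T) :
  [set a; b] = [set c; d] -> (a = c /\ b = d) \/ (a = d /\ b = c).
Proof.
move=> E.
have : a \in [set c; d] by rewrite -E !inE eqxx.
have : b \in [set c; d] by rewrite -E !inE eqxx orbT.
have : c \in [set a; b] by rewrite E !inE eqxx.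
have : d \in [set a; b] by rewrite E !inE eqxx orbT.
rewrite !inE => /orP[/eqP e1|/eqP e1] /orP[/eqP e2|/eqP e2] /orP[/eqP e3|/eqP e3]
  /orP[/eqP e4|/eqP e4]; by [left; split; congruence | right; split; congruence].
Qed.

(** * Exchanging edges between twin vertices *)

Section Chord.
Local Open Scope ring_scope.
Variable T : finType.
Variables (free M : {set {set T}}) (tw : rel T) (p : T).
Hypothesis free2 : forall e, e \in free -> #|e| = 2%N.
Hypothesis tw_sym : symmetric tw.
(* Only at the vertex [p] may the free edges be an arbitrary part of those between
   adjacent classes. *)
Hypothesis tw_free : forall u1 u2 w, tw u1 u2 -> [set u1; w] \in free -> u2 != p -> w != p ->
  (exists2 e, e \in free & u2 \in e) -> [set u2; w] \in free.
Hypothesis tw_mask : forall u1 u2 w, tw u1 u2 -> [set u1; w] \in free -> [set u2; w] \in free ->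
  ([set u1; w] \in M) = ([set u2; w] \in M).
Hypothesis mask_tw : forall e1 e2, e1 \in free :&: M -> e2 \in free :&: M -> e1 != e2 ->
  exists a b, [/\ a \in e1, b \in e2, a != b & tw a b].

Lemma row_sum_delta f o :
  row_sum M (fun e => (e == f)%:R) o = row_coef M o f.
Proof.
rewrite /row_sum (bigD1 f) //= eqxx mulr1 big1 ?addr0 // => e /negbTE->.
by rewrite mulr0.
Qed.

(** The two edges of [F] at a vertex [u1] are copied to a twin [u2]. A copy outside [F] is the
    chord. If both copies lie in [F], they close a 4-cycle, on which alternating signs give a kernel
    vector; the mask row cancels because twins agree on [M]. *)
Lemma twin_chord (F : {set {set T}}) : F \subset free ->
  (forall v, v \in cover F -> #|[set e in F | v \in e]| = 2%N) -> (2 <= #|F :&: M|)%N ->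
  (exists z, kernel_on M F z) \/ exists f, [/\ f \in free, f \notin F & f \subset cover F].
Proof.
move=> Ff reg le2.
have /card_gt1P [e1 [e2 [e1F e2F e12]]] : (1 < #|F :&: M|)%N by [].
have sub : F :&: M \subset free :&: M by apply: setSI.
have [a [b [ae1 be2 ab tab]]] := mask_tw (subsetP sub _ e1F) (subsetP sub _ e2F) e12.
have aF : a \in cover F by apply/bigcupP; exists e1 => //; case/setIP: e1F.
have bF : b \in cover F by apply/bigcupP; exists e2 => //; case/setIP: e2F.
have touch u : u \in cover F -> exists2 e, e \in free & u \in e.
  by case/bigcupP => e eF ue; exists e => //; apply: (subsetP Ff).
(* The irregular vertex [p] can spoil the copying in one direction only: if [a] has an edge of [F]
   to [p] and [b] has no free one, then no edge of [F] joins [b] to [p], and [b] can be copied to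
   [a]. *)
have [u1 [u2 [u12 u1F u2F t12 R]]] : exists u1 u2, [/\ u1 != u2, u1 \in cover F, u2 \in cover F,
    tw u1 u2 & forall w, [set u1; w] \in F -> [set u2; w] \in free].
  have Rgen u1 u2 : u1 \in cover F -> u2 \in cover F -> tw u1 u2 ->
      u2 != p -> (u1 == p) || ([set u1; p] \notin F) || ([set u2; p] \in free) ->
      forall w, [set u1; w] \in F -> [set u2; w] \in free.
    move=> H1 H2 t12 u2p H w wF; have [E|wp] := eqVneq w p; last first.
      by apply: (tw_free t12) => //; [apply: (subsetP Ff) | apply: touch].
    subst w; case/orP: H => [/orP[/eqP E|]|//]; last by rewrite wF.
    by have := free2 (subsetP Ff _ wF); rewrite E setUid cards1.
  have tba : tw b a by rewrite tw_sym.
  have [E|bp] := eqVneq b p.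
    exists b, a; split; rewrite // 1?eq_sym //; apply: Rgen => //; last by rewrite E eqxx.
    by rewrite -E.
  have [E|ap] := eqVneq a p.
    by exists a, b; split => //; apply: Rgen => //; rewrite E eqxx.
  have [H|H] := boolP (([set a; p] \notin F) || ([set b; p] \in free)).
    by exists a, b; split => //; apply: Rgen; rewrite ?(negbTE ap).
  exists b, a; split; rewrite // 1?eq_sym //; apply: Rgen => //.
  move: H; rewrite negb_or negbK => /andP[_ H].
  have -> : [set b; p] \notin F by apply: contraNN H; apply: (subsetP Ff).
  by rewrite orbT.
have c2 e : e \in F -> #|e| = 2%N by move/(subsetP Ff)/free2.
have /eqP/cards2P [g1 [g2 [g12 gE]]] := reg u1 u1F.
have : g1 \in [set e in F | u1 \in e] by rewrite gE !inE eqxx.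
have : g2 \in [set e in F | u1 \in e] by rewrite gE !inE eqxx orbT.
rewrite !inE => /andP[g2F ug2] /andP[g1F ug1].
have [w wu E1] := card2_other (c2 _ g1F) ug1.
have [w' wu' E2] := card2_other (c2 _ g2F) ug2.
have ww' : w != w' by apply: contraNneq g12 => H; rewrite E1 E2 H.
rewrite {}E1 {}E2 in g1F g2F; move=> {ug1 ug2 g12 gE}.
have inc v : [set u1; v] \in F -> v \in cover F.
  by move=> vF; apply/bigcupP; exists [set u1; v]; rewrite // !inE eqxx orbT.
have sub2 v : [set u1; v] \in F -> [set u2; v] \subset cover F.
  by move=> /inc vF; apply/subsetP => x; rewrite !inE => /orP[]/eqP->.
have [h1|h1] := boolP ([set u2; w] \in F); last first.
  by right; exists [set u2; w]; split; rewrite ?R ?sub2.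
have [h2|h2] := boolP ([set u2; w'] \in F); last first.
  by right; exists [set u2; w']; split; rewrite ?R ?sub2.
left.
have neq e (a' b' : T) : e \in F -> e = [set a'; b'] -> a' != b'.
  by move=> /c2 H E; apply: contra_eqN H => /eqP ab'; rewrite E ab' setUid cards1.
have u2w := neq _ _ _ h1 erefl; have u2w' := neq _ _ _ h2 erefl.
pose D f (e : {set T}) : rat := (e == f)%:R.
pose z e := (D [set u1; w] e + (-1) * D [set u2; w] e + (-1) * D [set u1; w'] e)
  + 1 * D [set u2; w'] e.
exists z; split.
- exists [set u1; w] => //; rewrite /z /D eqxx.
  have n1 : [set u1; w] != [set u2; w].
    apply/eqP => /set2_eq [[H _]|[H _]]; first by rewrite H eqxx in u12.
    by rewrite H eqxx in wu.
  have n2 : [set u1; w] != [set u1; w'].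
    apply/eqP => /set2_eq [[_ H]|[H _]]; first by rewrite H eqxx in ww'.
    by rewrite H eqxx in wu'.
  have n3 : [set u1; w] != [set u2; w'].
    apply/eqP => /set2_eq [[H _]|[H _]]; first by rewrite H eqxx in u12.
    by rewrite H eqxx in wu'.
  by rewrite (negbTE n1) (negbTE n2) (negbTE n3) !mulr0 !addr0.
- move=> e eF; have n f : f \in F -> D f e = 0.
    by move=> fF; rewrite /D; case: eqP => // H; rewrite H fF in eF.
  by rewrite /z !n // !mulr0 !addr0.
- move=> o; rewrite /z !row_sumD !row_sum_delta; case: o => [v|] /=.
    have H (a' b' : T) : a' != b' -> (v \in [set a'; b'])%:R = (v == a')%:R + (v == b')%:R :> rat.
      move=> ab'; rewrite !inE; case: eqP => [->|_]; rewrite ?add0r //= (negbTE ab') addr0 //.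
    rewrite !H // 1?eq_sym //; ring.
  rewrite (tw_mask t12 (subsetP Ff _ g1F) (subsetP Ff _ h1)).
  rewrite (tw_mask t12 (subsetP Ff _ g2F) (subsetP Ff _ h2)); ring.
Qed.
End Chord.

(** * Rounding in terms of classes and graphs *)

Section RoundGraph.
Local Open Scope ring_scope.
Variables (T : finType) (K : eqType) (cl : T -> K) (bone mask : rel K).
Variables (sigma : K -> int) (c : int).
Variables (lo hi : rel T) (p : T) (d : T -> nat) (tau : nat).

Definition host_rel : rel T := fun i j => bone (cl i) (cl j).
Definition mask_rel : rel T := fun i j => mask (cl i) (cl j).
Definition free_rel : rel T := fun i j => hi i j && ~~ lo i j.

Hypothesis bone_sym : symmetric bone.
Hypothesis bone_irr : irreflexive bone.
Hypothesis mask_one : forall a1 b1 a2 b2, mask a1 b1 -> mask a2 b2 -> a1 = a2 /\ b1 = b2.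
Hypothesis sigma1 : forall a, `|sigma a| = 1.
(** [c] is to be the sum of the signs at the ends of the guessed bone, which is nonzero when the
    bone closes an odd cycle. *)
Hypothesis c2 : `|c| <= 2.
Hypothesis sigma_bone : forall a1 a2, bone a1 a2 ->
  sigma a1 + sigma a2 = c * (mask a1 a2 || mask a2 a1)%:R.
Hypothesis lo_sym : symmetric lo.
Hypothesis hi_sym : symmetric hi.
Hypothesis hi_host : forall i j, hi i j -> host_rel i j.
(** [p] is the vertex whose pairs are being decided. Any other vertex with an open pair is one whose
    turn has not come. *)
Hypothesis free_complete : forall i j, i != p -> j != p -> host_rel i j ->
  (exists k, free_rel i k) -> (exists k, free_rel j k) -> free_rel i j.

Definition edge_set (r : rel T) : {set {set T}} :=
  [set e | [exists ij : T * T, (e == [set ij.1; ij.2]) && r ij.1 ij.2]].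

Lemma edge_setP (r : rel T) e : reflect (exists i j, e = [set i; j] /\ r i j) (e \in edge_set r).
Proof.
rewrite inE; apply: (iffP existsP) => [[[i j] /andP[/eqP-> H]]|[i [j [-> H]]]].
  by exists i, j.
by exists (i, j); rewrite eqxx.
Qed.

Lemma mem_edge_set (r : rel T) i j : symmetric r -> ([set i; j] \in edge_set r) = r i j.
Proof.
move=> rs; apply/edge_setP/idP => [[k [l [/set2_eq[[-> ->]|[-> ->]] //]]]|H].
  by rewrite rs.
by exists i, j.
Qed.

Let maskS : rel T := fun i j => host_rel i j && (mask_rel i j || mask_rel j i).
Let host := edge_set host_rel.
Let free := edge_set free_rel.
Let M := edge_set maskS.

Lemma host_sym : symmetric host_rel. Proof. by move=> i j; apply: bone_sym. Qed.
Lemma free_sym : symmetric free_rel.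
Proof. by move=> i j; rewrite /free_rel hi_sym lo_sym. Qed.
Lemma maskS_sym : symmetric maskS.
Proof. by move=> i j; rewrite /maskS host_sym orbC. Qed.

Lemma host_neq i j : host_rel i j -> i != j.
Proof. by apply: contraTneq => ->; rewrite /host_rel bone_irr. Qed.

Lemma hostS2 e : e \in host -> #|e| = 2%N.
Proof. by case/edge_setP => i [j [-> /host_neq H]]; rewrite cards2 H. Qed.

Lemma freeS_host : free \subset host.
Proof.
apply/subsetP => e /edge_setP [i [j [-> /andP[/hi_host H _]]]].
by rewrite mem_edge_set //; apply: host_sym.
Qed.

(** The two signs on an edge cancel, except in the guessed bone, where their sum [c] is cancelled by
    the mask row. *)
Let rho (o : option T) : int := if o is Some v then sigma (cl v) else - c.

Lemma graph_rho_row e : e \in host -> \sum_o (rho o)%:~R * row_coef M o e = 0.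
Proof.
case/edge_setP => i [j [-> H]]; have ij := host_neq H.
rewrite sum_option /= mem_edge_set; last exact: maskS_sym.
rewrite (bigD1 i) //= (bigD1 j) /=; last by rewrite eq_sym.
rewrite !inE !eqxx orbT !mulr1 big1 ?addr0; last first.
  by move=> k /andP[ki kj]; rewrite !inE (negbTE ki) (negbTE kj) mulr0.
have := sigma_bone H; rewrite /maskS H /= -/(mask_rel i j) -/(mask_rel j i).
rewrite -intrD => ->; case: (_ || _); rewrite ?mulr1 ?mulr0 ?addr0 //.
by rewrite -intrD addNr.
Qed.

Lemma row_sum_vertex (y : {set T} -> rat) v : (forall e, e \notin host -> y e = 0) ->
  row_sum M y (Some v) = \sum_j y [set v; j].
Proof.
move=> y0; rewrite /row_sum -(big_imset (h := fun j => [set v; j]) (A := predT) (fun e => y e)) /=; last first.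
  by move=> j k _ _ /set2_eq [[_ ->]|[-> ->]].
rewrite (bigID [in [set [set v; j] | j in predT]]) /= [X in _ + X]big1 ?addr0; last first.
  move=> e eN; case: (boolP (v \in e)) => ve; last by rewrite mul0r.
  rewrite y0 ?mulr0 //; apply: contraNN eN => /hostS2 ec.
  by have [w _ ->] := card2_other ec ve; apply/imsetP; exists w.
apply: eq_bigr => e /imsetP [j _ ->]; by rewrite !inE eqxx mul1r.
Qed.

(** [mask_rel] singles out one orientation of each edge of the bone, so the sum over ordered pairs
    counts every edge once. *)
Lemma row_sum_mask (y : {set T} -> rat) : (forall e, e \notin host -> y e = 0) ->
  row_sum M y None = \sum_i \sum_j (mask_rel i j)%:R * y [set i; j].
Proof.
move=> y0; rewrite pair_big /=.
pose A := [set ij : T * T | host_rel ij.1 ij.2 && mask_rel ij.1 ij.2].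
rewrite [RHS](bigID [in A]) /= [X in _ = _ + X]big1 ?addr0; last first.
  move=> [i j]; rewrite inE negb_and /= => /orP[H|/negbTE->]; last by rewrite mul0r.
  by rewrite y0 ?mulr0 // mem_edge_set //; exact: host_sym.
have inj : {in A &, injective (fun ij : T * T => [set ij.1; ij.2])}.
  move=> [i j] [k l]; rewrite !inE /= => /andP[H1 H2] /andP[H3 H4] /set2_eq [[-> ->] //|[E1 E2]].
  subst k l; have [E _] := mask_one H2 H4.
  by move: H1; rewrite /host_rel E bone_irr.
rewrite (eq_bigr (fun ij => y [set ij.1; ij.2])); last first.
  by move=> [i j]; rewrite inE /= => /andP[_ ->]; rewrite mul1r.
rewrite -(big_imset (fun e => y e) inj) /row_sum /=.
rewrite (bigID [in [set [set ij.1; ij.2] | ij in A]]) /= [X in _ + X]big1 ?addr0; last first.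
  move=> e eN; have [/edge_setP [i [j [E /andP[H mij]]]]|_] := boolP (e \in M); last by rewrite mul0r.
  case/negP: eN; rewrite E; case/orP: mij => m.
    by apply/imsetP; exists (i, j); rewrite // inE /= H.
  apply/imsetP; exists (j, i); last exact: setUC.
  by rewrite inE /= host_sym H.
apply: eq_bigr => e /imsetP [[i j]]; rewrite inE /= => /andP[H1 H2] ->.
by rewrite mem_edge_set ?/maskS ?H1 ?H2 ?mul1r //; exact: maskS_sym.
Qed.

Theorem round_graph (X : T -> T -> rat) (delta : rat) :
  (forall i j, X i j = X j i) -> (forall i j, 0 <= X i j <= 1) ->
  (forall i j, lo i j -> X i j = 1) -> (forall i j, ~~ hi i j -> X i j = 0) ->
  (forall i, `|\sum_j X i j - (d i)%:R| <= delta) ->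
  `|\sum_i \sum_j (mask_rel i j)%:R * X i j - tau%:R| <= delta ->
  delta * (1 + (#|T| ^ 2).+1%:R * #|T|%:R) < 1 / 2 ->
  exists g : rel T, [/\ symmetric g, forall i j, lo i j -> g i j, forall i j, g i j -> hi i j,
    forall i, (\sum_j g i j = d i)%N & (\sum_i \sum_j (mask_rel i j && g i j) = tau)%N].
Proof.
move=> Xs X01 Xlo Xhi Hd Hm Hdelta.
pose b o : int := if o is Some v then Posz (d v) else Posz tau.
pose x (e : {set T}) : rat :=
  if [pick ij : T * T | e == [set ij.1; ij.2]] is Some ij then X ij.1 ij.2 else 0.
have xE i j : x [set i; j] = X i j.
  rewrite /x; case: pickP => [[k l] /eqP/set2_eq [[-> ->]|[-> ->]] //=|/(_ (i, j))].
  by rewrite eqxx.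
have x0 e : e \notin host -> x e = 0.
  rewrite /x; case: pickP => // -[k l] /eqP -> /=; rewrite mem_edge_set; last exact: host_sym.
  by move=> H; apply: Xhi; apply: contraNN H; apply: hi_host.
have Hx : in_box x.
  by move=> e; rewrite /x; case: pickP => [[k l] _|_] //; rewrite lexx ler01.
have Hx2 e : e \notin free -> x e = 0 \/ x e = 1.
  rewrite /x; case: pickP => [[k l] /eqP -> /=|_ _]; last by left.
  rewrite mem_edge_set; last exact: free_sym.
  rewrite /free_rel negb_and negbK => /orP[H|H]; first by left; apply: Xhi.
  by right; apply: Xlo.
have Hf : fractional x \subset free.
  apply/subsetP => e; rewrite inE; apply: contraTT => /Hx2 [->|->]; by rewrite ltxx ?andbF.
have erv v : `|row_err M b x (Some v)| <= delta.
  rewrite /row_err row_sum_vertex //; under eq_bigr do rewrite xE.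
  exact: Hd.
have ern : `|row_err M b x None| <= delta.
  rewrite /row_err row_sum_mask //; under eq_bigr do under eq_bigr do rewrite xE.
  exact: Hm.
have cF : (#|fractional x| <= #|T| ^ 2)%N.
  have sub : fractional x \subset [set [set ij.1; ij.2] | ij : T * T].
    apply: subset_trans Hf _; apply: subset_trans freeS_host _; apply/subsetP => e.
    by case/edge_setP => i [j [-> _]]; apply/imsetP; exists (i, j).
  apply: leq_trans (subset_leq_card sub) _; apply: leq_trans (leq_imset_card _ _) _.
  by rewrite card_prod expnS expn1.
(* At most [#|T| ^ 2] edges are fractional, and there are [#|T|] vertex errors and one mask error,
   each at most [delta]. *)
have sl : slack M b x < 1 / 2.
  apply: le_lt_trans Hdelta; rewrite /slack mulrDr mulr1; apply: lerD => //.
  rewrite mulrCA; apply: ler_pM; rewrite ?ler0n ?sumr_ge0 ?ler_nat //.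
  apply: le_trans (_ : \sum_(v : T) delta <= _); first by apply: ler_sum.
  by rewrite sumr_const mulr_natr.
have rc := graph_rho_row.
have rN : `|rho None| <= 2 by rewrite /= normrN.
have [y [Hy Ey Fy yE]] := approx_exact hostS2 freeS_host rc (fun v => sigma1 (cl v))
  rN (leqnn _) Hx Hf x0 sl.
have chord := @twin_chord T free M (fun i j => cl i == cl j) p.
have [w [Hw Ew Fw wE]] : exists y', [/\ in_box y', on_target M b y', fractional y' = set0 &
    forall e, e \notin free -> y' e = y e].
  apply: (exact_round hostS2 freeS_host rc (fun v => sigma1 (cl v)) rN _ (leqnn _)) => //.
  have freeE i j : ([set i; j] \in free) = free_rel i j by apply: mem_edge_set; apply: free_sym.
  have ME i j : ([set i; j] \in M) = maskS i j by apply: mem_edge_set; apply: maskS_sym.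
  have fh i j : free_rel i j -> host_rel i j by case/andP => /hi_host.
  apply: chord.
  - by move=> e /(subsetP freeS_host)/hostS2.
  - by move=> i j; rewrite eq_sym.
  - move=> u1 u2 v /eqP tE; rewrite !freeE => H u2p vp [e /edge_setP [i [j [-> ij]]]].
    move=> ue; apply: free_complete => //.
    + by move: (fh _ _ H); rewrite /host_rel tE.
    + by move: ue; rewrite !inE => /orP[]/eqP->; [exists j | exists i; rewrite free_sym].
    + by exists u1; rewrite free_sym.
  - move=> u1 u2 v /eqP tE _ _; rewrite !ME /maskS /host_rel /mask_rel tE //.
  - move=> e1 e2 /setIP[_ /edge_setP [i1 [j1 [-> /andP[_ m1]]]]].
    move=> /setIP[_ /edge_setP [i2 [j2 [-> /andP[_ m2]]]]].
    (* Once both edges are oriented along the bone, their first ends share a class and so do their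
       second ends. As the edges differ, one of these pairs consists of distinct twins. *)
    wlog m1' : i1 j1 m1 / mask_rel i1 j1.
      move=> IH; case/orP: (m1) => H; first exact: IH.
      by rewrite [[set i1; j1]]setUC; apply: IH; rewrite // orbC.
    wlog m2' : i2 j2 m2 / mask_rel i2 j2.
      move=> IH; case/orP: (m2) => H; first exact: IH.
      by rewrite [[set i2; j2]]setUC; apply: IH; rewrite // orbC.
    move=> ne; have [E1 E2] := mask_one m1' m2'.
    have [E|i12] := eqVneq i1 i2; last by exists i1, i2; rewrite !inE !eqxx E1; split.
    have [E'|j12] := eqVneq j1 j2; last by exists j1, j2; rewrite !inE !eqxx !orbT E2; split.
    by rewrite E E' eqxx in ne.
have wx e : e \notin free -> w e = x e by move=> H; rewrite wE // yE.
have w0 e : e \notin host -> w e = 0.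
  by move=> H; rewrite wx ?x0 //; apply: contraNN H; apply: (subsetP freeS_host).
have w01 e : w e = (w e == 1)%:R.
  have : e \notin fractional w by rewrite Fw inE.
  by move/(boxNfrac Hw) => [->|->]; rewrite ?eqxx // eq_sym oner_eq0.
have wnf i j : ~~ free_rel i j -> w [set i; j] = X i j.
  by move=> H; rewrite wx ?xE // mem_edge_set //; exact: free_sym.
exists (fun i j => w [set i; j] == 1); split.
- by move=> i j; rewrite setUC.
- by move=> i j H; rewrite wnf ?Xlo // /free_rel H andbF.
- by move=> i j; apply: contraTT => H; rewrite wnf ?Xhi // /free_rel (negbTE H).
- move=> i; have := Ew (Some i); rewrite row_sum_vertex // => H.
  apply/eqP; rewrite -(eqr_nat rat) natr_sum -[X in _ == X]H; apply/eqP/eq_bigr => j _.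
  by rewrite [RHS]w01.
- have := Ew None; rewrite row_sum_mask // => H.
  apply/eqP; rewrite -(eqr_nat rat) natr_sum -[X in _ == X]H; apply/eqP/eq_bigr => i _.
  rewrite natr_sum; apply: eq_bigr => j _; rewrite [in RHS]w01.
  by case: (mask_rel i j); rewrite ?mul1r ?mul0r.
Qed.
End RoundGraph.

(** * Deciding feasibility by the Frank-Wolfe method *)

Section FrankWolfe.
Variable T : finType.
Variables (lo hi m : rel T) (d : T -> nat) (tau : nat).
Implicit Types (X : T -> T -> nat) (g : rel T).

(** [fw_gain - fw_goal] is, up to a positive factor, the partial derivative of the squared distance
    along the pair [i j]. Selecting the pairs where it is negative minimises the linearised
    distance. *)
Definition fw_gain X i j := \sum_l X i l + \sum_l X j l +
  (m i j + m j i) * \sum_a \sum_b m a b * X a b.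

Definition fw_goal k i j := k * (d i + d j + (m i j + m j i) * tau).

Definition fw_select k X i j := lo i j || hi i j && (fw_gain X i j < fw_goal k i j).

(* [fw k] is [k] times the [k]-th iterate, which keeps it integral. *)
Fixpoint fw k : T -> T -> nat :=
  if k is k'.+1 then fun i j => fw k' i j + fw_select k' (fw k') i j else fun _ _ => 0.

Definition feasible g := [/\ symmetric g, forall i j, lo i j -> g i j, forall i j, g i j -> hi i j,
  forall i, \sum_j g i j = d i & \sum_i \sum_j (m i j && g i j) = tau].

(** Cleared of denominators: [r / k] lies within [1 / N] of [target]. *)
Definition near N k (r target : nat) := (N * r <= N * k * target + k) && (N * k * target <= N * r + k).

Definition fw_test N k := let X := fw k in
  [forall i, near N k (\sum_j X i j) (d i)] &&
  near N k (\sum_a \sum_b m a b * X a b) tau.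

Hypothesis lo_sym : symmetric lo.
Hypothesis hi_sym : symmetric hi.
Hypothesis lo_hi : forall i j, lo i j -> hi i j.

Lemma fw_select_sym k X i j : fw_select k X i j = fw_select k X j i.
Proof.
rewrite /fw_select lo_sym hi_sym /fw_gain /fw_goal.
by rewrite [\sum_l X i l + _]addnC [d i + _]addnC [(m i j : nat) + _]addnC.
Qed.

Lemma fw_sym k i j : fw k i j = fw k j i.
Proof. by elim: k => //= k ->; rewrite fw_select_sym. Qed.

Lemma fw_le k i j : fw k i j <= k.
Proof. by elim: k => //= k IH; case: fw_select; rewrite ?addn1 ?addn0 // leqW. Qed.

Lemma fw_lo k i j : lo i j -> fw k i j = k.
Proof. by move=> H; elim: k => //= k ->; rewrite /fw_select H addn1. Qed.

Lemma fw_hi k i j : ~~ hi i j -> fw k i j = 0.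
Proof.
move=> H; elim: k => //= k ->; rewrite /fw_select (negbTE H) orbF.
by rewrite (negbTE (contraNN (@lo_hi i j) H)).
Qed.

Section Potential.
Local Open Scope ring_scope.
Variable g : rel T.
Hypothesis feasible_g : feasible g.
Let n := #|T|.

Let R k i : int := (\sum_j fw k i j)%N%:Z - (k * d i)%N%:Z.
Let Rm k : int := (\sum_a \sum_b m a b * fw k a b)%N%:Z - (k * tau)%N%:Z.
Let delta k i j : int := (fw_select k (fw k) i j)%:Z - (g i j)%:Z.

Lemma PoszD_sum (I : finType) (F : I -> nat) : (\sum_i F i)%N%:Z = \sum_i (F i)%:Z.
Proof. by rewrite -[LHS]natz natr_sum; apply: eq_bigr => i _; rewrite natz. Qed.

Lemma fw_residual k i : R k.+1 i = R k i + \sum_j delta k i j.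
Proof.
have [_ _ _ Hd _] := feasible_g; rewrite /R -(Hd i) /delta sumrB -!PoszD_sum /= big_split /=; nia.
Qed.

Lemma fw_mask_residual k : Rm k.+1 = Rm k + \sum_i \sum_j (m i j)%:Z * delta k i j.
Proof.
have [_ _ _ _ Hm] := feasible_g; rewrite /Rm -Hm.
have -> : (\sum_a \sum_b m a b * fw k.+1 a b = \sum_a \sum_b m a b * fw k a b +
    \sum_a \sum_b (m a b && fw_select k (fw k) a b))%N.
  rewrite -big_split; apply: eq_bigr => a _ /=; rewrite -big_split; apply: eq_bigr => b _ /=.
  by rewrite mulnDr; case: (m a b); rewrite ?mul1n ?mul0n.
have -> : \sum_i \sum_j (m i j)%:Z * delta k i j =
    (\sum_a \sum_b (m a b && fw_select k (fw k) a b))%N%:Z - (\sum_i \sum_j (m i j && g i j))%N%:Z.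
  rewrite !PoszD_sum -sumrB; apply: eq_bigr => i _; rewrite !PoszD_sum -sumrB.
  by apply: eq_bigr => j _; rewrite /delta; case: (m i j); rewrite ?mul1r ?mul0r.
rewrite mulSn !PoszD; lia.
Qed.

Lemma delta_norm k i j : `|delta k i j| <= 1.
Proof. by rewrite /delta; case: fw_select; case: g. Qed.

(* The selected edges minimise the linear form given by the residuals. *)
Lemma fw_descent k : (\sum_i R k i * \sum_j delta k i j +
  Rm k * \sum_i \sum_j (m i j)%:Z * delta k i j) *+ 2 <= 0.
Proof.
have dsym i j : delta k i j = delta k j i.
  by have [gs _ _ _ _] := feasible_g; rewrite /delta fw_select_sym gs.
(* The doubled sum can be symmetrised, which puts the derivative along the pair [i j] as the factor
   of [delta k i j]. *)
have -> : (\sum_i R k i * \sum_j delta k i j +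
    Rm k * \sum_i \sum_j (m i j)%:Z * delta k i j) *+ 2 =
   \sum_i \sum_j delta k i j * (R k i + R k j + ((m i j)%:Z + (m j i)%:Z) * Rm k).
  have E1 : \sum_i R k i * \sum_j delta k i j = \sum_i \sum_j delta k i j * R k i.
    by apply: eq_bigr => i _; rewrite mulr_sumr; apply: eq_bigr => j _; rewrite mulrC.
  have E2 : \sum_i R k i * \sum_j delta k i j = \sum_i \sum_j delta k i j * R k j.
    by rewrite E1 exchange_big; do 2 apply: eq_bigr => ? _; rewrite dsym.
  have E3 : Rm k * (\sum_i \sum_j (m i j)%:Z * delta k i j) =
      \sum_i \sum_j delta k i j * ((m i j)%:Z * Rm k).
    rewrite mulr_sumr; apply: eq_bigr => i _; rewrite mulr_sumr; apply: eq_bigr => j _; ring.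
  have E4 : Rm k * (\sum_i \sum_j (m i j)%:Z * delta k i j) =
      \sum_i \sum_j delta k i j * ((m j i)%:Z * Rm k).
    by rewrite E3 exchange_big; do 2 apply: eq_bigr => ? _; rewrite dsym.
  rewrite mulr2n {1}E1 E2 {1}E3 E4 -!big_split; apply: eq_bigr => i _ /=.
  by rewrite -!big_split; apply: eq_bigr => j _ /=; ring.
apply: sumr_le0 => i _; apply: sumr_le0 => j _.
have [_ glo ghi _ _] := feasible_g.
have -> : R k i + R k j + ((m i j)%:Z + (m j i)%:Z) * Rm k =
    (fw_gain (fw k) i j)%:Z - (fw_goal k i j)%:Z.
  rewrite /R /Rm /fw_gain /fw_goal; set a := (\sum_l fw k i l)%N; set b := (\sum_l fw k j l)%N.
  set c := (\sum_a _)%N; nia.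
rewrite /delta /fw_select; case L: (lo i j) => /=.
  by rewrite (glo _ _ L) subrr mul0r.
case H: (hi i j) => /=; last first.
  case G: (g i j) => /=; last by rewrite subrr mul0r.
  by rewrite (ghi _ _ G) in H.
(* On an open pair the selection is 1 exactly where the derivative is negative, and no value of
   [g i j] does better. *)
by case: ltnP => C; case: (g i j) => /=; nia.
Qed.

Lemma sqr_norm_le (a c : int) : `|a| <= c -> a ^+ 2 <= c ^+ 2.
Proof.
move=> H; rewrite -real_normK ?num_real //; apply: lerXn2r => //; rewrite nnegrE //.
exact: le_trans H.
Qed.

(** The cross terms of a step are at most zero by [fw_descent]. The squared changes add at most
    [n * n ^ 2] for the [n] vertex rows and [(n ^ 2) ^ 2] for the mask row. *)
Lemma fw_potential k : \sum_i R k i ^+ 2 + Rm k ^+ 2 <= (k * (n ^ 3 + n ^ 4))%N%:Z.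
Proof.
elim: k => [|k IH].
  have R0 i : R 0 i = 0 by rewrite /R big1.
  have -> : Rm 0 = 0.
    by rewrite /Rm big1 // => a _; rewrite big1 // => b _; rewrite muln0.
  by rewrite big1 // => i _; rewrite R0.
have nrm i : `|\sum_j delta k i j| <= n%:Z.
  apply: le_trans (ler_norm_sum _ _ _) _; apply: le_trans (_ : \sum_(j : T) 1 <= _).
    by apply: ler_sum => j _; apply: delta_norm.
  by rewrite sumr_const natz.
have nrmM : `|\sum_i \sum_j (m i j)%:Z * delta k i j| <= (n ^ 2)%N%:Z.
  apply: le_trans (ler_norm_sum _ _ _) _; apply: le_trans (_ : \sum_(i : T) n%:Z <= _).
    apply: ler_sum => i _; apply: le_trans (ler_norm_sum _ _ _) _.
    apply: le_trans (_ : \sum_(j : T) 1 <= _); last by rewrite sumr_const natz.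
    apply: ler_sum => j _; rewrite normrM; case: (m i j); last by rewrite normr0 mul0r.
    by rewrite normr1 mul1r delta_norm.
  by rewrite sumr_const -mulr_natr natz expnS expn1.
have S1 : \sum_i (\sum_j delta k i j) ^+ 2 <= (n ^ 3)%N%:Z.
  apply: le_trans (_ : \sum_(i : T) n%:Z ^+ 2 <= _).
    by apply: ler_sum => i _; apply: sqr_norm_le.
  by rewrite sumr_const -mulr_natr natz -/n; lia.
have S2 := sqr_norm_le nrmM.
have D := fw_descent k.
have -> : \sum_i R k.+1 i ^+ 2 = \sum_i R k i ^+ 2 +
   (\sum_i R k i * \sum_j delta k i j) *+ 2 + \sum_i (\sum_j delta k i j) ^+ 2.
  rewrite -sumrMnl -!big_split; apply: eq_bigr => i _ /=.
  by rewrite fw_residual sqrrD.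
rewrite fw_mask_residual sqrrD.
move: D IH S1 S2; rewrite mulrnDl.
set A := \sum_i R k i ^+ 2; set B := (\sum_i R k i * _) *+ 2; set C := \sum_i _ ^+ 2.
set E := (Rm k * _) *+ 2; set F := (\sum_i \sum_j _) ^+ 2; set G := Rm k ^+ 2.
have -> : ((n ^ 2)%N%:Z ^+ 2 = (n ^ 4)%N%:Z) by rewrite -!natz -natrX -expnM.
rewrite mulSn !PoszD.
lia.
Qed.

(** A residual of [sqrt (k * D)] after [k] steps becomes [sqrt (D / k)] on average, which is at most
    [1 / N] once [k] reaches [N ^ 2 * D]. The successor keeps [k] positive. *)
Lemma near_sqr N k (r t : nat) (D : nat) : k = (N ^ 2 * D.+1)%N ->
  (r%:Z - (k * t)%N%:Z) ^+ 2 <= (k * D)%N%:Z -> near N k r t.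
Proof.
move=> kE H.
have : `|N%:Z * (r%:Z - (k * t)%N%:Z)| <= k%:Z.
  rewrite -(ler_pXn2r (isT : (0 < 2)%N)) ?nnegrE // real_normK ?num_real //.
  rewrite exprMn; apply: le_trans (_ : N%:Z ^+ 2 * (k * D)%N%:Z <= _).
    by apply: ler_wpM2l; rewrite ?sqr_ge0.
  rewrite -!natz -!natrX -natrM ler_nat [(k ^ 2)%N]expnS expn1 {3}kE.
  by rewrite mulnCA leq_mul2l leq_mul2l leqnSn !orbT.
rewrite /near ler_norml => /andP[].
by move: H kE => _ _; nia.
Qed.

Lemma fw_complete N k : k = (N ^ 2 * (n ^ 3 + n ^ 4).+1)%N -> fw_test N k.
Proof.
move=> kE; have H := fw_potential k; apply/andP; split.
  apply/forallP => i; apply: (near_sqr kE); apply: le_trans H.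
  rewrite [X in _ <= X + _](bigD1 i) //= -!addrA lerDl addr_ge0 ?sqr_ge0 //.
  by apply: sumr_ge0 => j _; apply: sqr_ge0.
apply: (near_sqr kE); apply: le_trans H; rewrite lerDr.
by apply: sumr_ge0 => j _; apply: sqr_ge0.
Qed.
End Potential.
End FrankWolfe.

Section FrankWolfeSound.
Local Open Scope ring_scope.
Variables (T : finType) (K : eqType) (cl : T -> K) (bone mask : rel K).
Variables (sigma : K -> int) (c : int).
Variables (lo hi : rel T) (p : T) (d : T -> nat) (tau : nat).

Lemma near_dist N k (r t : nat) : (0 < N)%N -> (0 < k)%N -> near N k r t ->
  `|r%:R / k%:R - t%:R| <= N%:R^-1 :> rat.
Proof.
move=> N0 k0 /andP[H1 H2].
have N0' : 0 < N%:R :> rat by rewrite ltr0n.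
have k0' : 0 < k%:R :> rat by rewrite ltr0n.
move: H1 H2; rewrite -!(ler_nat rat) !natrD !natrM => H1 H2.
set u : rat := N%:R^-1; have Nu : u * N%:R = 1 by rewrite mulVf ?lt0r_neq0.
have u0 : 0 <= u by rewrite invr_ge0 ltW.
have := ler_wpM2l u0 H1; have := ler_wpM2l u0 H2; rewrite !mulrDr !mulrA Nu !mul1r => H3 H4.
rewrite ler_norml lerBDr lerBlDr ler_pdivrMr // ler_pdivlMr // !mulrDl mulNr.
by apply/andP; split; lra.
Qed.

(** The converse of [fw_complete]: an iterate that passes is, divided by [k], close enough to be
    rounded. Both together make the numerical test an exact decision. *)
Lemma fw_sound N k :
  symmetric bone -> irreflexive bone ->
  (forall a1 b1 a2 b2, mask a1 b1 -> mask a2 b2 -> a1 = a2 /\ b1 = b2) ->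
  (forall a, `|sigma a| = 1) -> `|c| <= 2 ->
  (forall a1 a2, bone a1 a2 -> sigma a1 + sigma a2 = c * (mask a1 a2 || mask a2 a1)%:R) ->
  symmetric lo -> symmetric hi -> (forall i j, lo i j -> hi i j) ->
  (forall i j, hi i j -> host_rel cl bone i j) ->
  (forall i j, i != p -> j != p -> host_rel cl bone i j ->
    (exists l, free_rel lo hi i l) -> (exists l, free_rel lo hi j l) -> free_rel lo hi i j) ->
  (0 < k)%N -> (2 * (#|T| ^ 3 + #|T| + 1) < N)%N ->
  fw_test lo hi (mask_rel cl mask) d tau N k ->
  exists g, feasible lo hi (mask_rel cl mask) d tau g.
Proof.
move=> bs bi m1 s1 c2 sb los his lohi hih fc k0 HN /andP[/forallP Hd Hm].
have N0 : (0 < N)%N by apply: leq_ltn_trans HN.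
set m := mask_rel cl mask in Hd Hm *.
pose X i j : rat := (fw lo hi m d tau k i j)%:R / k%:R.
have k0' : 0 < k%:R :> rat by rewrite ltr0n.
apply: (@round_graph T K cl bone mask sigma c lo hi p d tau bs bi m1 s1 c2 sb los his hih fc X N%:R^-1).
- by move=> i j; rewrite /X fw_sym.
- by move=> i j; rewrite /X divr_ge0 ?ler0n //= ler_pdivrMr // mul1r ler_nat fw_le.
- by move=> i j H; rewrite /X fw_lo // divff ?lt0r_neq0.
- by move=> i j H; rewrite /X fw_hi // mul0r.
- move=> i; have := near_dist N0 k0 (Hd i).
  by rewrite natr_sum mulr_suml.
- have := near_dist N0 k0 Hm; rewrite natr_sum mulr_suml.
  under eq_bigr do rewrite natr_sum mulr_suml.
  by under eq_bigr do under eq_bigr do rewrite natrM -mulrA.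
(* The bound on [N] is the condition on [delta] in [round_graph], read at [delta = 1 / N]. *)
- rewrite mulrC ltr_pdivrMr ?ltr0n //.
  have : (2 * (1 + (#|T| ^ 2).+1 * #|T|) < N)%N by apply: leq_ltn_trans HN; lia.
  by rewrite -(ltr_nat rat) natrM natrD natrM; lra.
Qed.
End FrankWolfeSound.

(** * Forests and unicyclic graphs *)

Section Forests.
Variable T : finType.
Implicit Types (E F : {set {set T}}) (e : {set T}).

Definition acyclic E := forall s, ~ is_cycle E s.

Lemma adj_sym E : symmetric (adj E).
Proof. by move=> x y; rewrite /adj setUC. Qed.

Lemma is_cycle_sub E F s : E \subset F -> is_cycle E s -> is_cycle F s.
Proof.
move=> EF [s3 /andP[c u]]; split => //; rewrite /ucycle u andbT.
by apply: sub_cycle c => x y; apply: (subsetP EF).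
Qed.

Lemma acyclic_sub E F : E \subset F -> acyclic F -> acyclic E.
Proof. by move=> EF aF s /(is_cycle_sub EF); apply: aF. Qed.

(** A path from [x] to [y] that avoids the edge would close to a cycle with it; shortening makes the
    path simple. *)
Lemma bridge E x y : acyclic E -> x != y -> [set x; y] \in E ->
  ~~ connect (adj (E :\ [set x; y])) x y.
Proof.
move=> aE xy exy; apply/negP => /connectP [p0 p0p p0y].
case/shortenP: p0p p0y => p pp up _ ly.
apply: (aE (x :: p)); split.
  case: p pp ly {up} => [|z [|w p]] //=; first by move=> _ E0; rewrite E0 eqxx in xy.
  by rewrite andbT /adj => H E0; rewrite -E0 !inE eqxx in H.
rewrite /ucycle up andbT /= rcons_path -ly {2}/adj setUC exy andbT.
by apply: sub_path pp => u v; rewrite /adj !inE => /andP[].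
Qed.

(** One edge is removed. If the colouring of the rest gives its ends equal colours, flipping the
    component of [x] repairs this, since by [bridge] that component misses [y]. *)
Lemma forest_coloring E : (forall e, e \in E -> #|e| = 2) -> acyclic E ->
  exists sg : T -> bool, forall x y, [set x; y] \in E -> sg x != sg y.
Proof.
have [n] := ubnP #|E|; elim: n E => // n IH E; rewrite ltnS => le E2 aE.
have [->|[e eE]] := set_0Vmem E; first by exists (fun=> true) => x y; rewrite inE.
have /eqP/cards2P [x [y [xy Ee]]] := E2 e eE; subst e.
set F := E :\ [set x; y].
have FE : F \subset E by apply: subD1set.
have br := bridge aE xy eE.
have [||sg Hsg] := IH F _ _ (acyclic_sub FE aE).
- by apply: leq_trans le; rewrite [X in _ < X](cardsD1 [set x; y]) eE.
- by move=> e /(subsetP FE)/E2.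
have [same|diff] := eqVneq (sg x) (sg y); last first.
  exists sg => u v uvE; have [E0|ne] := eqVneq [set u; v] [set x; y].
    by case: (set2_eq E0) => -[-> ->]; rewrite // eq_sym.
  by apply: Hsg; rewrite !inE ne.
exists (fun v => sg v (+) connect (adj F) x v) => u v uvE.
have [E0|ne] := eqVneq [set u; v] [set x; y].
  by case: (set2_eq E0) => -[-> ->]; rewrite connect0 (negbTE br) same; case: (sg y).
have uvF : [set u; v] \in F by rewrite !inE ne.
have cuv : connect (adj F) u v by apply: connect1.
rewrite (same_connect_r (sym_connect_sym (@adj_sym F)) cuv).
by have := Hsg u v uvF; case: (sg u); case: (sg v); case: connect.
Qed.

(** The vertex equations on the side of [x] of the bridge [e] are added with the signs of a
    2-colouring. Any other edge has both ends on one side, with opposite signs, so only [w e]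
    survives. *)
Lemma forest_weights E (w : {set T} -> int) : (forall e, e \in E -> #|e| = 2) -> acyclic E ->
  (forall x, (\sum_(e in E | x \in e) w e = 0)%R) -> forall e, e \in E -> w e = 0%R.
Proof.
move=> E2 aE Hw e eE; have [sg Hsg] := forest_coloring E2 aE.
have /eqP/cards2P [x [y [xy Ee]]] := E2 e eE.
have br := bridge aE xy (eq_ind _ (fun e => e \in E) eE _ Ee).
set F := E :\ [set x; y] in br.
pose S v := connect (adj F) x v.
pose s v : int := ((-1) ^+ sg v)%R.
have : (\sum_(v | S v) s v * \sum_(f in E | v \in f) w f = 0)%R.
  by rewrite big1 // => v _; rewrite Hw mulr0.
have -> : (\sum_(v | S v) s v * \sum_(f in E | v \in f) w f =
   \sum_(f in E) w f * \sum_(v | S v && (v \in f)) s v)%R.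
  transitivity (\sum_(v | S v) \sum_(f in E) (v \in f)%:R * (s v * w f))%R.
    apply: eq_bigr => v _; rewrite mulr_sumr big_mkcondr; apply: eq_bigr => f _.
    by case: (v \in f); rewrite ?mul1r ?mul0r.
  rewrite exchange_big; apply: eq_bigr => f _; rewrite mulr_sumr [RHS]big_mkcondr.
  by apply: eq_bigr => v _; case: (v \in f); rewrite ?mul1r ?mul0r // mulrC.
rewrite (bigD1 e) //= [X in (_ + X)%R]big1 ?addr0; last first.
  move=> f /andP[fE fe]; have /eqP/cards2P [u [v [uv Ef]]] := E2 f fE.
  have cuv : adj F u v by rewrite /adj !inE -Ef -Ee fe.
  have Suv : S u = S v.
    by rewrite /S (same_connect_r (sym_connect_sym (@adj_sym F)) (connect1 cuv)).
  have suv : (s u + s v = 0)%R.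
    by have := Hsg u v; rewrite -Ef fE => /(_ isT); rewrite /s; case: (sg u); case: (sg v).
  case Su : (S u); last first.
    rewrite [X in (_ * X)%R]big1 ?mulr0 // => z /andP[Sz]; rewrite Ef !inE => /orP[]/eqP H.
      by rewrite -H Sz in Su.
    by rewrite Suv -H Sz in Su.
  rewrite (bigD1 u) /=; last by rewrite Su Ef !inE eqxx.
  rewrite (bigD1 v) /=; last by rewrite -Suv Su Ef !inE eqxx orbT eq_sym uv.
  rewrite big1 ?addr0 ?suv ?mulr0 // => z /andP[/andP[/andP[_]]].
  by rewrite Ef !inE => /orP[]/eqP ->; rewrite eqxx.
rewrite (bigD1 x) /=; last by rewrite /S connect0 Ee !inE eqxx.
rewrite big1 ?addr0; last first.
  move=> z /andP[/andP[Sz]]; rewrite Ee !inE => /orP[]/eqP zE; first by rewrite zE eqxx.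
  by rewrite /S zE (negbTE br) in Sz.
by move/eqP; rewrite mulf_eq0 /s signr_eq0 orbF => /eqP.
Qed.

(** A cycle repeats no vertex, so its length is bounded and the existence of one is decidable. *)
Lemma cycle_or_acyclic E : acyclic E \/ exists s, is_cycle E s.
Proof.
have [/existsP [n /existsP [t /andP[t3 tc]]]|H] :=
    boolP [exists n : 'I_(#|T|.+1), [exists t : n.-tuple T, (2 < n) && ucycleb (adj E) t]].
  by right; exists t; split; rewrite ?size_tuple.
left => s [s3 sc]; case/negP: H; apply/existsP.
have us : uniq s by case/andP: sc.
have sz : size s < #|T|.+1 by rewrite ltnS -(card_uniqP us) max_card.
by exists (Ordinal sz); apply/existsP; exists (in_tuple s); rewrite s3.
Qed.

(** A cycle surviving the removal of an edge of the cycle would have the same edge set, and so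
    contain the removed edge. *)
Lemma break_cycle E : at_most_one_cycle E ->
  acyclic E \/ exists x y, [set x; y] \in E /\ acyclic (E :\ [set x; y]).
Proof.
move=> H; have [|[s cs]] := cycle_or_acyclic E; [by left | right].
have [s3 /andP[sc us]] := cs.
have [x xs] : exists x, x \in s by case: s s3 {cs sc us} => // x s' _; exists x; rewrite inE eqxx.
have exy : [set x; next s x] \in E by apply: (next_cycle sc).
exists x, (next s x); split => // s2 cs2.
have cs2E := is_cycle_sub (subD1set E _) cs2.
have : [set x; next s x] \in cycle_edges s by apply/imsetP; exists x.
rewrite (H _ _ cs cs2E) => /imsetP [z zs2 Ez].
have [_ /andP[sc2 _]] := cs2.
by have := next_cycle sc2 zs2; rewrite /adj -Ez !inE eqxx.
Qed.
End Forests.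

(** * The algorithm *)

Definition entry (S : Type) (a0 : S) (m : seq (seq S)) i j := nth a0 (nth [::] m i) j.

Definition mx_of (S : Type) n (f : nat -> nat -> S) := table f (iota 0 n).

Definition nsum n (f : nat -> nat) := sumn [seq f i | i <- iota 0 n].

Lemma entry_mx_of (S : Type) (a0 : S) n f i j : i < n -> j < n -> entry a0 (mx_of n f) i j = f i j.
Proof.
move=> Hi Hj; rewrite /entry (nth_map 0) ?size_iota // (nth_map 0) ?size_iota //.
by rewrite !nth_iota.
Qed.

Lemma nsumE n f : nsum n f = \sum_(i < n) f i.
Proof. by rewrite /nsum sumnE big_map -{1}(subn0 n) big_mkord. Qed.

Lemma ptime_mx_of {X S} {EX : encodable X} {ES : encodable S} (n : X -> nat) (f : X -> nat -> nat -> S) :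
  ptime (fun p : X * nat * nat => f p.1.1 p.1.2 p.2) -> ptime n ->
  ptime (fun x => mx_of (n x) (f x)).
Proof.
move=> Hf Hn; apply: (ptime_map (f := fun x i => [seq f x i j | j <- iota 0 (n x)])).
  apply: (ptime_map (f := fun (p : X * nat) j => f p.1 p.2 j)) => //.
  by apply: ptime_iota; pt.
exact: ptime_iota.
Qed.

Lemma ptime_entry {X S} {EX : encodable X} {ES : encodable S} (a0 : S)
    (m : X -> seq (seq S)) (i j : X -> nat) :
  enc a0 = Leaf -> ptime m -> ptime i -> ptime j -> ptime (fun x => entry a0 (m x) (i x) (j x)).
Proof. by move=> E Hm Hi Hj; apply: ptime_nth => //; apply: ptime_nth. Qed.

Lemma ptime_nsum {X} {EX : encodable X} (n : X -> nat) (f : X -> nat -> nat) :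
  ptime (fun p : X * nat => f p.1 p.2) -> ptime n -> ptime (fun x => nsum (n x) (f x)).
Proof. by move=> Hf Hn; apply: ptime_sumn; apply: ptime_map => //; apply: ptime_iota. Qed.

Lemma dsize_mx_of {S} {ES : encodable S} n (f : nat -> nat -> S) M :
  (forall i j, i < n -> j < n -> dsize (enc (f i j)) <= M) ->
  dsize (enc (mx_of n f)) <= n * (n * M.+1 + 1).+1 + 1.
Proof.
move=> H; have idx (R : Type) (g : nat -> R) s1 y s2 :
    [seq g i | i <- iota 0 n] = s1 ++ y :: s2 -> exists2 i, i < n & y = g i.
  move=> E; have lt : size s1 < n.
    by rewrite -(size_iota 0 n) -(size_map g) E size_cat /= -addSnnS leq_addr.
  exists (size s1) => //.
  have := nth_cat y s1 (y :: s2) (size s1); rewrite -E ltnn subnn (nth_map 0) ?size_iota //.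
  by rewrite nth_iota.
apply: leq_trans (@dsize_seq_le _ _ _ (n * M.+1 + 1) _) _; last by rewrite size_map size_iota.
move=> s1 y s2 E; have [i Hi ->] := idx _ _ _ _ _ E.
apply: leq_trans (@dsize_seq_le _ _ _ M _) _; last by rewrite size_map size_iota.
by move=> t1 z t2 E'; have [j Hj ->] := idx _ _ _ _ _ E'; apply: H.
Qed.

Ltac ptm_step := match goal with
  | |- ptime (fun x => entry ?a0 (@?m x) (@?i x) (@?j x)) =>
      apply: (ptime_entry (a0 := a0) (m := m) (i := i) (j := j)); first by []
  | |- ptime (fun x => nth ?a0 (@?l x) (@?i x)) =>
      apply: (ptime_nth (y0 := a0) (l := l) (i := i)); first by []
  | |- ptime (fun x => mx_of (@?n x) (@?f x)) =>
      apply: (ptime_mx_of (n := n) (f := f)); cbv beta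
  | |- ptime (fun x => nsum (@?n x) (@?f x)) =>
      apply: (ptime_nsum (n := n) (f := f)); cbv beta
  | |- ptime (fun x => map (@?f x) (@?l x)) =>
      apply: (ptime_map (f := f) (l := l)); cbv beta
  | |- ptime (fun x => all (@?f x) (@?l x)) =>
      apply: (ptime_all (p := f) (l := l)); cbv beta
  | |- ptime (fun x => has (@?f x) (@?l x)) =>
      apply: (ptime_has (p := f) (l := l)); cbv beta
  | |- ptime (fun x => filter (@?f x) (@?l x)) =>
      apply: (ptime_filter (p := f) (l := l)); cbv beta
  | |- ptime (fun x => flatten (@?l x)) => apply: (ptime_flatten (l := l))
  | |- ptime (fun x => iota 0 (@?n x)) => apply: (ptime_iota (f := n))
  | |- ptime (fun x => size (@?l x)) => apply: (ptime_size (l := l))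
  | |- ptime (fun x => rev (@?l x)) => apply: (ptime_rev (l := l))
  | |- ptime (fun x => nat_of_bool (@?b x)) => apply: (ptime_nat_of_bool (b := b))
  | |- ptime (fun x => muln (@?f x) (@?g x)) => apply: (ptime_muln (f := f) (g := g))
  | |- ptime (fun x => minn (@?f x) (@?g x)) => apply: (ptime_minn (f := f) (g := g))
  | |- ptime (fun x => expn (@?f x) ?k) => apply: (ptime_expn k (f := f))
  | |- ptime (fun x => leq (@?f x) (@?g x)) => apply: (ptime_leq (f := f) (g := g))
  | |- ptime (fun x => eq_op (@?f x) (@?g x)) => apply: (ptime_eqn (f := f) (g := g))
  | _ => ptime_step
  end.
Ltac ptm := repeat ptm_step.

Notation bmatrix := (seq (seq bool)).
Notation nmatrix := (seq (seq nat)).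

Definition fw_ctx : Type := nat * seq nat * bmatrix * nat * bmatrix * bmatrix.

Section RunFW.
Implicit Types (c : fw_ctx) (X : nmatrix).

Definition ctx_size c := c.1.1.1.1.1.
Definition ctx_deg c := c.1.1.1.1.2.
Definition ctx_mask c := c.1.1.1.2.
Definition ctx_tau c := c.1.1.2.
Definition ctx_lo c := c.1.2.
Definition ctx_hi c := c.2.

Definition mask_total c X := nsum (ctx_size c) (fun a => nsum (ctx_size c) (fun b =>
  nat_of_bool (entry false (ctx_mask c) a b) * entry 0 X a b)).

Definition run_step c X k : nmatrix := mx_of (ctx_size c) (fun i j =>
  entry 0 X i j + nat_of_bool (entry false (ctx_lo c) i j || entry false (ctx_hi c) i j &&
    (nsum (ctx_size c) (fun l => entry 0 X i l) + nsum (ctx_size c) (fun l => entry 0 X j l) +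
     (nat_of_bool (entry false (ctx_mask c) i j) + nat_of_bool (entry false (ctx_mask c) j i)) * mask_total c X <
     k * (nth 0 (ctx_deg c) i + nth 0 (ctx_deg c) j +
       (nat_of_bool (entry false (ctx_mask c) i j) + nat_of_bool (entry false (ctx_mask c) j i)) * ctx_tau c)))).

Definition run c k : nmatrix :=
  foldl (run_step c) (mx_of (ctx_size c) (fun _ _ => 0)) (iota 0 k).

(* With these many steps the averages are so close to the targets that they can
   be rounded. *)
Definition fw_acc n := (2 * (n ^ 3 + n + 1)).+1.
Definition fw_steps n := fw_acc n ^ 2 * (n ^ 3 + n ^ 4).+1.

Definition near_targets (p : fw_ctx * nmatrix) :=
  let n := ctx_size p.1 in
  all (fun i => near (fw_acc n) (fw_steps n) (nsum n (fun j => entry 0 p.2 i j)) (nth 0 (ctx_deg p.1) i))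
    (iota 0 n) && near (fw_acc n) (fw_steps n) (mask_total p.1 p.2) (ctx_tau p.1).

Definition run_test c := near_targets (c, run c (fw_steps (ctx_size c))).

Lemma ptime_mask_total {Y} {EY : encodable Y} (c : Y -> fw_ctx) (X : Y -> nmatrix) :
  ptime c -> ptime X -> ptime (fun y => mask_total (c y) (X y)).
Proof. by move=> Hc HX; rewrite /mask_total /ctx_size /ctx_mask; ptm. Qed.

Lemma ptime_fw_steps : ptime fw_steps.
Proof. by rewrite /fw_steps /fw_acc; ptm. Qed.

Lemma ptime_run_step : ptime (fun p : fw_ctx * nmatrix * nat => run_step p.1.1 p.1.2 p.2).
Proof.
rewrite /run_step /ctx_size /ctx_deg /ctx_mask /ctx_tau /ctx_lo /ctx_hi.
ptm; apply: ptime_mask_total; ptm.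
Qed.

Lemma run_succ c k : run c k.+1 = run_step c (run c k) k.
Proof. by rewrite /run -addn1 iotaD foldl_cat. Qed.

(** A step raises an entry by at most one, so the unary entries stay polynomially small throughout
    the run. *)
Lemma run_le c k : exists2 f, run c k = mx_of (ctx_size c) f & forall i j, i < ctx_size c -> j < ctx_size c -> f i j <= k.
Proof.
elim: k => [|k [f Ef Hf]]; first by exists (fun _ _ => 0).
rewrite run_succ Ef; eexists; first reflexivity.
move=> i j Hi Hj /=; rewrite entry_mx_of //; apply: (@leq_trans (k + 1)); last by rewrite addn1.
by apply: leq_add; [exact: Hf | exact: leq_b1].
Qed.

Lemma ptime_run : ptime (fun c => run c (fw_steps (ctx_size c))).
Proof.
have Hn : ptime ctx_size by rewrite /ctx_size; pt.
have Hk : ptime (fun c => fw_steps (ctx_size c)) by apply: (ptime_comp ptime_fw_steps).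
have Hb : pbounded (fun c => let n := ctx_size c in let M := (fw_steps n + fw_steps n).+1 in
    n * (n * M.+1 + 1).+1 + 1).
  have Hv := pbounded_value Hn; have Hvk := pbounded_value Hk.
  by do ?[apply: pbounded_add | apply: pbounded_mul | apply: pbounded_S | exact: pbounded_cst | done].
apply: (ptime_foldl (f := run_step) _ _ _ Hb); first exact: ptime_run_step.
- by ptm.
- exact: ptime_iota.
- move=> c l1 l2 El.
  have E1 : l1 = iota 0 (size l1).
    have T : take (size l1) (iota 0 (fw_steps (ctx_size c))) = l1 by rewrite El take_size_cat.
    have le : size l1 <= fw_steps (ctx_size c).
      by rewrite -(size_iota 0 (fw_steps _)) El size_cat leq_addr.
    by rewrite -{1}T take_iota (minn_idPl le).
  rewrite E1 -/(run c _); have [f -> Hf] := run_le c (size l1).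
  apply: dsize_mx_of => i j Hi Hj; rewrite dsize_nat.
  have : size l1 <= fw_steps (ctx_size c) by rewrite -(size_iota 0 (fw_steps _)) El size_cat leq_addr.
  by have := Hf i j Hi Hj; lia.
Qed.

Lemma ptime_run_test : ptime run_test.
Proof.
have Hn : ptime ctx_size by rewrite /ctx_size; pt.
have Hk := ptime_fw_steps.
have Ha : ptime fw_acc by rewrite /fw_acc; ptm.
apply: (ptime_comp (g := near_targets)); last by apply: ptime_pair ptime_run; pt.
rewrite /near_targets /near /ctx_deg /ctx_tau.
ptm; apply: ptime_mask_total; ptm.
Qed.
End RunFW.

(** * Deciding the pairs one by one *)

Definition fw_base : Type := nat * seq nat * bmatrix * nat.
Definition bounds : Type := bmatrix * bmatrix.

Definition mark n (m : bmatrix) i j v : bmatrix := mx_of n (fun a b =>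
  if (a == i) && (b == j) || (a == j) && (b == i) then v else entry false m a b).

(** A single test suffices: if forcing the pair in is infeasible while the current state is
    feasible, leaving it out is feasible. *)
Definition branch (c0 : fw_base) i (st : bounds) j : bounds :=
  if entry false st.2 i j && run_test (c0, mark c0.1.1.1 st.1 i j true, st.2)
  then (mark c0.1.1.1 st.1 i j true, st.2) else (st.1, mark c0.1.1.1 st.2 i j false).

Definition branch_row (c0 : fw_base) (st : bounds) i : bounds :=
  foldl (branch c0 i) st (iota 0 c0.1.1.1).

Definition solve (p : fw_base * bmatrix) : bounds :=
  foldl (branch_row p.1) (mx_of p.1.1.1.1 (fun _ _ => false), p.2) (iota 0 p.1.1.1.1).

(** The bound of [dsize_mx_of] for booleans, whose encodings have size at most 3. *)
Definition bmx_bound n := n * (n * 4 + 1).+1 + 1.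

Lemma dsize_mark n m i j v : dsize (enc (mark n m i j v)) <= bmx_bound n.
Proof. by apply: dsize_mx_of => a b _ _; case: (if _ then _ else _). Qed.

(** The initial upper matrix is an arbitrary input, whose size [n] does not control; all later
    matrices are produced by [mark]. *)
Definition marked n (m m' : bmatrix) := m' = m \/ dsize (enc m') <= bmx_bound n.

Lemma branch_marked c0 i j (st st' : bounds) :
  marked c0.1.1.1 st.1 st'.1 -> marked c0.1.1.1 st.2 st'.2 ->
  marked c0.1.1.1 st.1 (branch c0 i st' j).1 /\ marked c0.1.1.1 st.2 (branch c0 i st' j).2.
Proof.
by move=> H1 H2; rewrite /branch; case: ifP => _ /=; split => //; right; apply: dsize_mark.
Qed.

Lemma branch_fold_marked c0 i s (st st' : bounds) :
  marked c0.1.1.1 st.1 st'.1 -> marked c0.1.1.1 st.2 st'.2 ->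
  marked c0.1.1.1 st.1 (foldl (branch c0 i) st' s).1 /\
  marked c0.1.1.1 st.2 (foldl (branch c0 i) st' s).2.
Proof.
elim: s st' => // j s IH st' H1 H2 /=.
by have [H3 H4] := branch_marked i j H1 H2; apply: IH.
Qed.

Lemma marked_dsize n m m' : marked n m m' -> dsize (enc m') <= dsize (enc m) + bmx_bound n.
Proof. by case=> [->|/leq_trans]; [rewrite leq_addr | apply; rewrite leq_addl]. Qed.

Lemma ptime_mark {X} {EX : encodable X} (n : X -> nat) (m : X -> bmatrix) (i j : X -> nat) (v : X -> bool) :
  ptime n -> ptime m -> ptime i -> ptime j -> ptime v ->
  ptime (fun x => mark (n x) (m x) (i x) (j x) (v x)).
Proof. by move=> *; rewrite /mark; ptm. Qed.

Lemma ptime_branch : ptime (fun p : fw_base * nat * bounds * nat => branch p.1.1.1 p.1.1.2 p.1.2 p.2).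
Proof.
rewrite /branch; ptm; try by apply: ptime_mark; ptm.
by apply: (ptime_comp ptime_run_test); ptm; apply: ptime_mark; ptm.
Qed.

Lemma pbounded_bmx {X} {EX : encodable X} (n : X -> nat) : ptime n -> pbounded (fun x => bmx_bound (n x)).
Proof.
move=> /pbounded_value Hn; rewrite /bmx_bound.
by do ?[apply: pbounded_add | apply: pbounded_mul | apply: pbounded_S | exact: pbounded_cst | done].
Qed.

Lemma pbounded_state {X} {EX : encodable X} (st : X -> bounds) (n : X -> nat) : ptime st -> ptime n ->
  pbounded (fun x => (dsize (enc (st x).1) + bmx_bound (n x) + (dsize (enc (st x).2) + bmx_bound (n x))).+1).
Proof.
move=> Hst Hn; apply: pbounded_S.
have Hb := pbounded_bmx Hn.
by apply: pbounded_add; apply: pbounded_add => //; apply: pbounded_ptime; pt.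
Qed.

Lemma ptime_branch_row : ptime (fun p : fw_base * bounds * nat => branch_row p.1.1 p.1.2 p.2).
Proof.
have Hst : ptime (fun p : fw_base * bounds * nat => p.1.2) by pt.
have Hn : ptime (fun p : fw_base * bounds * nat => p.1.1.1.1.1) by pt.
apply: (ptime_foldl (f := fun (p : fw_base * bounds * nat) => branch p.1.1 p.2) _ Hst _ (pbounded_state Hst Hn)).
- apply: (ptime_comp (g := fun p : fw_base * nat * bounds * nat => branch p.1.1.1 p.1.1.2 p.1.2 p.2)
    (f := fun p : (fw_base * bounds * nat) * bounds * nat => (p.1.1.1.1, p.1.1.2, p.1.2, p.2))).
    exact: ptime_branch.
  by pt.
- by ptm.
- move=> p l1 l2 _.
  have [H1 H2] := @branch_fold_marked p.1.1 p.2 l1 p.1.2 p.1.2 (or_introl erefl) (or_introl erefl).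
  rewrite dsize_pair; have := marked_dsize H1; have := marked_dsize H2; lia.
Qed.

Lemma ptime_solve : ptime solve.
Proof.
have Hst : ptime (fun p : fw_base * bmatrix => (mx_of p.1.1.1.1 (fun _ _ => false), p.2)) by ptm.
have Hn : ptime (fun p : fw_base * bmatrix => p.1.1.1.1) by pt.
apply: (ptime_foldl (f := fun (p : fw_base * bmatrix) => branch_row p.1) _ Hst _ (pbounded_state Hst Hn)).
- apply: (ptime_comp (g := fun p : fw_base * bounds * nat => branch_row p.1.1 p.1.2 p.2)
    (f := fun p : (fw_base * bmatrix) * bounds * nat => (p.1.1.1, p.1.2, p.2))).
    exact: ptime_branch_row.
  by pt.
- by ptm.
- move=> p l1 l2 _; set st0 : bounds := (_, p.2).
  suff [H1 H2] : marked p.1.1.1.1 st0.1 (foldl (branch_row p.1) st0 l1).1 /\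
                 marked p.1.1.1.1 st0.2 (foldl (branch_row p.1) st0 l1).2.
    by rewrite dsize_pair; have := marked_dsize H1; have := marked_dsize H2; lia.
  have H st : marked p.1.1.1.1 st0.1 st.1 -> marked p.1.1.1.1 st0.2 st.2 ->
      marked p.1.1.1.1 st0.1 (foldl (branch_row p.1) st l1).1 /\
      marked p.1.1.1.1 st0.2 (foldl (branch_row p.1) st l1).2.
    elim: l1 st => // i l1 IH st H1 H2 /=.
    by have [H3 H4] := branch_fold_marked i (iota 0 p.1.1.1.1) H1 H2; apply: IH.
  by apply: H; left.
Qed.

(** Only degrees are checked: by [solve_sound] every result of [solve] is symmetric and inside the
    host graph, even for a wrong guess. *)
Definition valid (n : nat) (dl : seq nat) (E : bmatrix) :=
  all (fun i => nsum n (fun j => nat_of_bool (entry false E i j)) == nth 0 dl i) (iota 0 n).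

(* Binary counter; the boolean component of the state is the carry. *)
Definition binc_step (st : bitseq * bool) (b : bool) : bitseq * bool := ((b (+) st.2) :: st.1, b && st.2).

Definition binc (s : bitseq) : bitseq :=
  let st := foldl binc_step ([::], true) s in rev (if st.2 then true :: st.1 else st.1).

(** Counting up in [k] increments is affordable because [k] is held in unary. *)
Definition binary k : bitseq := iter k binc [::].

Fixpoint add_carry (s : bitseq) c : bitseq :=
  if s is b :: s' then (b (+) c) :: add_carry s' (b && c) else if c then [:: true] else [::].

Lemma bincE s : binc s = add_carry s true.
Proof.
have H acc c : let st := foldl binc_step (acc, c) s in
    rev (if st.2 then true :: st.1 else st.1) = catrev acc (add_carry s c).
  elim: s acc c => [|b s IH] acc c /=; last by rewrite IH.
  by case: c; rewrite /rev //= -[in RHS]catrev_catr.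
by rewrite /binc H.
Qed.

Lemma add_carry_false s : add_carry s false = s.
Proof. by elim: s => //= b s IH; rewrite addbF andbF IH. Qed.

Lemma pos_bits_succ p : pos_bits (PosDef.Pos.succ p) = add_carry (pos_bits p) true.
Proof. by elim: p => //= p IH; rewrite ?IH // add_carry_false. Qed.

Lemma binaryE k : binary k = nat_bits k.
Proof.
elim: k => // k IH; rewrite /binary iterS -/(binary k) IH bincE /nat_bits.
have -> : bin_of_nat k.+1 =
    BinNums.Npos (if bin_of_nat k is BinNums.Npos p then PosDef.Pos.succ p else BinNums.xH).
  apply: (can_inj nat_of_binK); rewrite bin_of_natK /= -{1}(bin_of_natK k).
  by case: (bin_of_nat k) => //= p; rewrite nat_of_succ_pos.
by case: (bin_of_nat k) => //= p; rewrite pos_bits_succ.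
Qed.

Lemma size_add_carry s c : size (add_carry s c) <= (size s).+1.
Proof. by elim: s c => [|b s IH] [] //=; rewrite ltnS. Qed.

Lemma dsize_bits (s : bitseq) : dsize (enc s) <= size s * 4 + 1.
Proof. by apply: dsize_seq_le => s1 y s2 _; case: y. Qed.

Lemma ptime_binary : ptime binary.
Proof.
apply: (@ptime_iter _ _ _ _ (fun _ => binc) (fun _ => [::]) id (fun k => k * 4 + 1)).
- have Hs : ptime (fun q : nat * bitseq => q.2) by pt.
  have Hfold : ptime (fun q : nat * bitseq => foldl binc_step ([::], true) q.2).
    apply: (ptime_foldl (f := fun _ => binc_step) (b := fun q => (size q.2 * 4 + 1 + 3).+1)) => //.
    + by rewrite /binc_step; pt.
    + by pt.
    + have := pbounded_size Hs => Hb.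
      by do ?[apply: pbounded_add | apply: pbounded_mul | apply: pbounded_S | exact: pbounded_cst | done].
    + move=> q l1 l2 ->; rewrite dsize_pair ltnS leq_add //; last by case: (foldl _ _ _).2.
      apply: leq_trans (dsize_bits _) _; rewrite leq_add2r leq_mul2r /=.
      suff -> : size (foldl binc_step ([::], true) l1).1 = size l1 by rewrite size_cat leq_addr.
      have H acc c : size (foldl binc_step (acc, c) l1).1 = size acc + size l1.
        by elim: l1 acc c => [|b l1 IH] acc c /=; rewrite ?addn0 // IH /= addSnnS.
      by rewrite H.
  rewrite /binc; apply: ptime_rev; apply: ptime_if; first exact: ptime_snd Hfold.
    by apply: ptime_cons; [pt | exact: ptime_fst Hfold].
  exact: ptime_fst Hfold.
- by pt.
- by pt.
- apply: pbounded_add; last exact: pbounded_cst.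
  by apply: pbounded_mul; [apply: pbounded_value; pt | exact: pbounded_cst].
- move=> k i le; apply: leq_trans (dsize_bits _) _; rewrite leq_add2r leq_mul2r /=.
  apply: leq_trans le; elim: i => // i IH; rewrite iterS bincE.
  exact: leq_trans (size_add_carry _ _) _.
Qed.

(** A degree given in binary may be exponential in the input size, too large for unary. Degrees in a
    simple graph are below [n], so truncation at [n] keeps unrealizable degrees unrealizable. The
    bits are read by Horner's rule from the top, truncating at each step. *)
Definition capped n (bs : bitseq) := foldl (fun v (b : bool) => minn n (nat_of_bool b + (v + v))) 0 (rev bs).

Lemma ptime_capped {X} {EX : encodable X} (n : X -> nat) (bs : X -> bitseq) :
  ptime n -> ptime bs -> ptime (fun x => capped (n x) (bs x)).
Proof.
move=> Hn Hbs.
apply: (ptime_foldl (f := fun x v (b : bool) => minn (n x) (nat_of_bool b + (v + v))) (b := fun x => (n x + n x).+1)).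
- by ptm.
- by pt.
- by ptm.
- by apply: pbounded_S; apply: pbounded_add; exact: pbounded_value.
- move=> x l1 l2 _; rewrite dsize_nat ltnS -addnn.
  suff : foldl (fun v (b : bool) => minn (n x) (nat_of_bool b + (v + v))) 0 l1 <= n x by lia.
  by case/lastP: l1 => // l1 b; rewrite foldl_rcons geq_minl.
Qed.

(** The three components of the encoded input, with degrees still as bits; [enc_raw] identifies the
    two encodings. *)
Definition raw_instance : Type := seq bitseq * (bmatrix * bmatrix).

Section Main.
Implicit Type x : raw_instance.

Definition raw_degs x : seq nat := [seq capped (size x.1) bs | bs <- x.1].

Definition raw_host x : bmatrix := mx_of (size x.1) (fun i j =>
  has (fun a => has (fun b => entry false x.2.1 a i && entry false x.2.1 b j && entry false x.2.2 a b)
    (iota 0 (size x.2.1))) (iota 0 (size x.2.1))).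

Definition raw_mask x a b : bmatrix :=
  mx_of (size x.1) (fun i j => entry false x.2.1 a i && entry false x.2.1 b j).

Definition raw_base x a b t : fw_base := (size x.1, raw_degs x, raw_mask x a b, t).

(* The junk index [size x.2.1] stands for an empty class, and makes the mask empty. *)
Definition candidates x : seq bmatrix :=
  flatten [seq flatten [seq [seq (solve (raw_base x a b t, raw_host x)).1 | t <- iota 0 (size x.1 * size x.1).+1]
    | b <- iota 0 (size x.2.1).+1] | a <- iota 0 (size x.2.1).+1].

Definition raw_weights x (E : bmatrix) : seq (seq bitseq) := mx_of (size x.2.1) (fun a b =>
  binary (nsum (size x.1) (fun i => nsum (size x.1) (fun j =>
    nat_of_bool (entry false x.2.1 a i && entry false x.2.1 b j && entry false E i j))))).

Definition main x : seq (seq (seq bitseq) * bmatrix) :=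
  [seq (raw_weights x E, E) | E <- [seq E <- candidates x | valid (size x.1) (raw_degs x) E]].

Lemma ptime_raw_degs : ptime raw_degs.
Proof. by rewrite /raw_degs; ptm; apply: ptime_capped; ptm. Qed.

Lemma ptime_raw_host : ptime raw_host.
Proof. by rewrite /raw_host; ptm. Qed.

Lemma ptime_candidates : ptime candidates.
Proof.
have Hd := ptime_raw_degs; have Hh := ptime_raw_host.
rewrite /candidates /raw_base /raw_mask; ptm.
by apply: (ptime_comp ptime_solve); ptm.
Qed.

Lemma ptime_main : ptime main.
Proof.
have Hd := ptime_raw_degs; have Hc := ptime_candidates.
rewrite /main /valid /raw_weights; ptm.
by apply: (ptime_comp ptime_binary); ptm.
Qed.
End Main.

Lemma ptime_computes {X Y} {EX : encodable X} {EY : encodable Y} (f : X -> Y) : ptime f ->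
  exists (p : cmd) (q : {poly nat}), forall x, exists t,
    computes p (enc x) (enc (f x)) t /\ t <= (q.[dsize (enc x)])%R.
Proof.
move=> [c [T [k Hk] Hc] _]; exists (c 0), (('X + 1%:P) ^+ k)%R => x.
have [s' [t [Xt E _ le]]] := Hc x 0 (init_store (enc x)) erefl.
exists t; split; first by exists s'.
have -> : (('X + 1%:P : {poly nat}) ^+ k).[dsize (enc x)]%R = (dsize (enc x)).+1 ^ k.
  by rewrite horner_exp hornerD hornerX hornerC -addn1 -natrXE.
exact: leq_trans le (Hk x).
Qed.

(** * Correctness of the algorithm *)

Definition rel_of n (m : bmatrix) : rel 'I_n := fun i j => entry false m i j.
Arguments rel_of : clear implicits.

Lemma rel_of_mx n f i j : rel_of n (mx_of n f) i j = f i j.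
Proof. by rewrite /rel_of entry_mx_of. Qed.

Lemma all_iota n (p : pred nat) : all p (iota 0 n) = [forall i : 'I_n, p i].
Proof.
apply/allP/forallP => H i; first by apply: H; rewrite mem_iota /= add0n ltn_ord.
by rewrite mem_iota add0n => /= lt; apply: (H (Ordinal lt)).
Qed.

Section RunCorrect.
Variable c : fw_ctx.
Let n := ctx_size c.
Let lo := rel_of n (ctx_lo c).
Let hi := rel_of n (ctx_hi c).
Let m := rel_of n (ctx_mask c).
Let d (i : 'I_n) := nth 0 (ctx_deg c) i.

Lemma mask_totalE (X : nmatrix) : mask_total c X = \sum_(a < n) \sum_(b < n) m a b * entry 0 X a b.
Proof. by rewrite /mask_total nsumE; apply: eq_bigr => a _; rewrite nsumE. Qed.

Lemma run_fw k (i j : 'I_n) : entry 0 (run c k) i j = fw lo hi m d (ctx_tau c) k i j.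
Proof.
elim: k i j => [|k IH] i j; first by rewrite /run /= entry_mx_of.
rewrite run_succ /run_step entry_mx_of // IH /=; congr (_ + nat_of_bool _).
rewrite /fw_select /fw_gain /fw_goal !nsumE mask_totalE.
congr (_ || _ && (_ + _ + _ * _ < _)); try by apply: eq_bigr => l _; rewrite IH.
by apply: eq_bigr => a _; apply: eq_bigr => b _; rewrite IH.
Qed.

Lemma run_testE : run_test c = fw_test lo hi m d (ctx_tau c) (fw_acc n) (fw_steps n).
Proof.
rewrite /run_test /near_targets /fw_test /= all_iota mask_totalE; congr (_ && _).
  by apply: eq_forallb => i; rewrite nsumE; congr near; apply: eq_bigr => j _; rewrite run_fw.
by congr near; apply: eq_bigr => a _; apply: eq_bigr => b _; rewrite run_fw.
Qed.
End RunCorrect.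

Section SolveCorrect.
Variables (c0 : fw_base) (h : bmatrix).
Let n := c0.1.1.1.
Let host := rel_of n h.
Let m := rel_of n c0.1.2.
Let d (i : 'I_n) := nth 0 c0.1.1.2 i.
Let tau := c0.2.

Lemma mark_rel (x : bmatrix) i j v (a b : 'I_n) : rel_of n (mark n x i j v) a b =
  if (a == i :> nat) && (b == j :> nat) || (a == j :> nat) && (b == i :> nat) then v else rel_of n x a b.
Proof. by rewrite /mark rel_of_mx. Qed.

Lemma mark_sym (x : bmatrix) i j v : symmetric (rel_of n x) -> symmetric (rel_of n (mark n x i j v)).
Proof. by move=> H a b; rewrite !mark_rel H orbC [(b == i :> nat) && _]andbC [(b == j :> nat) && _]andbC. Qed.

Section Sound.
Hypothesis host_sym : symmetric host.

(** What holds without feasibility, and hence for wrong guesses too. The last clause fixes the shape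
    of the matrix, which the encoding of the output depends on. *)
Definition sound_state (st : bounds) := [/\ symmetric (rel_of n st.1), symmetric (rel_of n st.2),
  forall a b, rel_of n st.1 a b -> host a b, forall a b, rel_of n st.2 a b -> host a b
  & exists f, st.1 = mx_of n f].

Lemma branch_sound i st j : i < n -> j < n -> sound_state st -> sound_state (branch c0 i st j).
Proof.
move=> Hi Hj [s1 s2 h1 h2 [f Ef]]; rewrite /branch; case: ifP => [/andP[hij _]|_]; split => //=; try exact: mark_sym.
- move=> a b; rewrite mark_rel; case: ifP => [|_]; last exact: h1.
  have hij' : rel_of n st.2 (Ordinal Hi) (Ordinal Hj) by [].
  by case/orP => /andP[/eqP Ea /eqP Eb] _; apply: h2; [|rewrite s2]; rewrite /rel_of Ea Eb.
- by eexists.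
- by move=> a b; rewrite mark_rel; case: ifP => // _; apply: h2.
- by exists f.
Qed.

Lemma foldl_inv (S : Type) (P : S -> Prop) (f : S -> nat -> S) (s : seq nat) st :
  (forall st i, i \in s -> P st -> P (f st i)) -> P st -> P (foldl f st s).
Proof.
elim: s st => //= i s IH st H Hst; apply: IH; last by apply: H; rewrite ?inE ?eqxx.
by move=> st' k ks; apply: H; rewrite inE ks orbT.
Qed.

Lemma solve_sound : sound_state (solve (c0, h)).
Proof.
apply: foldl_inv; last first.
  split => //=; last by eexists.
  - by move=> a b; rewrite !rel_of_mx.
  - by move=> a b; rewrite rel_of_mx.
move=> st i; rewrite mem_iota /= add0n => Hi Hst; apply: foldl_inv => // st' j.
by rewrite mem_iota /= add0n => Hj; apply: branch_sound.
Qed.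
End Sound.

Section Complete.
Variables (cl : 'I_n -> nat) (bone mask : rel nat) (sigma : nat -> int) (c : int).
Hypothesis hostE : forall i j, host i j = host_rel cl bone i j.
Hypothesis maskE : forall i j, m i j = mask_rel cl mask i j.
Hypothesis bone_sym : symmetric bone.
Hypothesis bone_irr : irreflexive bone.
Hypothesis mask_one : forall a1 b1 a2 b2, mask a1 b1 -> mask a2 b2 -> a1 = a2 /\ b1 = b2.
Hypothesis sigma1 : forall a, (`|sigma a| = 1)%R.
Hypothesis c_le : (`|c| <= 2)%R.
Hypothesis sigma_bone : forall a1 a2, bone a1 a2 ->
  (sigma a1 + sigma a2 = c * (mask a1 a2 || mask a2 a1)%:R)%R.

Definition feasible_between lo hi := exists g, feasible (rel_of n lo) (rel_of n hi) m d tau g.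

(* Before [(i, j)] is branched on, the undecided pairs avoid the first [i]
   vertices and the first [j] partners of [i], and are otherwise all the pairs of
   the host graph. *)
Definition progress i j (st : bounds) := [/\ symmetric (rel_of n st.1) /\ symmetric (rel_of n st.2),
   (forall a b, rel_of n st.1 a b -> rel_of n st.2 a b) /\ (forall a b, rel_of n st.2 a b -> host a b),
   feasible_between st.1 st.2,
   forall a b, free_rel (rel_of n st.1) (rel_of n st.2) a b -> i <= a /\ (a = i :> nat -> j <= b)
 & forall a b : 'I_n, i < a -> i < b -> host a b -> free_rel (rel_of n st.1) (rel_of n st.2) a b].

Lemma fw_steps_gt0 k : 0 < fw_steps k.
Proof. by rewrite /fw_steps muln_gt0 expn_gt0. Qed.

Lemma feasible_ext (T : finType) (lo hi m1 m2 : rel T) dd tt g :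
  (forall i j, m1 i j = m2 i j) -> feasible lo hi m1 dd tt g -> feasible lo hi m2 dd tt g.
Proof.
move=> E [H1 H2 H3 H4 H5]; split => //; rewrite -H5.
by apply: eq_bigr => i _; apply: eq_bigr => j _; rewrite E.
Qed.

(** The mask read from a matrix and the mask defined by classes agree only pointwise. *)
Lemma fw_ext (T : finType) (lo hi m1 m2 : rel T) dd tt k :
  (forall i j, m1 i j = m2 i j) -> fw lo hi m1 dd tt k =2 fw lo hi m2 dd tt k.
Proof.
move=> E; elim: k => //= k IH i j; rewrite IH; congr (_ + nat_of_bool _).
rewrite /fw_select /fw_gain /fw_goal !E; congr (_ || _ && (_ + _ + _ * _ < _)); try by apply: eq_bigr => l _.
by apply: eq_bigr => a _; apply: eq_bigr => b _; rewrite IH E.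
Qed.

Lemma fw_test_ext (T : finType) (lo hi m1 m2 : rel T) dd tt N k :
  (forall i j, m1 i j = m2 i j) -> fw_test lo hi m1 dd tt N k = fw_test lo hi m2 dd tt N k.
Proof.
move=> E; rewrite /fw_test; congr (_ && _).
  by apply: eq_forallb => i; congr near; apply: eq_bigr => j _; rewrite (fw_ext _ _ _ _ _ E).
by congr near; apply: eq_bigr => a _; apply: eq_bigr => b _; rewrite (fw_ext _ _ _ _ _ E) E.
Qed.

(** An excluded pair changes nothing. If the test passes, [fw_sound] gives a new feasible graph; if
    it fails, [fw_complete] shows that the old one does not use the pair, so it stays feasible. *)
Lemma branch_progress i j st : i < n -> j < n -> progress i j st -> progress i j.+1 (branch c0 i st j).
Proof.
move=> Hi Hj [[s1 s2] [lh hh] [g Hg] F1 F2].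
pose oi := Ordinal Hi; pose oj := Ordinal Hj.
have pairE (a b : 'I_n) : ((a == i :> nat) && (b == j :> nat) || (a == j :> nat) && (b == i :> nat)) =
    ((a == oi) && (b == oj) || (a == oj) && (b == oi)) by [].
have notpair (a b : 'I_n) : i < a -> i < b ->
    ((a == i :> nat) && (b == j :> nat) || (a == j :> nat) && (b == i :> nat)) = false.
  by move=> ia ib; rewrite !(gtn_eqF ia) (gtn_eqF ib) andbF.
have [gs glo ghi gd gm] := Hg.
rewrite /branch; set lo' := mark _ _ _ _ true; set hi' := mark _ _ _ _ false.
case Hij: (entry false st.2 i j); last first.
  have hE a b : rel_of n hi' a b = rel_of n st.2 a b.
    rewrite /hi' mark_rel; case: ifP => // /orP[]/andP[/eqP Ea /eqP Eb].
      by rewrite /rel_of Ea Eb Hij.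
    by rewrite s2 /rel_of Ea Eb Hij.
  have fE a b : free_rel (rel_of n st.1) (rel_of n hi') a b = free_rel (rel_of n st.1) (rel_of n st.2) a b.
    by rewrite /free_rel hE.
  split => /=.
  - by split => // a b; rewrite !hE.
  - by split => a b; rewrite hE; [apply: lh | apply: hh].
  - by exists g; split => // a b; rewrite hE; apply: ghi.
  - move=> a b; rewrite fE => H; have [H1 H2] := F1 a b H; split => // ai.
    rewrite ltn_neqAle H2 // andbT; apply: contraTneq H => jb.
    by rewrite /free_rel /rel_of ai -jb Hij.
  - by move=> a b ia ib hab; rewrite fE; apply: F2.
have rij : rel_of n st.2 oi oj by [].
have lo'_sym : symmetric (rel_of n lo') by apply: mark_sym.
have lo'_hi a b : rel_of n lo' a b -> rel_of n st.2 a b.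
  rewrite mark_rel pairE; case: ifP => [|_]; last exact: lh.
  by case/orP => /andP[/eqP-> /eqP->] _; rewrite // s2.
have free' a b : free_rel (rel_of n lo') (rel_of n st.2) a b ->
    free_rel (rel_of n st.1) (rel_of n st.2) a b /\ ~~ ((a == oi) && (b == oj)).
  rewrite /free_rel mark_rel pairE; case: ifP => [|/negbT]; first by rewrite andbF.
  by rewrite negb_or => /andP[].
have free'_big (a b : 'I_n) : i < a -> i < b -> host a b -> free_rel (rel_of n lo') (rel_of n st.2) a b.
  by move=> ia ib hab; rewrite /free_rel mark_rel notpair //; apply: F2.
have testE : run_test (c0, lo', st.2) = fw_test (rel_of n lo') (rel_of n st.2) m d tau (fw_acc n) (fw_steps n).
  by rewrite run_testE.
rewrite andTb testE.
have gN : fw_test (rel_of n lo') (rel_of n st.2) m d tau (fw_acc n) (fw_steps n) = false ->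
    forall a b : 'I_n, (a == i :> nat) && (b == j :> nat) || (a == j :> nat) && (b == i :> nat) ->
    g a b = false.
  move=> Ht a b; rewrite pairE => P; apply: contraFF Ht => gab.
  have gij : g oi oj by case/orP: P gab => /andP[/eqP-> /eqP->] //; rewrite gs.
  apply: (fw_complete lo'_sym s2 (g := g)); last by rewrite card_ord.
  split => // a' b'; rewrite mark_rel pairE; case: ifP => [|_]; last exact: glo.
  by case/orP => /andP[/eqP-> /eqP->] _; rewrite // gs.
case: ifP => Ht; [|have {}gN := gN Ht]; split => //=.
- move: Ht; rewrite (fw_test_ext _ _ _ _ _ _ maskE) => Ht.
  have [||||g' Hg'] := fw_sound (sigma := sigma) (p := oi) bone_sym bone_irr mask_one sigma1 c_le sigma_bone
     lo'_sym s2 lo'_hi _ _ _ _ Ht.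
  + by move=> a b /hh; rewrite hostE.
  (* Open pairs avoid the vertices before [i], so a vertex other than [oi] with an open pair comes
     after [i], and among such vertices nothing has been decided. *)
  + move=> a b ai bi hab [k1 fa] [k2 fb].
    have big (u k : 'I_n) : u != oi -> free_rel (rel_of n lo') (rel_of n st.2) u k -> i < u.
      by move=> ui /free' [/F1 [le _] _]; rewrite ltn_neqAle le andbT eq_sym.
    by apply: free'_big; [apply: big fa | apply: big fb | rewrite hostE].
  + exact: fw_steps_gt0.
  + by rewrite card_ord.
  + by exists g'; apply: (feasible_ext (m1 := mask_rel cl mask)) Hg' => a b; rewrite maskE.
- move=> a b H; have [H1 H2] := free' _ _ H; have [H3 H4] := F1 a b H1; split => // ai.
  rewrite ltn_neqAle H4 // andbT; apply: contraNneq H2 => jb.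
  by apply/andP; split; apply/eqP/val_inj.
- by split => //; apply: mark_sym.
- split=> a b; last by rewrite mark_rel; case: ifP => // _; exact: hh.
  rewrite mark_rel; case: ifP => P; last exact: lh.
  by move/glo; rewrite (gN _ _ P).
- exists g; split => // a b; rewrite mark_rel; case: ifP => P gab; last exact: ghi.
  by rewrite (gN _ _ P) in gab.
- move=> a b; rewrite /free_rel mark_rel pairE; case: ifP => // P H.
  have [H1 H2] := F1 a b H; split => // ai.
  rewrite ltn_neqAle H2 // andbT; apply: contraFneq P => jb.
  by apply/orP; left; apply/andP; split; apply/eqP/val_inj.
- move=> a b ia ib hab; rewrite /free_rel mark_rel notpair //; exact: F2.
Qed.

Lemma solve_progress : feasible_between (mx_of n (fun _ _ => false)) h ->
  progress n 0 (solve (c0, h)).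
Proof.
move=> Hf.
have host_sym a b : host a b = host b a by rewrite !hostE /host_rel bone_sym.
have start : progress 0 0 (mx_of n (fun _ _ => false), h).
  split => //=; first by split => // a b; rewrite !rel_of_mx.
    by split => // a b; rewrite rel_of_mx.
  by move=> a b _ _ hab; rewrite /free_rel rel_of_mx andbT.
have row i st : i < n -> progress i 0 st -> progress i.+1 0 (branch_row c0 st i).
  move=> Hi H0.
  have H k : k <= n -> progress i k (foldl (branch c0 i) st (iota 0 k)).
    elim: k => // k IH le; rewrite -addn1 iotaD foldl_cat /= add0n addn1.
    by apply: branch_progress => //; apply: IH; exact: ltnW.
  have [[s1 s2] Hl Hg F1 F2] := H n (leqnn n).
  split => //; last by move=> a b ia ib; apply: F2; exact: ltnW.
  move=> a b /F1 [H1 H2]; split => //; rewrite ltn_neqAle H1 andbT.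
  by apply/eqP => Ea; have := H2 (esym Ea); rewrite leqNgt ltn_ord.
suff H k : k <= n -> progress k 0 (foldl (branch_row c0) (mx_of n (fun _ _ => false), h) (iota 0 k)).
  exact: H.
elim: k => // k IH le; rewrite -addn1 iotaD foldl_cat /= add0n addn1.
by apply: row => //; apply: IH; exact: ltnW.
Qed.

(** At the end no vertex is left for an open pair, so the lower bound, the upper bound and the
    feasible graph coincide. *)
Lemma solve_complete : feasible_between (mx_of n (fun _ _ => false)) h ->
  let g := rel_of n (solve (c0, h)).1 in
  (forall i, \sum_j g i j = d i) /\ \sum_i \sum_j (m i j && g i j) = tau.
Proof.
move=> /solve_progress [_ _ [g [gs glo ghi gd gm]] F1 _] /=.
have E a b : rel_of n (solve (c0, h)).1 a b = g a b.
  apply/idP/idP => [/glo //|gab]; apply: contraTT isT => nlo.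
  have [] := F1 a b; last by rewrite leqNgt ltn_ord.
  by rewrite /free_rel ghi.
split => [i|]; first by rewrite -gd; apply: eq_bigr => j _; rewrite E.
by rewrite -gm; apply: eq_bigr => i _; apply: eq_bigr => j _; rewrite E.
Qed.
End Complete.
End SolveCorrect.

(** * Realizations and their weights *)

Section Drawn.
Variables (V : finType) (Pi : {set {set V}}) (B : {set {set {set V}}}) (d : V -> nat).
Hypothesis part : partition Pi [set: V].
Hypothesis simpleB : simple_graph Pi B.
Implicit Types (E : {set {set V}}) (U W : {set V}).

Let blk := pblock Pi.

Lemma mem_blk v : v \in blk v.
Proof. by rewrite mem_pblock (cover_partition part) inE. Qed.

Lemma blk_in v : blk v \in Pi.
Proof. by rewrite pblock_mem // (cover_partition part) inE. Qed.

Lemma blkE U v : U \in Pi -> (blk v == U) = (v \in U).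
Proof.
move=> UP; apply/eqP/idP => [<-|vU]; first exact: mem_blk.
by apply: def_pblock => //; case/and3P: part.
Qed.

Definition bone_of (e : {set V}) : {set {set V}} := [set blk x | x in e].

Lemma bone_of2 u v : bone_of [set u; v] = [set blk u; blk v].
Proof. by rewrite /bone_of imsetU !imset_set1. Qed.

(** The part of consistency that does not mention weights; the weights are then forced to be
    [weight_of E]. *)
Definition drawn E := forall e, e \in E -> #|e| = 2 /\ bone_of e \in B.

Definition weight_of E : {ffun {set {set V}} -> nat} :=
  [ffun b => #|[set e in E | bone_of e == b]|].

Lemma bone2 b : b \in B -> exists U W, [/\ b = [set U; W], U != W, U \in Pi & W \in Pi].
Proof.
move=> bB; have [/eqP/cards2P [U [W [UW bE]]] bP] := simpleB bB.
by exists U, W; split => //; apply: (subsetP bP); rewrite bE !inE eqxx ?orbT.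
Qed.

Lemma edges_betweenE E U W : (forall e, e \in E -> #|e| = 2) -> U \in Pi -> W \in Pi ->
  edges_between E U W = [set e in E | bone_of e == [set U; W]].
Proof.
move=> E2 UP WP; apply/setP => e; rewrite !inE; case: (boolP (e \in E)) => //= eE.
apply/existsP/eqP => [[u /andP[uU /existsP [v /andP[vW /eqP->]]]]|].
  by rewrite bone_of2; move: uU vW; rewrite -!blkE // => /eqP-> /eqP->.
have /eqP/cards2P [u [v [_ ->]]] := E2 e eE; rewrite bone_of2.
case/set2_eq => -[uE vE].
  by exists u; rewrite -blkE // uE eqxx; apply/existsP; exists v; rewrite -blkE // vE !eqxx.
exists v; rewrite -blkE // vE eqxx; apply/existsP; exists u; rewrite -blkE // uE eqxx /=.
by rewrite setUC.
Qed.

Lemma consistent_drawn w E : consistent_realization Pi B d w E ->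
  [/\ drawn E, forall v, degree E v = d v & w = weight_of E].
Proof.
case=> wB [sE dE] [cE iE].
have E2 e : e \in E -> #|e| = 2 by move=> /sE[].
have dr : drawn E.
  move=> e eE; split; first exact: E2.
  have /eqP/cards2P [u [v [uv Ee]]] := E2 e eE; rewrite Ee bone_of2.
  have ne : blk u != blk v.
    apply: contraNneq (iE e (blk u) eE (blk_in u)) => same.
    by rewrite Ee; apply/subsetP => x; rewrite !inE => /orP[]/eqP->; [|rewrite same]; exact: mem_blk.
  apply: contraTT isT => /wB w0.
  have := cE _ _ (blk_in u) (blk_in v) ne; rewrite w0 => /eqP; rewrite cards_eq0 => /eqP H.
  have : e \in edges_between E (blk u) (blk v).
    by rewrite edges_betweenE ?blk_in // inE eE Ee bone_of2 eqxx.
  by rewrite H inE.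
split => //; apply/ffunP => b; rewrite ffunE.
have [bB|bB] := boolP (b \in B).
  have [U [W [-> UW UP WP]]] := bone2 bB.
  by rewrite -edges_betweenE // cE.
rewrite wB //; apply/esym/eqP; rewrite cards_eq0; apply/eqP/setP => e; rewrite !inE.
by apply: contraNF bB => /andP[/dr[_ eB] /eqP<-].
Qed.

Lemma drawn_consistent E : drawn E -> (forall v, degree E v = d v) ->
  consistent_realization Pi B d (weight_of E) E.
Proof.
move=> dr dE; have E2 e : e \in E -> #|e| = 2 by move=> /dr[].
split.
- move=> b bB; rewrite ffunE; apply/eqP; rewrite cards_eq0; apply/eqP/setP => e; rewrite !inE.
  by apply: contraNF bB => /andP[/dr[_ eB] /eqP<-].
- by split => // e eE; split; [apply: E2 | apply: subsetT].
- split; first by move=> U W UP WP UW; rewrite edges_betweenE // ffunE.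
  move=> e U eE UP; have [_ eB] := dr e eE; apply/negP => sub.
  have /eqP/cards2P [u [v [uv Ee]]] := E2 e eE.
  have [/eqP] := simpleB eB; rewrite Ee bone_of2.
  have : blk u == U by rewrite blkE // (subsetP sub) // Ee !inE eqxx.
  have : blk v == U by rewrite blkE // (subsetP sub) // Ee !inE eqxx orbT.
  by move=> /eqP-> /eqP->; rewrite setUid cards1.
Qed.

Lemma degreeE E v : (forall e, e \in E -> #|e| = 2) -> degree E v = \sum_u adj E v u.
Proof.
move=> E2; transitivity #|[set u | adj E v u]|; last first.
  by rewrite -sum1_card big_mkcond /=; apply: eq_bigr => u _; rewrite inE; case: adj.
have inj : injective (fun u => [set v; u]) by move=> a b /set2_eq [[_ ->]|[<- ->]].
rewrite -(card_imset _ inj) /degree; congr #|pred_of_set _|; apply/setP => e; rewrite inE.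
apply/andP/imsetP => [[eE ve]|[u]].
  by have [w _ Ew] := card2_other (E2 e eE) ve; exists w => //; rewrite inE /adj -Ew.
by rewrite inE => uE ->; split => //; rewrite !inE eqxx.
Qed.

Lemma weight_ofE E U W : (forall e, e \in E -> #|e| = 2) -> U != W ->
  weight_of E [set U; W] = \sum_u \sum_v ((blk u == U) && (blk v == W) && adj E u v).
Proof.
move=> E2 UW; rewrite ffunE pair_big /=.
pose A := [set uv : V * V | (blk uv.1 == U) && (blk uv.2 == W) && adj E uv.1 uv.2].
transitivity #|A|; last first.
  by rewrite -sum1_card big_mkcond /=; apply: eq_bigr => uv _; rewrite inE; case: ifP.
have inj : {in A &, injective (fun uv : V * V => [set uv.1; uv.2])}.
  move=> [a b] [a' b']; rewrite !inE /= => /andP[/andP[/eqP aU _] _] /andP[/andP[_ /eqP bW] _].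
  case/set2_eq => -[E1 E2']; first by rewrite E1 E2'.
  by move: UW; rewrite -aU -bW E1 eqxx.
rewrite -(card_in_imset inj); congr #|pred_of_set _|; apply/setP => e; rewrite inE.
apply/andP/imsetP => [[eE /eqP be]|[[u v]]]; last first.
  rewrite inE /= => /andP[/andP[/eqP uU /eqP vW] uvE] ->; split => //.
  by rewrite bone_of2 uU vW.
have /eqP/cards2P [u [v [_ Ee]]] := E2 e eE.
move: be; rewrite Ee bone_of2 => /set2_eq [[uU vW]|[uW vU]].
  by exists (u, v); rewrite // inE /= uU vW !eqxx /adj -Ee.
exists (v, u); last by rewrite setUC.
by rewrite inE /= uW vU !eqxx /adj setUC -Ee.
Qed.

(** Both sides count the edges with an end in [U]; none has two, because a bone joins distinct
    classes. *)
Lemma class_degree E U : drawn E ->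
  \sum_(b in B | U \in b) weight_of E b = \sum_(v | blk v == U) degree E v.
Proof.
move=> dr.
transitivity (\sum_(e in E) (U \in bone_of e)).
  under eq_bigr => b _ do rewrite ffunE -sum1_card.
  rewrite (exchange_big_dep [in E]) /=; last by move=> b e _; rewrite inE => /andP[].
  apply: eq_bigr => e eE; have [_ eB] := dr e eE.
  have [Ue|Ue] := boolP (U \in bone_of e).
    rewrite (bigD1 (bone_of e)) /=; last by rewrite eB Ue inE eE eqxx.
    rewrite big1 // => b /andP[/andP[_]]; rewrite inE eE /= => /eqP->.
    by rewrite eqxx.
  rewrite big_pred0 // => b; apply/negP => /andP[/andP[_ Ub]].
  by rewrite inE => /andP[_ /eqP be]; rewrite be Ub in Ue.
have -> : \sum_(v | blk v == U) degree E v = \sum_(v | blk v == U) \sum_(e in E) (v \in e).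
  apply: eq_bigr => v _; rewrite /degree -sum1_card big_mkcond [RHS]big_mkcond /=.
  by apply: eq_bigr => e _; rewrite inE; case: (e \in E) => //=; case: (v \in e).
rewrite exchange_big; apply: eq_bigr => e eE; have [e2 eB] := dr e eE.
have /eqP/cards2P [u [v [uv Ee]]] := e2.
have [/eqP b2 _] := simpleB eB.
have buv : blk u != blk v.
  by apply: contraTneq b2 => same; rewrite Ee bone_of2 same setUid cards1.
rewrite Ee bone_of2 !inE big_mkcond (bigD1 u) //= (bigD1 v) /=; last by rewrite eq_sym.
rewrite !inE !eqxx orbT big1; last first.
  by move=> x /andP[xu xv]; rewrite !inE (negbTE xu) (negbTE xv); case: ifP.
rewrite [U == _]eq_sym [U == blk v]eq_sym addn0.
by case: eqP => [<-|_]; case: eqP => // H; rewrite H eqxx in buv.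
Qed.

(** By [class_degree] the difference of the two weight functions sums to zero at every class. It
    vanishes at [beta], so [forest_weights] applies to the other bones. *)
Lemma weight_unique E E' beta : acyclic (B :\ beta) -> drawn E -> drawn E' ->
  (forall v, degree E v = degree E' v) -> weight_of E beta = weight_of E' beta ->
  weight_of E = weight_of E'.
Proof.
move=> aB dr dr' dE wb.
pose w b : int := ((weight_of E b)%:Z - (weight_of E' b)%:Z)%R.
have B2 b : b \in B -> #|b| = 2 by move=> /simpleB[].
have H := @forest_weights _ (B :\ beta) w _ aB.
have w0 : forall b, b \in B :\ beta -> w b = 0%R.
  apply: H => [b|U]; first by rewrite !inE => /andP[_ /B2].
  have : (\sum_(b in B | U \in b) w b = 0)%R.
    rewrite sumrB; apply/eqP; rewrite subr_eq0; apply/eqP.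
    have P E0 : (\sum_(b in B | U \in b) (weight_of E0 b)%:Z = (\sum_(b in B | U \in b) weight_of E0 b)%N%:Z)%R.
      by rewrite -[RHS]natz natr_sum; apply: eq_bigr => b _; rewrite natz.
    by rewrite !P !class_degree //; congr Posz; apply: eq_bigr => v _.
  move=> H0; rewrite -[RHS]H0 [RHS](bigID (pred1 beta)) [X in _ = (X + _)%R]big1; last first.
    by move=> b /andP[_ /eqP->]; rewrite /w wb subrr.
  rewrite add0r; apply: eq_bigl => b; rewrite !inE.
  by case: (b == beta); case: (b \in B); case: (U \in b).
apply/ffunP => b; have [->|bb] := eqVneq b beta; first exact: wb.
have [bB|bB] := boolP (b \in B).
  have : w b = 0%R by apply: w0; rewrite !inE bb.
  by rewrite /w => /eqP; rewrite subr_eq0 => /eqP [].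
have z E0 : drawn E0 -> weight_of E0 b = 0.
  move=> dr0; rewrite ffunE; apply/eqP; rewrite cards_eq0; apply/eqP/setP => e; rewrite !inE.
  by apply: contraNF bB => /andP[/dr0[_ eB] /eqP<-].
by rewrite !z.
Qed.
End Drawn.

(** * Instances and solutions *)

Lemma enc_seq_map (S T : Type) (f : T -> data) (g : S -> T) s :
  enc_seq f (map g s) = enc_seq (fun x => f (g x)) s.
Proof. by elim: s => //= x s ->. Qed.

Lemma enc_seq_eq_in (S : eqType) (f g : S -> data) s : {in s, f =1 g} -> enc_seq f s = enc_seq g s.
Proof.
elim: s => //= x s IH H; rewrite H ?inE ?eqxx // IH // => y ys; apply: H.
by rewrite inE ys orbT.
Qed.

Lemma table_eq_mx (I S : Type) (s : seq I) n (f : I -> I -> S) (g : nat -> nat -> S) :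
  n = size s ->
  (forall x0 i j, i < n -> j < n -> f (nth x0 s i) (nth x0 s j) = g i j) ->
  table f s = mx_of n g.
Proof.
move=> ->; case: s => // x0 s'; move: (x0 :: s') => s H.
have sE : s = [seq nth x0 s i | i <- iota 0 (size s)] by rewrite -[LHS](mkseq_nth x0).
rewrite [in LHS]sE /mx_of /table -map_comp; apply/eq_in_map => i; rewrite mem_iota /= add0n => Hi.
rewrite -map_comp; apply/eq_in_map => j; rewrite mem_iota /= add0n => Hj.
exact: H.
Qed.

Lemma table_comp (I S S' : Type) (h : S -> S') (f : I -> I -> S) s :
  [seq [seq h y | y <- r] | r <- table f s] = table (fun i j => h (f i j)) s.
Proof. by rewrite /table -map_comp; apply: eq_map => i /=; rewrite -map_comp. Qed.

Lemma enc_nat_matrix (M : seq (seq nat)) :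
  enc_seq (enc_seq enc_nat) M = enc [seq [seq nat_bits k | k <- r] | r <- M].
Proof.
have H (r : seq nat) : enc_seq enc_nat r = enc [seq nat_bits k | k <- r].
  by elim: r => // k r IH; rewrite [LHS]/= IH.
by elim: M => // r M IH; rewrite [LHS]/= IH H.
Qed.

Fixpoint bval (s : bitseq) : nat := if s is b :: s' then b + (bval s' + bval s') else 0.

Lemma bval_nat_bits k : bval (nat_bits k) = k.
Proof.
have H p : bval (pos_bits p) = nat_of_pos p.
  by elim: p => //= p ->; rewrite NatTrec.doubleE -addnn.
by rewrite /nat_bits -[RHS]bin_of_natK; case: (bin_of_nat k) => //= p.
Qed.

(** Truncation at [n] commutes with a Horner step, as a truncated value stays at least [n] after
    doubling. *)
Lemma cappedE n k : capped n (nat_bits k) = minn n k.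
Proof.
rewrite /capped foldl_rev -[in RHS](bval_nat_bits k).
by elim: (nat_bits k) => [|b s IH] /=; rewrite ?minn0 // IH; case: b => /=; lia.
Qed.

Section Instance.
Variables (V : finType) (Pi : {set {set V}}) (d : V -> nat) (B : {set {set {set V}}}).
Variables (vs : seq V) (cs : seq {set V}).
Hypothesis vsE : perm_eq vs (enum V).
Hypothesis csE : perm_eq cs (enum Pi).
Hypothesis part : partition Pi [set: V].
Hypothesis simpleB : simple_graph Pi B.

Definition raw_of : raw_instance := ([seq nat_bits (d v) | v <- vs],
  ([seq [seq v \in U | v <- vs] | U : {set V} <- cs], table (adj B) cs)).
Let x := raw_of.
Let n := size x.1.
Let m := size x.2.1.
Let blk := pblock Pi.

Lemma enc_raw : enc_instance vs cs d B = enc x.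
Proof.
rewrite /enc_instance /enc /encodable_prod /=; congr Node.
by rewrite /enc /encodable_seq /enc /encodable_seq /enc !enc_seq_map.
Qed.

Lemma nE : n = size vs. Proof. by rewrite /n size_map. Qed.
Lemma mE : m = size cs. Proof. by rewrite /m size_map. Qed.

Lemma uniq_vs : uniq vs. Proof. by rewrite (perm_uniq vsE) enum_uniq. Qed.
Lemma uniq_cs : uniq cs. Proof. by rewrite (perm_uniq csE) enum_uniq. Qed.
Lemma mem_vs v : v \in vs. Proof. by rewrite (perm_mem vsE) mem_enum. Qed.
Lemma mem_cs U : (U \in cs) = (U \in Pi). Proof. by rewrite (perm_mem csE) mem_enum. Qed.

Definition vx (i : 'I_n) : V := tnth (in_tuple vs) (cast_ord nE i).

Lemma vxE v0 i : vx i = nth v0 vs i. Proof. by rewrite /vx (tnth_nth v0). Qed.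

Lemma vx_index_lt v : index v vs < n. Proof. by rewrite nE index_mem mem_vs. Qed.

Definition vxi v : 'I_n := Ordinal (vx_index_lt v).

Lemma vxK : cancel vx vxi.
Proof.
by move=> i; apply: val_inj; rewrite /= (vxE (vx i)) index_uniq ?uniq_vs // -nE.
Qed.

Lemma vxiK : cancel vxi vx.
Proof. by move=> v; rewrite (vxE v) nth_index ?mem_vs. Qed.

Lemma sum_vx (R : nmodType) (F : V -> R) : (\sum_v F v = \sum_i F (vx i))%R.
Proof. by apply: reindex; exists vxi => i _; [apply: vxK | apply: vxiK]. Qed.

Definition cls a : {set V} := nth set0 cs a.
Definition cl (i : 'I_n) : nat := index (blk (vx i)) cs.

Lemma cl_lt i : cl i < m.
Proof. by rewrite mE index_mem mem_cs blk_in. Qed.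

Lemma cls_cl i : cls (cl i) = blk (vx i).
Proof. by rewrite /cls nth_index // mem_cs blk_in. Qed.

Lemma cls_in a : a < m -> cls a \in Pi.
Proof. by rewrite mE => H; rewrite -mem_cs mem_nth. Qed.

(** The junk index [m] is included: there [cls] returns its default, the empty set. *)
Lemma mem_cls a i : a <= m -> (vx i \in cls a) = (cl i == a).
Proof.
rewrite leq_eqVlt => /orP[/eqP->|am].
  by rewrite /cls nth_default -?mE // inE ltn_eqF ?cl_lt.
rewrite -(blkE part) ?cls_in // -/blk -cls_cl /cls nth_uniq ?uniq_cs -?mE ?cl_lt //.
Qed.

Lemma degs_nth (i : 'I_n) : nth 0 (raw_degs x) i = minn n (d (vx i)).
Proof.
rewrite /raw_degs (nth_map [::]) // (nth_map (vx i)) -?nE // cappedE.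
by rewrite -vxE.
Qed.

Lemma inc_entry a (i : 'I_n) : entry false x.2.1 a i = (vx i \in cls a).
Proof.
rewrite /entry /=; have [am|ma] := ltnP a m.
  by rewrite (nth_map set0) -?mE // (nth_map (vx i)) -?nE // -vxE.
by rewrite [nth [::] _ _]nth_default // nth_nil /cls nth_default -?mE // inE.
Qed.

Lemma adj_entry a b : a < m -> b < m -> entry false x.2.2 a b = adj B (cls a) (cls b).
Proof. by move=> Ha Hb; rewrite /entry /= /table (nth_map set0) -?mE // (nth_map set0) -?mE. Qed.

Definition bone a b := [&& a < m, b < m & adj B (cls a) (cls b)].

Lemma bone_sym : symmetric bone.
Proof. by move=> a b; rewrite /bone adj_sym andbCA. Qed.

Lemma adjBxx U : adj B U U = false.
Proof. by apply/negP => /simpleB []; rewrite setUid cards1. Qed.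

Lemma bone_irr : irreflexive bone.
Proof. by move=> a; rewrite /bone adjBxx !andbF. Qed.

Lemma host_relE i j : rel_of n (raw_host x) i j = host_rel cl bone i j.
Proof.
rewrite rel_of_mx /host_rel; apply/hasP/idP => [[a]|].
  rewrite mem_iota /= add0n => am /hasP [b]; rewrite mem_iota /= add0n => bm.
  rewrite !inc_entry adj_entry // !mem_cls ?(ltnW am) ?(ltnW bm) //.
  by case/andP => /andP[/eqP-> /eqP->] H; rewrite /bone am bm.
move=> /and3P[im jm H]; exists (cl i); first by rewrite mem_iota.
apply/hasP; exists (cl j); first by rewrite mem_iota.
by rewrite !inc_entry adj_entry // !mem_cls ?eqxx ?(ltnW im) ?(ltnW jm).
Qed.

Lemma mask_relE a0 b0 i j : a0 <= m -> b0 <= m ->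
  rel_of n (raw_mask x a0 b0) i j = (cl i == a0) && (cl j == b0).
Proof. by move=> Ha Hb; rewrite rel_of_mx !inc_entry !mem_cls. Qed.

Definition graph_of (E : bmatrix) : {set {set V}} := edge_set (fun u v => rel_of n E (vxi u) (vxi v)).

Definition is_result (E : bmatrix) :=
  [/\ symmetric (rel_of n E), forall i j, rel_of n E i j -> host_rel cl bone i j,
      E = mx_of n (entry false E) & forall i, \sum_j rel_of n E i j = d (vx i)].

Section Result.
Variable E : bmatrix.
Hypothesis resE : is_result E.

Lemma graph_adj i j : adj (graph_of E) (vx i) (vx j) = rel_of n E i j.
Proof.
case: resE => s _ _ _; rewrite /adj mem_edge_set ?vxK // => u v; exact: s.
Qed.

Lemma graph_of_drawn : drawn Pi B (graph_of E).
Proof.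
case: resE => _ h _ _; move=> e /edge_setP [u [v [-> /h]]]; rewrite /host_rel => /and3P[_ _].
rewrite !cls_cl !vxiK bone_of2 => H; split => //.
rewrite cards2; case: eqP => // uv; by rewrite uv adjBxx in H.
Qed.

Lemma graph_of_degree v : degree (graph_of E) v = d v.
Proof.
case: resE => _ _ _ dE; have dr := graph_of_drawn.
rewrite degreeE; last by move=> e /dr[].
rewrite -(vxiK v) -dE (sum_vx (fun u => nat_of_bool (adj (graph_of E) (vx (vxi v)) u))).
by apply: eq_bigr => j _; rewrite graph_adj.
Qed.

Lemma graph_of_consistent : consistent_realization Pi B d (weight_of Pi (graph_of E)) (graph_of E).
Proof. by apply: drawn_consistent => //; [exact: graph_of_drawn | exact: graph_of_degree]. Qed.
End Result.

Lemma weight_index (F : {set {set V}}) a b : (forall e, e \in F -> #|e| = 2) -> a < m -> b < m -> a != b ->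
  weight_of Pi F [set cls a; cls b] =
    \sum_i \sum_j ((cl i == a) && (cl j == b) && adj F (vx i) (vx j)).
Proof.
move=> F2 am bm ab; rewrite weight_ofE //; last first.
  by rewrite /cls nth_uniq ?uniq_cs -?mE.
rewrite (sum_vx (fun u => \sum_v (((pblock Pi u == cls a) && (pblock Pi v == cls b) && adj F u v) : nat))).
apply: eq_bigr => i _.
rewrite (sum_vx (fun v => ((pblock Pi (vx i) == cls a) && (pblock Pi v == cls b) && adj F (vx i) v) : nat)).
by apply: eq_bigr => j _; rewrite !(blkE part) ?cls_in // !mem_cls // ltnW.
Qed.

Lemma enc_graph_result E : is_result E -> enc_graph vs (graph_of E) = enc E.
Proof.
move=> res; have [_ _ Emx _] := res; rewrite [in RHS]Emx.
rewrite /enc_graph /enc_matrix (@table_eq_mx _ _ vs n _ (entry false E)) //; first exact: nE.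
move=> v0 i j Hi Hj; have := graph_adj res (Ordinal Hi) (Ordinal Hj).
by rewrite !(vxE v0).
Qed.

Lemma enc_weight_result E : is_result E ->
  enc_weight cs (weight_of Pi (graph_of E)) = enc (raw_weights x E).
Proof.
move=> res; have [_ hE _ _] := res; have dr := graph_of_drawn res.
rewrite /enc_weight /enc_matrix.
rewrite enc_nat_matrix.
congr enc; rewrite table_comp; apply: table_eq_mx; first exact: mE.
move=> x0 a b Ha Hb; rewrite binaryE; congr nat_bits.
have nthE k : k < m -> nth x0 cs k = cls k by move=> H; apply: set_nth_default; rewrite -mE.
rewrite !nthE // nsumE.
have -> : \sum_(i < size x.1) nsum (size x.1) (fun j => entry false x.2.1 a i && entry false x.2.1 b j && entry false E i j) =
    \sum_(i < n) \sum_(j < n) ((cl i == a) && (cl j == b) && rel_of n E i j).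
  apply: eq_bigr => i _; rewrite nsumE; apply: eq_bigr => j _.
  by rewrite !inc_entry !mem_cls ?(ltnW Ha) ?(ltnW Hb).
have [ab|ab] := eqVneq a b.
  rewrite ab setUid big1; last first.
    move=> i _; rewrite big1 // => j _; case: eqP => // ci; case: eqP => //= cj.
    by apply/eqP; rewrite eqb0; apply/negP => /hE; rewrite /host_rel ci cj bone_irr.
  rewrite ffunE; apply/eqP; rewrite cards_eq0; apply/eqP/setP => e; rewrite in_set in_set0.
  apply/negP => /andP[/dr[_ eB] /eqP be]; have [] := simpleB eB; by rewrite be cards1.
have F2 e : e \in graph_of E -> #|e| = 2 by move=> /dr[].
rewrite (weight_index F2 Ha Hb ab).
by apply: eq_bigr => i _; apply: eq_bigr => j _; rewrite graph_adj.
Qed.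

Lemma valid_result a b t : let E := (solve (raw_base x a b t, raw_host x)).1 in
  valid n (raw_degs x) E -> is_result E.
Proof.
move=> E; rewrite /valid all_iota => /forallP val.
have hs : symmetric (rel_of n (raw_host x)).
  by move=> i j; rewrite !host_relE /host_rel bone_sym.
have [s1 _ h1 _ [f Ef]] := @solve_sound (raw_base x a b t) (raw_host x) hs.
have h2 i j : rel_of n E i j -> host_rel cl bone i j by move=> /h1; rewrite -host_relE.
split => //.
  rewrite [LHS]Ef; apply/eq_in_map => i; rewrite mem_iota /= add0n => Hi.
  apply/eq_in_map => j; rewrite mem_iota /= add0n => Hj.
  by rewrite /E Ef entry_mx_of.
move=> i; have := val i; rewrite nsumE degs_nth => /eqP H.
(* Without loops a row sum is below [n], so a sum equal to the truncated degree is equal to the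
   degree itself. *)
have lt : \sum_j rel_of n E i j < n.
  rewrite (bigD1 i) //=.
  have -> : rel_of n E i i = false by apply/negP => /h2; rewrite /host_rel bone_irr.
  rewrite add0n; apply: (@leq_ltn_trans (\sum_(j < n | j != i) 1)).
    by apply: leq_sum => j _; apply: leq_b1.
  rewrite sum1_card cardC1 card_ord ltn_predL; exact: leq_ltn_trans (ltn_ord i).
have H' : \sum_j rel_of n E i j = minn n (d (vx i)) by [].
by move: lt; rewrite H'; lia.
Qed.

Definition solutions : seq bmatrix := [seq E <- candidates x | valid n (raw_degs x) E].

Lemma solution_result E : E \in solutions -> is_result E.
Proof.
rewrite mem_filter => /andP[val /flatten_mapP [a _ /flatten_mapP [b _ /mapP [t _ EE]]]].
by move: val; rewrite EE; apply: valid_result.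
Qed.

Definition output : seq ({ffun {set {set V}} -> nat} * {set {set V}}) :=
  [seq (weight_of Pi (graph_of E), graph_of E) | E <- solutions].

Lemma enc_output_main : enc_output vs cs output = enc (main x).
Proof.
rewrite /enc_output /output /main -/solutions /enc /encodable_seq !enc_seq_map.
apply: enc_seq_eq_in => E /solution_result res /=.
by rewrite (enc_weight_result res) (enc_graph_result res).
Qed.

Lemma output_sound w E : (w, E) \in output -> consistent_realization Pi B d w E.
Proof. by case/mapP => F /solution_result res [-> ->]; apply: graph_of_consistent. Qed.

(** The graph [F] witnesses that its own guess is feasible. Its edge count [t] is at most [n * n],
    so this guess is among those tried. *)
Lemma solve_output (F : {set {set V}}) a0 b0 c (sigma : nat -> int) t : drawn Pi B F -> (forall v, degree F v = d v) ->
  a0 <= m -> b0 <= m -> (`|c| <= 2)%R -> (forall a, `|sigma a| = 1)%R ->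
  (forall a1 a2, bone a1 a2 -> sigma a1 + sigma a2 =
     c * ((a1 == a0) && (a2 == b0) || (a2 == a0) && (a1 == b0))%:R)%R ->
  \sum_i \sum_j ((cl i == a0) && (cl j == b0) && adj F (vx i) (vx j)) = t ->
  let E := (solve (raw_base x a0 b0 t, raw_host x)).1 in
  E \in solutions /\ \sum_i \sum_j ((cl i == a0) && (cl j == b0) && adj (graph_of E) (vx i) (vx j)) = t.
Proof.
move=> dr dF Ha Hb Hc Hs Hsb Ht E.
have F2 e : e \in F -> #|e| = 2 by move=> /dr[].
have rowF i : \sum_j adj F (vx i) (vx j) = d (vx i).
  by rewrite -dF degreeE // (sum_vx (fun u => nat_of_bool (adj F (vx i) u))).
have dle i : d (vx i) <= n.
  rewrite -rowF -[n in X in _ <= X]card_ord -sum1_card; apply: leq_sum => j _; exact: leq_b1.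
pose mk a b := (a == a0) && (b == b0).
have feas : @feasible_between (raw_base x a0 b0 t) (mx_of n (fun _ _ => false)) (raw_host x).
  exists (fun i j => adj F (vx i) (vx j)); split.
  - by move=> i j; apply: adj_sym.
  - by move=> i j; rewrite rel_of_mx.
  - move=> i j /dr [_]; rewrite bone_of2 host_relE /host_rel /bone !cl_lt !cls_cl //.
  - by move=> i; rewrite rowF degs_nth (minn_idPr (dle i)).
  - by rewrite -[RHS]Ht; apply: eq_bigr => i _; apply: eq_bigr => j _; rewrite mask_relE.
have [] := @solve_complete (raw_base x a0 b0 t) (raw_host x) cl bone mk sigma c host_relE _
  bone_sym bone_irr _ Hs Hc Hsb feas.
- by move=> i j; rewrite mask_relE.
- by move=> a1 b1 a2 b2 /andP[/eqP-> /eqP->] /andP[/eqP-> /eqP->].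
rewrite -/E => rowE maskE'.
have val : valid n (raw_degs x) E.
  by rewrite /valid all_iota; apply/forallP => i; rewrite nsumE; apply/eqP; apply: (rowE i).
have tn : t <= n * n.
  rewrite -Ht; apply: (@leq_trans (\sum_(i < n) n)); last by rewrite sum_nat_const card_ord.
  apply: leq_sum => i _; apply: (@leq_trans (\sum_(j < n) 1)); last by rewrite sum1_card card_ord.
  by apply: leq_sum => j _; apply: leq_b1.
split.
  rewrite mem_filter val /=; apply/flatten_mapP; exists a0; first by rewrite mem_iota ltnS.
  apply/flatten_mapP; exists b0; first by rewrite mem_iota ltnS.
  by apply/mapP; exists t; rewrite // mem_iota ltnS.
have res := valid_result val.
rewrite -[RHS]maskE'; apply: eq_bigr => i _; apply: eq_bigr => j _.
by rewrite (graph_adj res) mask_relE.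
Qed.

(** The algorithm need not find [F]: any realization with the same weight on the guessed bone has
    all weights equal, by [weight_unique]. *)
Lemma output_complete w : at_most_one_cycle B -> (exists E, consistent_realization Pi B d w E) ->
  exists E, (w, E) \in output.
Proof.
move=> oneB [F /(consistent_drawn part simpleB) [dr dF ->]].
have F2 e : e \in F -> #|e| = 2 by move=> /dr[].
have B2 b : b \in B -> #|b| = 2 by move=> /simpleB[].
have finish a0 b0 c (sigma : nat -> int) t beta :
  a0 <= m -> b0 <= m -> (`|c| <= 2)%R -> (forall a, `|sigma a| = 1)%R ->
  (forall a1 a2, bone a1 a2 -> sigma a1 + sigma a2 =
     c * ((a1 == a0) && (a2 == b0) || (a2 == a0) && (a1 == b0))%:R)%R ->
  \sum_i \sum_j ((cl i == a0) && (cl j == b0) && adj F (vx i) (vx j)) = t ->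
  acyclic (B :\ beta) ->
  (forall E, drawn Pi B E -> \sum_i \sum_j ((cl i == a0) && (cl j == b0) && adj E (vx i) (vx j)) = t ->
     weight_of Pi E beta = t) ->
  exists E, (weight_of Pi F, E) \in output.
  move=> Ha Hb Hc Hs Hsb Ht aB Hbeta.
  have [sol tE] := solve_output dr dF Ha Hb Hc Hs Hsb Ht.
  move: sol tE; set E := (solve _).1 => sol tE; have res := solution_result sol.
  exists (graph_of E); apply/mapP; exists E => //; congr (_, _).
  have drE := graph_of_drawn res.
  apply: (weight_unique simpleB aB dr drE); last by rewrite !Hbeta.
  by move=> v; rewrite dF graph_of_degree.
pose sgn (sg : {set V} -> bool) (a : nat) : int := ((-1) ^+ sg (cls a))%R.
have sgn1 sg a : (`|sgn sg a| = 1)%R by rewrite normr_sign.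
have [aB|[U [W [bB aB]]]] := break_cycle oneB.
  have [sg Hsg] := forest_coloring B2 aB.
  (* A forest requires no guess. The junk indices empty the mask, and [set0], which is not a bone
     and so has weight 0, serves as [beta]. *)
  apply: (@finish m m 0%R (sgn sg) 0 set0) => //.
  - move=> a1 a2 /and3P[_ _ /Hsg]; rewrite /sgn mul0r.
    by case: (sg (cls a1)); case: (sg (cls a2)).
  - by rewrite big1 // => i _; rewrite big1 // => j _; rewrite ltn_eqF ?cl_lt.
  - by apply: acyclic_sub aB; apply: subD1set.
  - move=> E drE _; rewrite ffunE; apply/eqP; rewrite cards_eq0; apply/eqP/setP => e; rewrite !inE.
    by apply/negP => /andP[/drE[_ /B2 b2] /eqP be]; rewrite be cards0 in b2.
have [c2 sub] := simpleB bB.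
have UW : U != W by apply: contraTneq bB => ->; rewrite -/(adj B W W) adjBxx.
have UP : U \in cs by rewrite mem_cs (subsetP sub) // !inE eqxx.
have WP : W \in cs by rewrite mem_cs (subsetP sub) // !inE eqxx orbT.
have clsU : cls (index U cs) = U by apply: nth_index.
have clsW : cls (index W cs) = W by apply: nth_index.
have Um : index U cs < m by rewrite mE index_mem.
have Wm : index W cs < m by rewrite mE index_mem.
have B2' b : b \in B :\ [set U; W] -> #|b| = 2 by rewrite inE => /andP[_ /B2].
have [sg Hsg] := forest_coloring B2' aB.
(* The colouring is that of the forest left after removing the bone [[set U; W]], so [c] is 0 or has
   absolute value 2. The guessed [t] is the count for [F]. *)
apply: (@finish (index U cs) (index W cs) (sgn sg (index U cs) + sgn sg (index W cs))%R (sgn sg) _ [set U; W]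
   (ltnW Um) (ltnW Wm) _ _ _ erefl aB).
- by apply: le_trans (ler_normD _ _) _; rewrite !sgn1.
- by move=> a; apply: sgn1.
- move=> a1 a2 /and3P[m1 m2 a12].
  have cls_inj a b : a < m -> b < m -> cls a = cls b -> a = b.
    by move=> am bm /eqP; rewrite /cls nth_uniq ?uniq_cs -?mE // => /eqP.
  have [E|ne] := eqVneq [set cls a1; cls a2] [set U; W].
    case: (set2_eq E) => -[E1 E2]; rewrite -clsU -clsW in E1 E2.
      by rewrite (cls_inj _ _ m1 Um E1) (cls_inj _ _ m2 Wm E2) !eqxx mulr1.
    by rewrite (cls_inj _ _ m1 Wm E1) (cls_inj _ _ m2 Um E2) !eqxx orbT mulr1 addrC.
  have -> : (a1 == index U cs) && (a2 == index W cs) || (a2 == index U cs) && (a1 == index W cs) = false.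
    apply: contraNF ne => /orP[]/andP[/eqP-> /eqP->]; rewrite clsU clsW //.
    by rewrite setUC.
  have /Hsg : [set cls a1; cls a2] \in B :\ [set U; W] by rewrite !inE ne.
  by rewrite mulr0 /sgn; case: (sg (cls a1)); case: (sg (cls a2)).
- move=> E drE <-; have E2 e : e \in E -> #|e| = 2 by move=> /drE[].
  rewrite -{1}clsU -{1}clsW (weight_index E2 Um Wm) //.
  by apply: contraNneq UW => H; rewrite -clsU H clsW.
Qed.
End Instance.

Theorem theorem4p6 :
  exists (p : cmd) (q : {poly nat}),
  forall (V : finType) (Pi : {set {set V}}) (d : V -> nat)
         (B : {set {set {set V}}}) (vs : seq V) (cs : seq {set V}),
    perm_eq vs (enum V) ->
    perm_eq cs (enum Pi) ->
    partition Pi [set: V] ->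
    (forall v, 0 < d v) ->
    simple_graph Pi B ->
    connected_graph Pi B ->
    at_most_one_cycle B ->
    exists (L : seq ({ffun {set {set V}} -> nat} * {set {set V}})) (t : nat),
      [/\ computes p (enc_instance vs cs d B) (enc_output vs cs L) t,
          t <= (q.[dsize (enc_instance vs cs d B)])%R,
          forall w E, (w, E) \in L -> consistent_realization Pi B d w E
        & forall w, (exists E, consistent_realization Pi B d w E) ->
            exists E, (w, E) \in L].
Proof.
have [p [q Hpq]] := ptime_computes ptime_main.
exists p, q => V Pi d B vs cs vsE csE part _ simpleB _ oneB.
have [t [Ct Lt]] := Hpq (raw_of d B vs cs).
exists (output Pi d B cs vsE), t; split.
- by rewrite enc_output_main // enc_raw.
- by rewrite enc_raw.
- exact: output_sound.
- by move=> w; apply: output_complete.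
Qed.
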